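(* Let $w:I\to(0,\infty)$ be a decreasing weight on $I=(0,a)$, $0<a\le\infty$, with $W(t)=\int_0^t w\,dm<\infty$ for all $t\in I$. Let $b=\int_I w\,dm\in(0,\infty]$, $J=(0,b)$. For any fully symmetric Banach function space $E$ on $J$ with support $J$, we have $(\Lambda_{E,w})'=P_{E',w}$ isometrically.
   Context: $m$ is Lebesgue measure; functions are identified when equal a.e.; ''decreasing'' means non-increasing. $L^0(I)$ is the space of real Lebesgue measurable functions on $I$. For a measure $\mu$ and a $\mu$-measurable $f$ on $\Omega$, $d_f^\mu(s)=\mu\{|f|>s\}$ and $f^{*,\mu}(t)=\inf\{s>0:d_f^\mu(s)\le t\}$ for $0\le t<\mu(\Omega)$; $f^*$ is the rearrangement for $\mu=m$. For functions on the same interval ($I$ or $J$), $f\prec g$ means $\int_0^x f^*\,dm\le\int_0^x g^*\,dm$ for all $x$ in the interval. A Banach function space on an interval is a solid linear subspace $E$ of $L^0$ with full support, complete under a monotone norm ($|f|\le|g|$ a.e. implies $\|f\|_E\le\|g\|_E$). It is fully symmetric if equimeasurable functions have equal norms and $f\prec g$, $f\in L^0$, $g\in E$ imply $f\in E$ and $\|f\|_E\le\|g\|_E$. ''Support $J$'' means $\chi_A\in E$ whenever $m(A)<\infty$. The Köthe dual $F'$ of a Banach function space $F$ (on $J$ or $I$, Lebesgue measure) is the set of measurable $f$ with $\|f\|_{F'}=\sup\{\int|fg|\,dm:\|g\|_F\le1\}<\infty$. For a positive decreasing weight $v$ on $I$ with $v\prec w$ (in particular $v=w$), $f^{*,v}$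 is the decreasing rearrangement of $f$ with respect to the measure $v\,dm$ on $I$; it is a function on $(0,\int_I v\,dm)\subset J$, regarded as a function on $J$ by extending it by $0$. For a fully symmetric space $F$ on $J$: $F_v=\{f\in L^0(I):f^{*,v}\in F\}$, $\|f\|_{F_v}=\|f^{*,v}\|_F$; $M_{F,v}=\{f\in L^0(I): f^*/v\in F_v\}$ with gauge $\|f\|_{M_{F,v}}=\|f^*/v\|_{F_v}$ (and $\|f\|_{M_{F,v}}=\infty$ if $f\notin M_{F,v}$); $\Lambda_{F,w}=\{f\in L^0(I):f^*\in F_w\}$, $\|f\|_{\Lambda_{F,w}}=\|f^*\|_{F_w}$. $P_{F,w}$ is the union of the classes $M_{F,v}$ over all positive decreasing weights $v$ on $I$ with $v\prec w$, with gauge $\|f\|_{P_{F,w}}=\inf\{\|f\|_{M_{F,v}}: v>0,\ v\text{ decreasing},\ v\prec w\}$. *)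

(* Defs.v *)
From HB Require Import structures.
From mathcomp Require Import all_boot all_order all_algebra.
From mathcomp Require Import all_classical all_reals all_analysis.

Set Implicit Arguments.
Unset Strict Implicit.
Unset Printing Implicit Defensive.

Import Order.TTheory GRing.Theory Num.Theory.
Import numFieldNormedType.Exports.

Local Open Scope classical_set_scope.
Local Open Scope ring_scope.
Local Open Scope ereal_scope.

(* The real line with the sigma-algebra of Lebesgue measurable sets (the plain
   instance on R is the Borel one). *)
Definition lebesgue_type (R : realType) : measurableType _ :=
  caratheodory_type ((wlength (R := R) idfun)^*)%mu.

Notation leb := completed_lebesgue_measure.

Section rearrangement.
Context {R : realType}.
Implicit Types (a : \bar R) (A D : set R) (f g v w : R -> R).

Definition interval0 a : set R := [set x | (0 < x)%R /\ x%:E < a].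

Definition lebesgue_measurable A := measurable (A : set (lebesgue_type R)).

(* Functions on an interval D are represented by total functions whose values
   outside D are never looked at; functions that agree a.e. on D are not
   quotiented, but every notion below is invariant under this relation. *)
Definition L0 D : set (R -> R) :=
  [set f | measurable_fun (D : set (lebesgue_type R)) f].

Definition ae_on D (P : R -> Prop) := {ae @leb R, forall x, D x -> P x}.

Definition density v A : \bar R := \int[leb]_(x in A) (v x)%:E.

Definition tail (mu : set R -> \bar R) D f (s : R) : \bar R :=
  mu (D `&` [set x | (s < `|f x|)%R]).

(* The rearrangement takes the value +oo when no s qualifies. For t >= mu D
   every s > 0 qualifies and the value is 0, so this formula contains the
   extension by 0 of the rearrangement beyond mu D. *)
Definition rearr (mu : set R -> \bar R) D f (t : R) : \bar R :=
  ereal_inf [set s%:E | s in [set s : R | (0 < s)%R /\ tail mu D f s <= t%:E]].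

Definition equimeasurable D f g :=
  forall s : R, (0 < s)%R -> tail leb D f s = tail leb D g s.

Definition prec D f g := forall x, D x ->
  \int[leb]_(t in `]0%R, x]) rearr leb D f t <=
  \int[leb]_(t in `]0%R, x]) rearr leb D g t.

Definition pos_decreasing D v :=
  (forall x, D x -> (0 < v x)%R) /\
  (forall x y, D x -> D y -> (x <= y)%R -> (v y <= v x)%R).

End rearrangement.

(* A class of functions together with a gauge. *)
Record fspace (R : realType) := FSpace {
  carrier : set (R -> R) ;
  gauge : (R -> R) -> \bar R }.

Section function_spaces.
Context {R : realType}.
Implicit Types (D I J : set R) (E F : fspace R) (f g v w : R -> R).

Record banach_function_space D E : Prop := {
  bfs_measurable : carrier E `<=` L0 D ;
  bfs_0 : carrier E (cst 0%R) ;
  bfs_add : forall f g, carrier E f -> carrier E g ->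
    carrier E (fun x => f x + g x)%R ;
  bfs_scale : forall (c : R) f, carrier E f -> carrier E (fun x => c * f x)%R ;
  bfs_solid : forall f g, L0 D f -> carrier E g ->
    ae_on D (fun x => `|f x| <= `|g x|)%R -> carrier E f ;
  bfs_full_support : forall A, lebesgue_measurable A -> A `<=` D ->
    0 < leb A -> exists2 f, carrier E f & ~ ae_on A (fun x => f x = 0%R) ;
  bfs_fin : forall f, carrier E f -> 0 <= gauge E f < +oo ;
  bfs_eq0 : forall f, carrier E f -> gauge E f = 0 ->
    ae_on D (fun x => f x = 0%R) ;
  bfs_normZ : forall (c : R) f, carrier E f ->
    gauge E (fun x => c * f x)%R = `|c|%:E * gauge E f ;
  bfs_normD : forall f g, carrier E f -> carrier E g ->
    gauge E (fun x => f x + g x)%R <= gauge E f + gauge E g ;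
  bfs_monotone : forall f g, carrier E f -> carrier E g ->
    ae_on D (fun x => `|f x| <= `|g x|)%R -> gauge E f <= gauge E g ;
  bfs_complete : forall u : nat -> R -> R, (forall n, carrier E (u n)) ->
    (forall e : R, (0 < e)%R -> exists N, forall m n, (N <= m)%N -> (N <= n)%N ->
      gauge E (fun x => u m x - u n x)%R <= e%:E) ->
    exists2 f, carrier E f &
      forall e : R, (0 < e)%R -> exists N, forall n, (N <= n)%N ->
        gauge E (fun x => u n x - f x)%R <= e%:E }.

Record fully_symmetric D E : Prop := {
  fs_bfs : banach_function_space D E ;
  fs_equimeasurable : forall f g, carrier E f -> carrier E g ->
    equimeasurable D f g -> gauge E f = gauge E g ;
  fs_prec : forall f g, L0 D f -> carrier E g -> prec D f g ->
    carrier E f /\ gauge E f <= gauge E g }.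

Definition has_support J E := forall A, lebesgue_measurable A -> A `<=` J ->
  leb A < +oo -> carrier E (\1_A : R -> R).

Definition kothe_gauge D F f : \bar R :=
  ereal_sup [set \int[leb]_(x in D) `|f x * g x|%:E |
             g in [set g | carrier F g /\ gauge F g <= 1]].

Definition kothe_dual D F : fspace R :=
  FSpace [set f | L0 D f /\ kothe_gauge D F f < +oo] (kothe_gauge D F).

(* Membership in F of an extended real function, such as a rearrangement: it
   must be a.e. finite, and it is then identified with the real function
   fine \o h. *)
Definition emem D F (h : R -> \bar R) :=
  ae_on D (fun x => h x \is a fin_num) /\ carrier F (fine \o h).

(* The class C with the gauge N, extended by +oo outside of C. *)
Definition guarded (C : set (R -> R)) (N : (R -> R) -> \bar R) : fspace R :=
  FSpace C (fun f => if `[< C f >] then N f else +oo).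

(* F is a space on J; the three spaces below are spaces on I. *)
Definition weighted_space I J F v : fspace R :=
  let fstar f := rearr (density v) I f in
  guarded [set f | L0 I f /\ emem J F (fstar f)]
          (fun f => gauge F (fine \o fstar f)).

Definition Mspace I J F v : fspace R :=
  let Fv := weighted_space I J F v in
  let h f x := rearr leb I f x * ((v x)^-1)%:E in
  guarded [set f | L0 I f /\ emem I Fv (h f)] (fun f => gauge Fv (fine \o h f)).

Definition Lambda I J F w : fspace R :=
  let Fw := weighted_space I J F w in
  let fstar f := rearr leb I f in
  guarded [set f | L0 I f /\ emem I Fw (fstar f)]
          (fun f => gauge Fw (fine \o fstar f)).

Definition admissible I w v := pos_decreasing I v /\ prec I v w.

Definition Pspace I J F w : fspace R :=
  FSpace [set f | exists2 v, admissible I w v & carrier (Mspace I J F v) f]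
         (fun f => ereal_inf [set gauge (Mspace I J F v) f |
                              v in [set v | admissible I w v]]).

Definition isometrically_equal F G :=
  carrier F = carrier G /\ forall f, carrier F f -> gauge F f = gauge G f.

End function_spaces.

(* Main.v *)
(** Write [f#] and [f#v] for the decreasing rearrangements of [f] with respect to
    Lebesgue measure and to [v dm], and [F], [W], [V] for the primitives of [f#],
    [w], [v].

    If [v] is decreasing and [V <= W], then the Hardy-Littlewood inequality, used
    once for Lebesgue measure and once for [v dm], bounds the integral of [|f g|]
    by that of [(f#/v)#v (g#)#v]; since the level sets of [g#] are initial
    intervals, [(g#)#v <= (g#)#w], so the gauge of [f] for any admissible [v]
    dominates its dual norm.

    Conversely let [f] have dual norm [N], and let [phi] be the slope of the least
    concave majorant of [F] as a function of [W] (Halperin's level function). The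
    weight [v = f#/phi] ([v = w] where [phi = 0]) is decreasing and satisfies
    [V <= W], and [f#/v = phi] is decreasing. For [h] in the unit ball of [E], cut
    [I] at the last maximum points of [F - l W], with [l] in a geometric
    progression of ratio [r]. On each cell [phi] is at most [r] times the chord
    slope of [F] against [W]. Replacing [h#] by its averages [k] over the images of
    the cells under [W], which only makes it smaller in the Hardy-Littlewood-Polya
    order, therefore bounds the integral of [phi#v h#] by [r] times that of
    [f# (k o W)], hence by [r N]; finally [r] tends to 1. *)

Require Import Defs.
From HB Require Import structures.
From mathcomp Require Import all_boot all_order all_algebra.
From mathcomp Require Import all_classical all_reals all_analysis.
From mathcomp Require Import measurable_realfun ring lra.

Set Implicit Arguments.
Unset Strict Implicit.
Unset Printing Implicit Defensive.

Import Order.TTheory GRing.Theory Num.Theory.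
Import numFieldNormedType.Exports.

Local Open Scope classical_set_scope.
Local Open Scope ring_scope.
Local Open Scope ereal_scope.

(** * Lebesgue measurability and layer cakes *)

(** Why [v] is decreasing: if [x] is the last maximum point of [F - l W], comparing chords on both
    sides gives [f# >= l w(x)] before [x] and [f# <= l w(x)] after it, so [w(x)] separates the
    values of [v] wherever [phi] drops; where [phi] is constant, [v] is a multiple of [f#] or equals
    [w]. Why [V <= W]: between the last maximum points for the slopes [r l] and [l], one has
    [phi >= l] while the chord slope of [F] against [W] is at most [r l], so [v] has there at most
    [r] times the mass of [w]. Three obstacles shape the rest. [phi] may blow up at 0 and is known
    only through maximum points, so all estimates run over finite chains of cells away from the
    ends, and limits come afterwards. The dual norm pairs with [|f|], which need not attain its
    rearrangement when [I] is infinite, so test functions live on nested sets that carry almost all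
    of the integral of [f#]. Finally, local integrability of [f#] is not given: it is extracted from
    the dual norm by a one-cell test on truncations of [f]. *)

Section lebesgue_measurability.
Context {R : realType}.
Implicit Types (A D : set R) (f : R -> \bar R).
Local Notation LT := (lebesgue_type R).

Lemma lmeas_borel A :
  measurable (A : set (measurableTypeR R)) -> lebesgue_measurable A.
Proof. by move=> mA; exact: sub_caratheodory. Qed.

Lemma lmeas_is_interval A : is_interval A -> lebesgue_measurable A.
Proof. by move=> iA; apply: lmeas_borel; exact: is_interval_measurable. Qed.

Lemma lmeas_itv (i : interval R) : lebesgue_measurable [set` i].
Proof. by apply: lmeas_is_interval; exact: interval_is_interval. Qed.

Lemma leb_itv (i : interval R) :
  leb [set` i] = (if i.2 > i.1 then (i.2 : \bar R) - i.1 else 0).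
Proof. exact: lebesgue_measure_itv. Qed.

Lemma lmeas_fun_id D : measurable_fun (D : set LT) (id : R -> R).
Proof. by move=> mD B mB; apply: measurableI => //; exact: lmeas_borel. Qed.

Lemma interval0_is_interval (a : \bar R) : is_interval (interval0 a).
Proof.
move=> x y [x0 xa] [y0 ya] z /andP[xz zy]; split; first exact: lt_le_trans xz.
by apply: le_lt_trans ya; rewrite lee_fin.
Qed.

Lemma lmeas_interval0 (a : \bar R) : lebesgue_measurable (interval0 a).
Proof. by apply: lmeas_is_interval; exact: interval0_is_interval. Qed.

Lemma lmeas_antitone D f : is_interval D ->
  (forall x y, D x -> D y -> (x <= y)%R -> f y <= f x) ->
  measurable_fun (D : set LT) f.
Proof.
move=> iD f_ni.
apply: (measurability _ (ErealGenCInfty.measurableE R)) => _ [_ [r ->] <-].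
apply: lmeas_is_interval => s t /= [Ds]; rewrite in_itv/= andbT => fs [Dt].
rewrite in_itv/= andbT => ft u /andP[su ut].
have Du : D u by apply: (iD _ _ Ds Dt); rewrite su.
by split => //; rewrite in_itv/= andbT (le_trans ft)// f_ni.
Qed.

Lemma lmeas_antitoneR D (f : R -> R) : is_interval D ->
  (forall x y, D x -> D y -> (x <= y)%R -> (f y <= f x)%R) -> L0 D f.
Proof.
move=> iD f_ni.
suff : measurable_fun (D : set LT) (EFin \o f) by move/measurable_EFinP.
by apply: lmeas_antitone => // x y Dx Dy xy /=; rewrite lee_fin f_ni.
Qed.

End lebesgue_measurability.

Section layer_cake.
Context {R : realType} d1 d2 (T1 : measurableType d1) (T2 : measurableType d2).
Context (m1 : {sigma_finite_measure set T1 -> \bar R}).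
Context (m2 : {sigma_finite_measure set T2 -> \bar R}).
Implicit Types (D : set T1) (u G : T1 -> \bar R).

(** Tonelli for [G x] times the indicator of [S]: integrating over [s] first gives back [u x].
    Leaving [S] abstract covers strict and non-strict level sets at once. *)
Lemma layer_cake_gen D (E : set T2) u G (S : T1 -> T2 -> Prop) : measurable D ->
  measurable_fun D G -> (forall x, D x -> 0 <= G x) ->
  measurable [set z : T1 * T2 | [/\ D z.1, E z.2 & S z.1 z.2]] ->
  (forall x, D x -> m2 [set s | E s /\ S x s] = u x) ->
  \int[m1]_(x in D) (u x * G x) =
  \int[m2]_(s in E) \int[m1]_(x in D `&` [set x | S x s]) G x.
Proof.
move=> mD mG G0 mS uE.
set SS := [set z : T1 * T2 | _] in mS.
pose f (z : T1 * T2) := (G \_ D) z.1 * (\1_SS z)%:E.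
have GD0 x : 0 <= (G \_ D) x by apply: erestrict_ge0.
have f0 z : 0 <= f z by rewrite mule_ge0 ?lee_fin.
have mGD : measurable_fun setT (G \_ D) by exact/(measurable_restrictT _ _).1.
have mf : measurable_fun setT f.
  apply: emeasurable_funM; first exact: measurableT_comp.
  by apply/measurable_EFinP; exact: measurable_indic.
have lr := @fubini_tonelli _ _ T1 T2 R m1 m2 f mf f0.
transitivity (\int[m1]_x \int[m2]_y f (x, y)).
  rewrite integral_mkcond/=; apply: eq_integral => x _.
  rewrite /f /= patchE; case: ifPn => xD; last first.
    rewrite /= patchE (negbTE xD).
    by under eq_integral do rewrite mul0e; rewrite integral0.
  under eq_integral do rewrite /= patchE xD.
  have mSx : measurable (xsection SS x) by exact: measurable_xsection.
  rewrite ge0_integralZl//.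
  - under eq_integral do rewrite indicE -mem_xsection -indicE.
    rewrite integral_indic// setIT muleC -uE; last exact: set_mem.
    congr (_ * m2 _); apply/seteqP; split => s; rewrite /xsection/= in_setE.
      by move=> [s0 Ss]; split => //; exact: set_mem.
    by case.
  - apply/measurable_EFinP.
    rewrite [X in measurable_fun _ X](_ : _ = \1_(xsection SS x)).
      exact: measurable_indic.
    by apply/funext => s; rewrite !indicE mem_xsection.
  - by apply: G0; exact: set_mem.
rewrite lr [RHS]integral_mkcond/=; apply: eq_integral => s _.
rewrite patchE; case: ifPn => s0; last first.
  rewrite integral0_eq// => x _; rewrite /f indicE memNset ?mule0//.
  by move=> [_ /= s0' _]; move: s0; rewrite notin_setE.
rewrite inE in s0.
rewrite [RHS]integral_mkcond/=; apply: eq_integral => x _.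
rewrite /f/= !patchE indicE.
have [xD|xD] := boolP (x \in D); last first.
  rewrite mul0e ifF//; apply/negbTE; rewrite notin_setE => -[/= Dx _].
  by move: xD; rewrite notin_setE.
have -> : ((x, s) \in SS) = (x \in D `&` [set x | S x s]).
  by apply/idP/idP; rewrite !inE /SS/= => -[].
by case: ifPn => _; rewrite ?mule1 ?mule0.
Qed.

End layer_cake.

Section layer_cake_fun.
Context {R : realType} d1 d2 (T1 : measurableType d1) (T2 : measurableType d2).
Implicit Types (D : set T1) (u G : T1 -> \bar R).

(** The set is cut out by the sign of [u - j], a difference that is always defined because [j] is
    real valued. In the application [j] is the identity from the completed line to the Borel
    line. *)
Lemma measurable_subgraph D (E : set T2) (j : T2 -> R) u (strict : bool) :
  measurable D -> measurable E -> measurable_fun setT j -> measurable_fun D u ->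
  measurable [set z : T1 * T2 | [/\ D z.1, E z.2 &
    if strict then (j z.2)%:E < u z.1 else (j z.2)%:E <= u z.1]].
Proof.
move=> mD mE mj mu.
pose k (z : T1 * T2) := (u \_ D) z.1 - (j z.2)%:E.
have mk : measurable_fun (D `*` E) k.
  apply: measurable_funTS; apply: emeasurable_funB.
    by apply: measurableT_comp => //; exact/(measurable_restrictT _ _).1.
  by apply/measurable_EFinP; exact: measurableT_comp.
have mDE : measurable (D `*` E) by exact: measurableX.
rewrite [X in measurable X](_ : _ = D `*` E `&`
    [set z | if strict then 0 < k z else 0 <= k z]); last first.
  apply/seteqP; split => -[x s] /=.
    move=> [Dx Es us]; split=> //; move: us.
    by rewrite /k/= patchE mem_set// EFinN; case: strict; rewrite ?sube_gt0// suber_ge0.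
  move=> [[Dx Es]]; rewrite /k/= patchE mem_set// EFinN.
  by case: strict; rewrite ?sube_gt0 ?suber_ge0.
by case: strict; [exact: emeasurable_fun_o_infty|exact: emeasurable_fun_c_infty].
Qed.

End layer_cake_fun.

(** Fixes the completed sigma-algebra on the source, so that a plain function on [R] is not read as
    a Borel one. *)
Definition lebesgue_mfun {R : realType} (D : set R) (f : R -> \bar R) :=
  measurable_fun (D : set (lebesgue_type R)) f.

Section lebesgue_integral_api.
Context {R : realType}.
Implicit Types (A B D : set R) (f g : R -> \bar R).
Local Notation LT := (lebesgue_type R).
Let mu : {measure set LT -> \bar R} := leb.

Lemma lmeasI A B :
  lebesgue_measurable A -> lebesgue_measurable B -> lebesgue_measurable (A `&` B).
Proof. exact: (@measurableI _ LT). Qed.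

Lemma lmeasU A B :
  lebesgue_measurable A -> lebesgue_measurable B -> lebesgue_measurable (A `|` B).
Proof. exact: (@measurableU _ LT). Qed.

Lemma lmeasD A B :
  lebesgue_measurable A -> lebesgue_measurable B -> lebesgue_measurable (A `\` B).
Proof. exact: (@measurableD _ LT). Qed.

Lemma lmeas0 : lebesgue_measurable (set0 : set R).
Proof. exact: (@measurable0 _ LT). Qed.

Lemma lmeas_bigcup (F : (set R)^nat) :
  (forall n, lebesgue_measurable (F n)) -> lebesgue_measurable (\bigcup_n F n).
Proof. exact: (@bigcupT_measurable _ LT). Qed.

Lemma lmfunS A B f : lebesgue_measurable B -> A `<=` B ->
  lebesgue_mfun B f -> lebesgue_mfun A f.
Proof. exact: (@measurable_funS _ _ LT). Qed.

Lemma lmfun_antitone D f : is_interval D ->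
  (forall x y, D x -> D y -> (x <= y)%R -> f y <= f x) -> lebesgue_mfun D f.
Proof. exact: lmeas_antitone. Qed.

Lemma lmfun_cst D c : lebesgue_mfun D (cst c).
Proof. exact: measurable_cst. Qed.

Lemma lmfun_EFin D (f : R -> R) : lebesgue_mfun D (EFin \o f) <-> L0 D f.
Proof. by split => [/measurable_EFinP//|?]; exact/measurable_EFinP. Qed.

Lemma lmfunM D f g :
  lebesgue_mfun D f -> lebesgue_mfun D g -> lebesgue_mfun D (f \* g).
Proof. exact: emeasurable_funM. Qed.

Lemma L0_normr D (f : R -> R) : L0 D f -> L0 D (fun x => `|f x|%R).
Proof. by move=> mf; exact: (measurableT_comp _ mf). Qed.

Lemma lmeas_gt D f y : lebesgue_measurable D -> lebesgue_mfun D f ->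
  lebesgue_measurable (D `&` [set x | y < f x]).
Proof. by move=> mD mf; exact: (@emeasurable_fun_o_infty _ LT). Qed.

Lemma lmeas_ge D f y : lebesgue_measurable D -> lebesgue_mfun D f ->
  lebesgue_measurable (D `&` [set x | y <= f x]).
Proof. by move=> mD mf; exact: (@emeasurable_fun_c_infty _ LT). Qed.

Lemma leb0 : leb (set0 : set R) = 0.
Proof. by have := leb_itv `](0%R : R), (0%R : R)[; rewrite set_itvoo0 /= ltxx. Qed.

Lemma le_leb A B : lebesgue_measurable A -> lebesgue_measurable B ->
  A `<=` B -> leb A <= leb B.
Proof. by move=> mA mB AB; apply: (le_measure mu); rewrite ?inE. Qed.

Lemma leb_ge0 A : 0 <= leb A.
Proof. exact: (measure_ge0 mu). Qed.

Lemma int_ge0 D f : (forall x, D x -> 0 <= f x) -> 0 <= \int[leb]_(x in D) f x.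
Proof. by move=> f0; exact: (integral_ge0 mu). Qed.

Lemma int_le D f g : lebesgue_measurable D ->
  lebesgue_mfun D f -> lebesgue_mfun D g -> (forall x, D x -> 0 <= f x) ->
  (forall x, D x -> f x <= g x) ->
  \int[leb]_(x in D) f x <= \int[leb]_(x in D) g x.
Proof. by move=> mD mf mg f0 fg; exact: (@ge0_le_integral _ LT R mu). Qed.

Lemma int_eq D f g : (forall x, D x -> f x = g x) ->
  \int[leb]_(x in D) f x = \int[leb]_(x in D) g x.
Proof. by move=> fg; apply: eq_integral => x; rewrite inE => /fg. Qed.

Lemma int_subset A B f : lebesgue_measurable A -> lebesgue_measurable B ->
  lebesgue_mfun B f -> (forall x, B x -> 0 <= f x) -> A `<=` B ->
  \int[leb]_(x in A) f x <= \int[leb]_(x in B) f x.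
Proof. by move=> mA mB mf f0 AB; exact: (@ge0_subset_integral _ LT R mu A B mA mB f). Qed.

Lemma int_setU A B f : lebesgue_measurable A -> lebesgue_measurable B ->
  lebesgue_mfun (A `|` B) f -> (forall x, (A `|` B) x -> 0 <= f x) ->
  A `&` B = set0 ->
  \int[leb]_(x in A `|` B) f x = \int[leb]_(x in A) f x + \int[leb]_(x in B) f x.
Proof.
move=> mA mB mf f0 AB; apply: (@ge0_integral_setU _ LT R mu) => //.
by rewrite disj_set2E AB.
Qed.

Lemma int_cst D c : lebesgue_measurable D -> \int[leb]_(x in D) c = c * leb D.
Proof. by move=> mD; exact: (@integral_cst _ LT R mu). Qed.

Lemma int_set0 f : \int[leb]_(x in set0) f x = 0.
Proof. exact: integral_set0. Qed.

Lemma intZl D f (k : R) : lebesgue_measurable D -> lebesgue_mfun D f ->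
  (forall x, D x -> 0 <= f x) -> (0 <= k)%R ->
  \int[leb]_(x in D) (k%:E * f x) = k%:E * \int[leb]_(x in D) f x.
Proof. by move=> mD mf f0 k0; exact: (@ge0_integralZl_EFin _ LT R mu). Qed.

Lemma intD D f g : lebesgue_measurable D ->
  lebesgue_mfun D f -> lebesgue_mfun D g ->
  (forall x, D x -> 0 <= f x) -> (forall x, D x -> 0 <= g x) ->
  \int[leb]_(x in D) (f x + g x) = \int[leb]_(x in D) f x + \int[leb]_(x in D) g x.
Proof. by move=> mD mf mg f0 g0; exact: (@ge0_integralD _ LT R mu). Qed.

Lemma int_ae_le D f g : lebesgue_measurable D ->
  lebesgue_mfun D f -> lebesgue_mfun D g ->
  (forall x, D x -> 0 <= f x) -> (forall x, D x -> 0 <= g x) ->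
  ae_on D (fun x => f x <= g x) ->
  \int[leb]_(x in D) f x <= \int[leb]_(x in D) g x.
Proof. by move=> mD mf mg f0 g0; exact: (@ae_ge0_le_integral _ LT R mu). Qed.

Lemma int_exhaust_le (F : (set R)^nat) f c :
  nondecreasing_seq F -> (forall n, lebesgue_measurable (F n)) ->
  lebesgue_mfun (\bigcup_n F n) f -> (forall n x, F n x -> 0 <= f x) ->
  (forall n, \int[leb]_(x in F n) f x <= c) ->
  \int[leb]_(x in \bigcup_n F n) f x <= c.
Proof.
move=> ndF mF mf f0 Fc.
have mfn n : lebesgue_mfun (F n) f.
  by apply: lmfunS mf; [exact: lmeas_bigcup|exact: bigcup_sup].
have cv := @ge0_nondecreasing_set_cvg_integral _ LT R F f mu ndF mF mfn f0.
rewrite -(cvg_lim _ cv)//; apply: lime_le; first by apply/cvg_ex; eexists; exact: cv.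
exact: nearW.
Qed.

Lemma lmeas_set1 (r : R) : lebesgue_measurable [set r].
Proof. by rewrite -set_itv1; exact: lmeas_itv. Qed.

Lemma int_set1 f (r : R) : \int[leb]_(x in [set r]) f x = 0.
Proof.
apply: (@null_set_integral _ LT R mu [set r] f).
- exact: lmeas_set1.
- have := @lmfun_antitone [set r] f; apply.
    by move=> x y -> -> z /andP[rz zr]; apply/eqP; rewrite eq_le zr.
  by move=> x y -> ->.
- by have := leb_itv `[r, r]; rewrite set_itv1 /= lte_fin ltxx.
Qed.

(** Lets a bound that holds strictly inside an interval control the integral over the half-open
    interval. *)
Lemma int_oc_oo (x y : R) f : lebesgue_mfun `]x, y]%classic f ->
  (forall t, `]x, y]%classic t -> 0 <= f t) ->
  \int[leb]_(t in `]x, y]) f t = \int[leb]_(t in `]x, y[) f t.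
Proof.
have [xy|yx] := ltP x y; last by rewrite !set_itv_ge// bnd_simp -leNgt.
have -> : `]x, y]%classic = `]x, y[%classic `|` [set y].
  by rewrite setUitv1// bnd_simp.
move=> mf f0; rewrite int_setU ?int_set1 ?adde0//; first exact: lmeas_itv.
  exact: lmeas_set1.
by apply/seteqP; split => // t [/=]; rewrite in_itv/= => /andP[_ /[swap] ->]; rewrite ltxx.
Qed.

Lemma leb_itv_oc (x y : R) : (x <= y)%R -> leb `]x, y]%classic = (y - x)%:E.
Proof.
rewrite le_eqVlt => /predU1P[->|xy].
  by rewrite leb_itv /= lte_fin ltxx subrr.
by rewrite leb_itv /= lte_fin xy.
Qed.

End lebesgue_integral_api.

(** * Rearrangements and the Hardy-Littlewood inequality *)

Opaque lebesgue_measurable lebesgue_mfun.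

Section layer_cake_line.
Context {R : realType}.
Implicit Types (D : set R) (u G : R -> \bar R).
Local Notation LT := (lebesgue_type R).

Lemma leb_interval0 (c : \bar R) : 0 <= c -> leb (interval0 c) = c.
Proof.
case: c => [r| |]// r0; last first.
  rewrite (_ : interval0 _ = `]0%R, +oo[%classic) ?leb_itv ?ltry//=.
  apply/seteqP; split => x /=; rewrite /interval0/= in_itv/= ?andbT ?ltry//.
  by case.
rewrite (_ : interval0 _ = `]0%R, r[%classic) ?leb_itv/=; last first.
  by apply/seteqP; split => x /=; rewrite /interval0/= in_itv/= lte_fin => /andP.
rewrite lee_fin in r0; rewrite lte_fin oppr0 adde0.
by case: ltgtP r0 => // <-.
Qed.

Lemma interval0_cap (c : \bar R) :
  [set s | `]0%R, +oo[%classic s /\ s%:E < c] = interval0 c.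
Proof. by apply/seteqP; split => x /=; rewrite in_itv/= andbT. Qed.

Lemma leb_interval0_closed (c : \bar R) : 0 <= c ->
  leb [set s | `]0%R, +oo[%classic s /\ s%:E <= c] = c.
Proof.
case: c => [r| |]// r0.
  rewrite (_ : [set _ | _] = `]0%R, r]%classic) ?leb_itv_oc ?subr0//.
  apply/seteqP; split => x /=; rewrite !in_itv/= andbT lee_fin => /andP//.
rewrite (_ : [set _ | _] = `]0%R, +oo[%classic) ?leb_itv ?ltry//=.
by apply/seteqP; split => x /=; rewrite in_itv/= andbT ?leey//; case.
Qed.

(** Both kinds of level sets are needed: [t < tail s] yields only [s <= rearr t], so strict level
    sets of functions get matched with non-strict level sets of rearrangements. *)
Let layer_cake (strict : bool) D u G : lebesgue_measurable D ->
  lebesgue_mfun D u -> lebesgue_mfun D G ->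
  (forall x, D x -> 0 <= u x) -> (forall x, D x -> 0 <= G x) ->
  \int[leb]_(x in D) (u x * G x) = \int[leb]_(s in `]0%R, +oo[)
    \int[leb]_(x in D `&` [set x | if strict then s%:E < u x else s%:E <= u x]) G x.
Proof.
move=> mD mu mG u0 G0.
apply: (@layer_cake_gen R _ _ LT LT leb leb D `]0%R, +oo[%classic u G
  (fun x s => if strict then s%:E < u x else s%:E <= u x)).
- exact: mD.
- exact: mG.
- exact: G0.
- have /= := @measurable_subgraph R _ _ LT LT D `]0%R, +oo[%classic id u strict mD
    (lmeas_itv _) (@lmeas_fun_id R setT) mu.
  exact.
- move=> x /u0 ux0.
  case: strict; last exact: leb_interval0_closed.
  by rewrite interval0_cap; exact: leb_interval0.
Qed.

Lemma layer_cake_lt D u G : lebesgue_measurable D ->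
  lebesgue_mfun D u -> lebesgue_mfun D G ->
  (forall x, D x -> 0 <= u x) -> (forall x, D x -> 0 <= G x) ->
  \int[leb]_(x in D) (u x * G x) = \int[leb]_(s in `]0%R, +oo[)
    \int[leb]_(x in D `&` [set x | s%:E < u x]) G x.
Proof. exact: (layer_cake true). Qed.

Lemma layer_cake_le D u G : lebesgue_measurable D ->
  lebesgue_mfun D u -> lebesgue_mfun D G ->
  (forall x, D x -> 0 <= u x) -> (forall x, D x -> 0 <= G x) ->
  \int[leb]_(x in D) (u x * G x) = \int[leb]_(s in `]0%R, +oo[)
    \int[leb]_(x in D `&` [set x | s%:E <= u x]) G x.
Proof. exact: (layer_cake false). Qed.

End layer_cake_line.

Section rearrangement_theory.
Context {R : realType}.
Implicit Types (D : set R) (f p q v : R -> R) (mu : set R -> \bar R).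

(** The property of [mu] on which the elementary bounds for rearrangements rest; it lets a plain set
    function such as [density v] stand beside [leb]. *)
Definition monotone_on D mu := forall A B, lebesgue_measurable A ->
  lebesgue_measurable B -> A `<=` B -> B `<=` D -> mu A <= mu B.

Lemma monotone_on_leb D : monotone_on D leb.
Proof. by move=> A B mA mB AB _; exact: le_leb. Qed.

Lemma monotone_on_density D v : lebesgue_measurable D -> L0 D v ->
  (forall x, D x -> (0 <= v x)%R) -> monotone_on D (density v).
Proof.
move=> mD /lmfun_EFin mv v0 A B mA mB AB BD; apply: int_subset => //.
  exact: lmfunS mv.
by move=> x /BD /v0; rewrite lee_fin.
Qed.

Lemma lmeas_tail D f (s : R) : lebesgue_measurable D -> L0 D f ->
  lebesgue_measurable (D `&` [set x | (s < `|f x|)%R]).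
Proof. by move=> mD /L0_normr/lmfun_EFin mf; exact: (lmeas_gt s%:E mD mf). Qed.

Lemma tail_antitone D f mu (s s' : R) : lebesgue_measurable D -> L0 D f ->
  monotone_on D mu -> (s <= s')%R -> tail mu D f s' <= tail mu D f s.
Proof.
move=> mD mf mon ss'; apply: mon; [exact: lmeas_tail|exact: lmeas_tail| |].
- by move=> x [Dx /=] => /(le_lt_trans ss').
- exact: subIsetl.
Qed.

Lemma rearr_ge0 mu D f t : 0 <= rearr mu D f t.
Proof. by apply: le_ereal_inf_tmp => _ [s [s0 _] <-]; rewrite lee_fin ltW. Qed.

Lemma rearr_antitone mu D f t t' : (t <= t')%R -> rearr mu D f t' <= rearr mu D f t.
Proof.
move=> tt'; apply: ereal_inf_le_tmp => _ [s [s0 ts] <-]; exists s => //; split=> //.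
by apply: le_trans ts _; rewrite lee_fin.
Qed.

Lemma rearr_le mu D f t (r : R) : (0 <= r)%R ->
  (forall s, (r < s)%R -> tail mu D f s <= t%:E) -> rearr mu D f t <= r%:E.
Proof.
move=> r0 H; apply/lee_addgt0Pr => e e0; apply: ereal_inf_lbound.
exists (r + e)%R => //; split; first by rewrite ltr_wpDl.
by apply: H; rewrite ltrDl.
Qed.

Lemma rearr_le_tail mu D f t (r : R) : lebesgue_measurable D -> L0 D f ->
  monotone_on D mu -> (0 <= r)%R -> tail mu D f r <= t%:E -> rearr mu D f t <= r%:E.
Proof.
move=> mD mf mon r0 H; apply: rearr_le => // s rs; apply: le_trans H.
by apply: tail_antitone => //; exact: ltW.
Qed.

Lemma lt_rearr_tail mu D f t (s : R) : (0 < s)%R -> s%:E < rearr mu D f t ->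
  t%:E < tail mu D f s.
Proof.
move=> s0; rewrite !ltNge; apply: contra => H.
by apply: ereal_inf_lbound; exists s.
Qed.

Lemma tail_le_rearr mu D f t (s : R) : lebesgue_measurable D -> L0 D f ->
  monotone_on D mu -> t%:E < tail mu D f s -> s%:E <= rearr mu D f t.
Proof.
move=> mD mf mon ts; apply: le_ereal_inf_tmp => _ [s' [s0 s't] <-].
rewrite lee_fin leNgt; apply/negP => s's.
have := le_lt_trans s't ts; rewrite ltNge; move/negP; apply.
by apply: tail_antitone => //; exact: ltW.
Qed.

(** Right continuity: at a level [s] between [c] and the value at [t], the tail exceeds [t]
    strictly, hence exceeds some [y > t], and the rearrangement is still at least [s] at [y]. *)
Lemma rearr_right_lim mu D f t (c : \bar R) : lebesgue_measurable D -> L0 D f ->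
  monotone_on D mu ->
  (forall y, (t < y)%R -> rearr mu D f y <= c) -> rearr mu D f t <= c.
Proof.
move=> mD mf mon H; rewrite leNgt; apply/negP => ct.
have c0 : 0 <= c by apply: le_trans (H (t + 1)%R _); rewrite ?rearr_ge0 ?ltrDl.
have cfin : c \is a fin_num by rewrite ge0_fin_numE// (lt_le_trans ct)// leey.
move: c0 ct H; rewrite -(fineK cfin) lee_fin; move: (fine c) => {c cfin}c c0 ct H.
have [s /andP[cs st]] : exists s : R, c%:E < s%:E < rearr mu D f t.
  case: (rearr mu D f t) ct => [r| |]//; rewrite ?lte_fin.
    by move=> cr; exists ((c + r) / 2)%R; rewrite !lte_fin midf_lt// midf_lt.
  by move=> _; exists (c + 1)%R; rewrite lte_fin ltrDl ltr01 ltry.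
rewrite lte_fin in cs; have s0 : (0 < s)%R by exact: le_lt_trans cs.
have ts := lt_rearr_tail s0 st.
have [y ty ys] : exists2 y : R, (t < y)%R & y%:E < tail mu D f s.
  case: (tail mu D f s) ts => [r| |]//; rewrite ?lte_fin.
    by move=> tr; exists ((t + r) / 2)%R; rewrite ?lte_fin midf_lt.
  by move=> _; exists (t + 1)%R; rewrite ?ltrDl ?ltr01 ?ltry.
have := le_trans (tail_le_rearr mD mf mon ys) (H _ ty).
by rewrite lee_fin leNgt cs.
Qed.

Lemma lmfun_rearr mu D f (E : set R) : is_interval E -> lebesgue_mfun E (rearr mu D f).
Proof. by move=> iE; apply: lmfun_antitone => // x y _ _; exact: rearr_antitone. Qed.

Lemma rearr_beyond mu D f t : lebesgue_measurable D -> L0 D f ->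
  monotone_on D mu -> mu D <= t%:E -> rearr mu D f t = 0.
Proof.
move=> mD mf mon Dt; apply/eqP; rewrite eq_le rearr_ge0 andbT.
apply: rearr_le => // s s0; apply: le_trans Dt.
by apply: mon => //; exact: lmeas_tail.
Qed.

(** Two layer cakes reduce both sides to sets: the [v]-mass [c] of the set where [|p| > s] and
    [|q| > r], against the length of the set where the rearrangements reach [s] and [r]. The latter
    contains [(0, c)], since both tails are at least [c]. Tying [mu] to [v] through its values makes
    [leb] itself an instance. *)
Lemma hardy_littlewood D mu v p q : lebesgue_measurable D -> L0 D v ->
  (forall x, D x -> (0 <= v x)%R) ->
  (forall A, lebesgue_measurable A -> A `<=` D -> mu A = density v A) ->
  L0 D p -> L0 D q ->
  \int[leb]_(x in D) (`|p x| * `|q x| * v x)%:E <=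
  \int[leb]_(t in `]0%R, +oo[) (rearr mu D p t * rearr mu D q t).
Proof.
move=> mD mv v0 muE mp mq.
have mon : monotone_on D mu.
  move=> A B mA mB AB BD; rewrite !muE//; last exact: subset_trans BD.
  by apply: (@monotone_on_density D).
have mE : lebesgue_measurable (`]0%R, +oo[%classic : set R) by exact: lmeas_itv.
have iE : is_interval (`]0%R, +oo[%classic : set R) by exact: interval_is_interval.
have mp' : lebesgue_mfun D (EFin \o (fun x => `|p x|%R)).
  by apply/lmfun_EFin; exact: L0_normr.
have mq' : lebesgue_mfun D (EFin \o (fun x => `|q x|%R)).
  by apply/lmfun_EFin; exact: L0_normr.
have mv' : lebesgue_mfun D (EFin \o v) by apply/lmfun_EFin.
have mqv : lebesgue_mfun D (fun x => `|q x|%:E * (v x)%:E) by exact: lmfunM mq' mv'.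
have qv0 x : D x -> 0 <= `|q x|%:E * (v x)%:E.
  by move=> Dx; rewrite mule_ge0 ?lee_fin ?v0.
rewrite (@int_eq _ _ _ (fun x => `|p x|%:E * (`|q x|%:E * (v x)%:E))); last first.
  by move=> x _; rewrite -!EFinM mulrA.
rewrite (@layer_cake_lt _ _ (EFin \o (fun x => `|p x|%R)))//; last first.
  by move=> x _; rewrite lee_fin.
rewrite layer_cake_le//; [|exact: lmfun_rearr|exact: lmfun_rearr|
  by move=> *; exact: rearr_ge0|by move=> *; exact: rearr_ge0].
have mS (s : R) : lebesgue_measurable (D `&` [set x | s%:E < `|p x|%:E]) by exact: lmeas_gt.
have mT (s : R) : lebesgue_measurable (`]0%R, +oo[ `&` [set x | s%:E <= rearr mu D p x]).
  by apply: lmeas_ge => //; exact: lmfun_rearr.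
have mSr (s r : R) :
    lebesgue_measurable ((D `&` [set x | s%:E < `|p x|%:E]) `&` [set x | r%:E < `|q x|%:E]).
  by apply: lmeas_gt => //; apply: lmfunS mq'.
have mTr (s r : R) :
    lebesgue_measurable ((`]0%R, +oo[ `&` [set x | s%:E <= rearr mu D p x])
      `&` [set x | r%:E <= rearr mu D q x]).
  apply: lmeas_ge => //; apply: (@lmfunS _ _ `]0%R, +oo[%classic) => //.
  exact: lmfun_rearr.
apply: int_le => //.
- apply: lmfun_antitone => // s s' _ _ ss'; apply: int_subset => //.
    by apply: lmfunS mqv.
    by move=> x [Dx _]; exact: qv0.
  by move=> x [Dx /= H]; split => //=; apply: le_lt_trans H; rewrite lee_fin.
- apply: lmfun_antitone => // s s' _ _ ss'; apply: int_subset => //.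
    apply: (@lmfunS _ _ `]0%R, +oo[%classic) => //.
    exact: lmfun_rearr.
    by move=> x _; exact: rearr_ge0.
  by move=> x [Dx /= H]; split => //=; apply: le_trans H; rewrite lee_fin.
- by move=> s _; apply: int_ge0 => x [Dx _]; exact: qv0.
move=> s; rewrite /= in_itv/= andbT => s0.
rewrite (@layer_cake_lt _ _ (EFin \o (fun x => `|q x|%R)))//; last 4 first.
  by apply: lmfunS mq'.
  by apply: lmfunS mv'.
  by move=> x _; rewrite lee_fin.
  by move=> x [Dx _]; rewrite lee_fin v0.
rewrite [leRHS](@int_eq _ _ _ (fun x => rearr mu D q x * 1)); last first.
  by move=> x _; rewrite mule1.
rewrite layer_cake_le//; last 3 first.
  apply: (@lmfunS _ _ `]0%R, +oo[%classic) => //.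
  exact: lmfun_rearr.
  exact: lmfun_cst.
  by move=> *; exact: rearr_ge0.
apply: int_le => //.
- apply: lmfun_antitone => // r r' _ _ rr'; apply: int_subset => //.
    by apply: lmfunS mv' => //; move=> x [[]].
    by move=> x [[Dx _] _]; rewrite lee_fin v0.
  by move=> x [Dx /= H]; split => //=; apply: le_lt_trans H; rewrite lee_fin.
- apply: lmfun_antitone => // r r' _ _ rr'; apply: int_subset => //.
    exact: lmfun_cst.
  by move=> x [Dx /= H]; split => //=; apply: le_trans H; rewrite lee_fin.
- by move=> r _; apply: int_ge0 => x [[Dx _] _]; rewrite lee_fin v0.
move=> r; rewrite /= in_itv/= andbT => r0.
set A := (X in \int[_]_(x in X) (v _)%:E <= _).
rewrite -/(density v A) -muE//; last 2 first.
  exact: mSr.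
  by move=> x [[]].
rewrite int_cst// mul1e.
have AD : A `<=` D by move=> x [[]].
set c := mu A.
have c0 : 0 <= c.
  have -> : c = density v A by apply: muE => //; exact: mSr.
  by apply: int_ge0 => x /AD Dx; rewrite lee_fin v0.
rewrite -(leb_interval0 c0); apply: le_leb => //.
  exact: lmeas_interval0.
move=> t [t0 tc]; split; [split|] => /=.
- by rewrite in_itv/= t0.
- apply: tail_le_rearr => //; apply: lt_le_trans tc _.
  apply: mon; [exact: mSr|exact: lmeas_tail| |exact: subIsetl].
  by move=> x [[Dx /= sp] _]; split => //; move: sp; rewrite lte_fin.
- apply: tail_le_rearr => //; apply: lt_le_trans tc _.
  apply: mon; [exact: mSr|exact: lmeas_tail| |exact: subIsetl].
  by move=> x [[Dx _] /= rq]; split => //; move: rq; rewrite lte_fin.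
Qed.

(** The rearrangements vanish from [mu D] on, so the half line can be cut at any [b >= mu D]. *)
Lemma hardy_littlewood_on (b : \bar R) D mu v p q : lebesgue_measurable D -> L0 D v ->
  (forall x, D x -> (0 <= v x)%R) ->
  (forall A, lebesgue_measurable A -> A `<=` D -> mu A = density v A) ->
  L0 D p -> L0 D q -> mu D <= b ->
  \int[leb]_(x in D) (`|p x| * `|q x| * v x)%:E <=
  \int[leb]_(t in interval0 b) (rearr mu D p t * rearr mu D q t).
Proof.
move=> mD mv v0 muE mp mq Db; apply: le_trans (hardy_littlewood mD mv v0 muE mp mq) _.
have mon : monotone_on D mu.
  move=> A B mA mB AB BD; rewrite !muE//; last exact: subset_trans BD.
  by apply: (@monotone_on_density D).
have mE : lebesgue_measurable (`]0%R, +oo[%classic : set R) by exact: lmeas_itv.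
have U : `]0%R, +oo[%classic = interval0 b `|` (`]0%R, +oo[%classic `\` interval0 b).
  by rewrite setDUK// => x [x0 _]; rewrite /= in_itv/= x0.
have mb := @lmeas_interval0 R b.
rewrite U int_setU; [|by []|exact: lmeasD| | |]; last first.
- by apply/seteqP; split => // x [Bx []].
- by move=> t _; rewrite mule_ge0 ?rearr_ge0.
- by rewrite -U; apply: lmfunM; apply: lmfun_rearr; exact: interval_is_interval.
rewrite [X in _ + X](@int_eq _ _ _ (cst 0)); last first.
  move=> t [/=]; rewrite in_itv/= andbT => t0 nt.
  rewrite (@rearr_beyond mu D p t)// ?mul0e//; apply: (le_trans Db).
  by rewrite leNgt; apply/negP => tb; apply: nt.
rewrite int_cst; last exact: lmeasD.
by rewrite mul0e adde0.
Qed.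

Lemma hardy_littlewood_leb (a : \bar R) p q : 0 <= a ->
  L0 (interval0 a) p -> L0 (interval0 a) q ->
  \int[leb]_(x in interval0 a) `|p x * q x|%:E <=
  \int[leb]_(t in interval0 a)
    (rearr leb (interval0 a) p t * rearr leb (interval0 a) q t).
Proof.
move=> a0 mp mq; have mI := @lmeas_interval0 R a.
rewrite (@int_eq _ _ _ (fun x => (`|p x| * `|q x| * 1)%R%:E)); last first.
  by move=> x _; rewrite mulr1 normrM.
apply: (@hardy_littlewood_on a _ _ (cst 1%R)) => //.
- exact: measurable_cst.
- by move=> A mA _; rewrite -[LHS]mul1e -int_cst.
- by rewrite leb_interval0.
Qed.

End rearrangement_theory.

(** * Primitives of decreasing weights *)

Section primitives.
Context {R : realType}.
Implicit Types (a q : \bar R) (u : R -> R) (x y t : R).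

(** Monotone convergence along intervals that stay away from both ends, so that only interior
    estimates have to be supplied. *)
Lemma int_interval0_le q (f : R -> \bar R) c : 0 <= c ->
  lebesgue_mfun (interval0 q) f -> (forall x, interval0 q x -> 0 <= f x) ->
  (forall s t, (0 < s)%R -> (s < t)%R -> t%:E < q ->
     \int[leb]_(x in `]s, t]) f x <= c) ->
  \int[leb]_(x in interval0 q) f x <= c.
Proof.
move=> c0 mf f0 H.
(* [b] climbs to [q] from below, as [r - 1/(n+1)] or as [n]; for [q = -oo] both sides of the
   equivalence are false and any constant serves. *)
have [b [bS bq]] : exists b : nat -> R, {homo b : n m / (n <= m)%N >-> (n <= m)%R} /\
    forall x, (x%:E < q) <-> (exists n, (x <= b n)%R) /\ (forall n, ((b n)%:E < q)).
  case: q mf f0 H => [r| |] mf f0 H.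
  - exists (fun n => r - n.+1%:R^-1)%R; split.
      by move=> n m nm; rewrite lerD2l lerN2 lef_pV2 ?posrE// ler_nat.
    move=> x; rewrite lte_fin; split => [xr|[[n xn] _]]; last first.
      by apply: le_lt_trans xn _; rewrite ltrBlDr ltrDl.
    split; last by move=> n; rewrite lte_fin ltrBlDr ltrDl.
    have rx : (0 < r - x)%R by rewrite subr_gt0.
    have [n _ Hn] := near_infty_natSinv_lt (PosNum rx).
    exists n; have : (n.+1%:R^-1 < r - x)%R := Hn n (leqnn n).
    by rewrite ltrBrDl lerBrDr => /ltW.
  - exists (fun n => n%:R)%R; split; first by move=> n m; rewrite ler_nat.
    move=> x; rewrite ltry; split => // _; split; last by move=> n; rewrite ltry.
    exists (Num.truncn `|x|).+1; rewrite ltW// (le_lt_trans (ler_norm x))//.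
    exact: truncnS_gt.
  - exists (fun=> 0)%R; split => // x; rewrite ltNge leNye; split => // -[_ /(_ 0%N)].
    by rewrite ltNge leNye.
pose F n : set R := [set` `](n.+1%:R^-1)%R, b n]].

have [q0|q0] := pselect (forall n, (b n)%:E < q); last first.
  rewrite (_ : interval0 q = set0) ?int_set0//.
  by apply/seteqP; split => // x [_ /bq[_ /q0]].
have FE : \bigcup_n F n = interval0 q.
  apply/seteqP; split => x.
    move=> [n _]; rewrite /F/= in_itv/= => /andP[nx xb]; split.
      by apply: le_lt_trans nx; rewrite invr_ge0.
    by apply/bq; split => //; exists n.
  move=> [x0 /bq[[n xn] _]].
  have [m _ Hm] := near_infty_natSinv_lt (PosNum x0).
  exists (maxn n m) => //; rewrite /F/= in_itv/=; apply/andP; split.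
    by apply: Hm; rewrite /= leq_maxr.
  by apply: le_trans xn (bS _ _ (leq_maxl _ _)).
have mF n : lebesgue_measurable (F n) by exact: lmeas_itv.
rewrite -FE; apply: int_exhaust_le.
- move=> n m nm; rewrite subsetEset => x; rewrite /F/= !in_itv/= => /andP[nx xn].
  rewrite (le_trans xn (bS _ _ nm)) andbT; apply: le_lt_trans nx.
  by rewrite lef_pV2 ?posrE// ler_nat.
- exact: mF.
- by rewrite FE.
- by move=> n x Fx; apply: f0; rewrite -FE; exists n.
- move=> n; have [nb|bn] := ltP (n.+1%:R^-1)%R (b n).
    by apply: H => //; rewrite invr_gt0.
  by rewrite /F set_itv_ge ?bnd_simp -?leNgt// int_set0.
Qed.

(** Values may vanish, so that rearrangements are covered together with [w] and [v]. *)
Record decreasing_weight a u : Prop := {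
  dw_pos : 0 < a ;
  dw_ge0 : forall x, interval0 a x -> (0 <= u x)%R ;
  dw_anti : forall x y, interval0 a x -> interval0 a y -> (x <= y)%R -> (u y <= u x)%R ;
  dw_fin : forall x, interval0 a x -> \int[leb]_(t in `]0%R, x]) (u t)%:E < +oo }.

Definition primitive u x : R := fine (\int[leb]_(t in `]0%R, x]) (u t)%:E).

Section primitive_of_weight.
Variables (a : \bar R) (u : R -> R).
Hypothesis hu : decreasing_weight a u.

Lemma itv_interval0 x y : (0 <= x)%R -> y%:E < a -> `]x, y]%classic `<=` interval0 a.
Proof.
move=> x0 ya t /=; rewrite in_itv/= => /andP[xt ty]; split; first exact: le_lt_trans xt.
by apply: le_lt_trans ya; rewrite lee_fin.
Qed.

Lemma dw_L0 : L0 (interval0 a) u.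
Proof.
by apply: lmeas_antitoneR; [exact: interval0_is_interval|exact: dw_anti].
Qed.

Lemma dw_lmfun : lebesgue_mfun (interval0 a) (EFin \o u).
Proof. by apply/lmfun_EFin; exact: dw_L0. Qed.

Lemma dw_lmfun_itv x y : (0 <= x)%R -> y%:E < a ->
  lebesgue_mfun `]x, y]%classic (EFin \o u).
Proof.
move=> x0 ya; apply: lmfunS dw_lmfun; first exact: lmeas_interval0.
exact: itv_interval0.
Qed.

Lemma dw_ge0_itv x y t : (0 <= x)%R -> y%:E < a -> `]x, y]%classic t ->
  0 <= (u t)%:E.
Proof. by move=> x0 ya xyt; rewrite lee_fin; apply: (dw_ge0 hu); exact: itv_interval0 xyt. Qed.

Lemma primitive_le0 x : (x <= 0)%R -> primitive u x = 0%R.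
Proof.
by move=> x0; rewrite /primitive set_itv_ge ?int_set0// bnd_simp -leNgt.
Qed.

Lemma primitiveE x : x%:E < a -> \int[leb]_(t in `]0%R, x]) (u t)%:E = (primitive u x)%:E.
Proof.
move=> xa; have [x0|x0] := ltP 0%R x.
  rewrite fineK// ge0_fin_numE; first exact: (dw_fin hu).
  by apply: int_ge0 => t; exact: dw_ge0_itv.
by rewrite primitive_le0// set_itv_ge ?int_set0// bnd_simp -leNgt.
Qed.

Lemma primitive_diff x y : (0 <= x)%R -> (x <= y)%R -> y%:E < a ->
  \int[leb]_(t in `]x, y]) (u t)%:E = (primitive u y - primitive u x)%:E.
Proof.
move=> x0 xy ya; have xa : x%:E < a by apply: le_lt_trans ya; rewrite lee_fin.
rewrite EFinB -!primitiveE//.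
have -> : `]0%R, y]%classic = `]0%R, x]%classic `|` `]x, y]%classic.
  by rewrite -itv_bndbnd_setU// bnd_simp.
rewrite int_setU; [|exact: lmeas_itv|exact: lmeas_itv| | |].
- rewrite addeAC subee ?add0e// primitiveE//.
- rewrite -itv_bndbnd_setU ?bnd_simp//; exact: dw_lmfun_itv.
- by rewrite -itv_bndbnd_setU ?bnd_simp// => t; exact: dw_ge0_itv.
- apply/seteqP; split => // t [/=]; rewrite !in_itv/= => /andP[_ tx] /andP[xt _].
  by move: (le_lt_trans tx xt); rewrite ltxx.
Qed.

Lemma primitive_mono x y : (0 <= x)%R -> (x <= y)%R -> y%:E < a ->
  (primitive u x <= primitive u y)%R.
Proof.
move=> x0 xy ya; rewrite -subr_ge0 -lee_fin -primitive_diff//.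
by apply: int_ge0 => t; exact: dw_ge0_itv.
Qed.

Lemma primitive_ge0 x : x%:E < a -> (0 <= primitive u x)%R.
Proof.
move=> xa; have [x0|x0] := leP 0%R x; last by rewrite primitive_le0// ltW.
by rewrite -(primitive_le0 (lexx 0%R)); exact: primitive_mono.
Qed.

Lemma primitive_lower x y (c : R) : (0 <= x)%R -> (x <= y)%R -> y%:E < a ->
  (0 <= c)%R -> (forall t, (x < t)%R -> (t < y)%R -> (c <= u t)%R) ->
  (c * (y - x) <= primitive u y - primitive u x)%R.
Proof.
move=> x0 xy ya c0 H; rewrite -lee_fin -primitive_diff//.
rewrite EFinM -leb_itv_oc// -int_cst; last exact: lmeas_itv.
rewrite !int_oc_oo//; [|exact: dw_lmfun_itv|by move=> t; exact: dw_ge0_itv|exact: lmfun_cst].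
apply: int_le; [exact: lmeas_itv|exact: lmfun_cst| |by []|].
  apply: (@lmfunS _ _ `]x, y]%classic); [exact: lmeas_itv| |exact: dw_lmfun_itv].
  by apply: subset_itvl; rewrite bnd_simp.
by move=> t /=; rewrite in_itv/= => /andP[xt ty]; rewrite lee_fin H.
Qed.

Lemma primitive_upper x y (c : R) : (0 <= x)%R -> (x <= y)%R -> y%:E < a ->
  (forall t, (x < t)%R -> (t < y)%R -> (u t <= c)%R) ->
  (primitive u y - primitive u x <= c * (y - x))%R.
Proof.
move=> x0; rewrite le_eqVlt => /predU1P[->|xy] ya H; first by rewrite !subrr mulr0.
have c0 : (0 <= c)%R.
  apply: le_trans (H ((x + y) / 2)%R _ _); rewrite ?midf_lt//.
  apply: (dw_ge0 hu); split; last by apply: lt_trans ya; rewrite lte_fin midf_lt.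
  by apply: le_lt_trans x0 _; rewrite midf_lt.
rewrite -lee_fin -primitive_diff//; last exact: ltW.
rewrite EFinM -leb_itv_oc; last exact: ltW.
rewrite -int_cst; last exact: lmeas_itv.
rewrite !int_oc_oo//; [|exact: lmfun_cst|exact: dw_lmfun_itv|by move=> t; exact: dw_ge0_itv].
apply: int_le; [exact: lmeas_itv| |exact: lmfun_cst| |].
- apply: (@lmfunS _ _ `]x, y]%classic); [exact: lmeas_itv| |exact: dw_lmfun_itv].
  by apply: subset_itvl; rewrite bnd_simp.
- move=> t /= txy; apply: (@dw_ge0_itv x y) => //; apply: subset_itvl txy.
  by rewrite bnd_simp.
- by move=> t /=; rewrite in_itv/= => /andP[xt ty]; rewrite lee_fin H.
Qed.

(** If the primitive stayed above [e] near 0, every integral over []s, t]] inside [(0, c)] would be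
    at most [primitive u c - e], and exhausting [(0, c)] would make the whole integral smaller than
    itself. *)
Lemma primitive_small (e : R) : (0 < e)%R ->
  exists2 z, interval0 a z & (primitive u z <= e)%R.
Proof.
move=> e0; have [c [c0 ca]] : exists c, interval0 a c.
  case: a (dw_pos hu) => [r| |]//; last by move=> _; exists 1%R; split; rewrite ?ltry.
  rewrite lte_fin => r0; exists (r / 2)%R; split; rewrite ?lte_fin.
    by rewrite divr_gt0.
  by rewrite ltr_pdivrMr// ltr_pMr// ltr1n.
apply: contrapT => H.
have pe z : interval0 a z -> (e < primitive u z)%R.
  by move=> Iz; rewrite ltNge; apply/negP => ?; apply: H; exists z.
have ce := pe c (conj c0 ca).
have : \int[leb]_(t in interval0 c%:E) (u t)%:E <= (primitive u c - e)%:E.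
  apply: int_interval0_le.
  - by rewrite lee_fin subr_ge0 ltW.
  - apply: lmfunS dw_lmfun; first exact: lmeas_interval0.
    by move=> x [x0 xc]; split => //; apply: lt_trans ca.
  - move=> x [x0 xc]; rewrite lee_fin; apply: (dw_ge0 hu).
    by split => //; apply: lt_trans ca.
  - move=> s t s0 st tc; rewrite primitive_diff//; [|exact: ltW|exact: ltW|exact: lt_trans ca].
    rewrite lee_fin lerB//.
      by apply: primitive_mono => //; rewrite ltW// (lt_trans s0).
    apply: ltW; apply: pe; split => //; apply: lt_trans ca.
    by apply: lt_trans tc; rewrite lte_fin.
have -> : interval0 c%:E = `]0%R, c[%classic.
  by apply/seteqP; split => x /=; rewrite /interval0/= in_itv/= lte_fin => /andP.
rewrite -int_oc_oo ?primitiveE//; [|exact: dw_lmfun_itv|by move=> t; exact: dw_ge0_itv].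
by rewrite lee_fin; lra.
Qed.

(** [u] may be unbounded at 0, so the interval is split at a point [z] with mass at most [e / 2]
    before it; after [z] the primitive is Lipschitz with constant [u z]. The summand 1 in [u z + 1]
    keeps the divisor positive. *)
Lemma primitive_modulus (c e : R) : c%:E < a -> (0 < e)%R ->
  exists2 d : R, (0 < d)%R & forall x y, (0 <= x)%R -> (x <= y)%R -> (y <= c)%R ->
    (y - x < d)%R -> (primitive u y - primitive u x <= e)%R.
Proof.
move=> ca e0; have e20 : (0 < e / 2)%R by rewrite divr_gt0.
have [z [z0 za] ze] := primitive_small e20.
have uz0 : (0 <= u z)%R by apply: (dw_ge0 hu).
have uz1 : (0 < u z + 1)%R by rewrite ltr_wpDl.
have zlip x y : (z <= x)%R -> (x <= y)%R -> y%:E < a ->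
    (primitive u y - primitive u x <= u z * (y - x))%R.
  move=> zx xy ya; apply: primitive_upper => //; first by apply: le_trans zx; exact: ltW.
  move=> t xt ty; apply: (dw_anti hu) => //.
    split; first by rewrite (lt_le_trans z0)// (le_trans zx)// ltW.
    by apply: lt_trans ya; rewrite lte_fin.
  by rewrite (le_trans zx)// ltW.
exists (e / 2 / (u z + 1))%R; first by rewrite divr_gt0.
move=> x y x0 xy yc; rewrite ltr_pdivlMr// => yx.
have ya : y%:E < a by apply: le_lt_trans ca; rewrite lee_fin.
have [yz|zy] := leP y z.
  have := primitive_mono (le_trans x0 xy) yz za.
  have := primitive_ge0 (le_lt_trans (xy : x%:E <= y%:E) ya); lra.
have [zx|xz] := leP z x.
  have := zlip _ _ zx xy ya; nra.
have := zlip _ _ (lexx z) (ltW zy) ya.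
have := primitive_mono x0 (ltW xz) za.
have := primitive_ge0 (le_lt_trans (xy : x%:E <= y%:E) ya); nra.
Qed.

Lemma primitive_continuous (c : R) : c%:E < a -> {within `[0%R, c], continuous (primitive u)}.
Proof.
move=> ca; apply/subspace_continuousP => x /=; rewrite in_itv/= => /andP[x0 xc].
apply/cvgrPdist_le => e e0; have [d d0 H] := primitive_modulus ca e0.
rewrite near_withinE; near=> y => /=; rewrite in_itv/= => /andP[y0 yc].
have : (`|x - y| < d)%R by near: y; exact: nbhsx_ballx.
have [xy|yx] := leP x y.
  rewrite distrC ger0_norm ?subr_ge0// => yd.
  rewrite distrC ger0_norm ?subr_ge0; first exact: H.
  by apply: primitive_mono => //; apply: le_lt_trans ca.
rewrite ger0_norm ?subr_ge0 ?(ltW yx)// => yd.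
rewrite ger0_norm ?subr_ge0; first by apply: H => //; exact: ltW.
by apply: primitive_mono => //; [exact: ltW|apply: le_lt_trans ca].
Unshelve. all: by end_near. Qed.

End primitive_of_weight.
End primitives.

(** * Nested near-optimal sets *)

Section cut.
Context {R : realType}.
Implicit Types (B C : set R) (r x y : R).

Definition cut_length C r : R := fine (leb (C `&` `]0%R, r[%classic)).

(** Produces a subset of [C] of prescribed measure [m] in a way that is monotone in [m], as nested
    sets require. *)
Definition cut_radius C (m : R) : R := inf [set r | (0 <= r)%R /\ (m <= cut_length C r)%R].

Variable C : set R.
Hypothesis mC : lebesgue_measurable C.
Hypothesis C0 : C `<=` `]0%R, +oo[%classic.

Let mCr r : lebesgue_measurable (C `&` `]0%R, r[%classic).
Proof. by apply: lmeasI => //; exact: lmeas_itv. Qed.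

Lemma cut_lengthE r : leb (C `&` `]0%R, r[%classic) = (cut_length C r)%:E.
Proof.
rewrite fineK// ge0_fin_numE ?leb_ge0//.
apply: (@le_lt_trans _ _ (leb `]0%R, r[%classic)).
  by apply: le_leb; [exact: mCr|exact: lmeas_itv|exact: subIsetr].
by rewrite leb_itv/=; case: ifP; rewrite ?ltry// oppr0 adde0 ltry.
Qed.

Lemma cut_length_lip r r' : (0 <= r)%R -> (r <= r')%R ->
  (cut_length C r' <= cut_length C r + (r' - r))%R.
Proof.
move=> r0 rr'; rewrite -lee_fin EFinD -!cut_lengthE.
have [->|rr] := eqVneq r r'; first by rewrite subrr adde0.
have lrr : (r < r')%R by rewrite lt_neqAle rr.
apply: (@le_trans _ _ (leb (C `&` `]0%R, r[%classic) + leb `[r, r'[%classic)); last first.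
  by rewrite leeD2l// leb_itv/= lte_fin lrr.
apply: (@le_trans _ _ (leb ((C `&` `]0%R, r[%classic) `|` `[r, r'[%classic))).
  apply: le_leb; [exact: mCr| |].
    by apply: lmeasU; [exact: mCr|exact: lmeas_itv].
  move=> x [Cx]; rewrite /= !in_itv/= => /andP[x0 xr'].
  have [xr|rx] := ltP x r; first by left; split => //=; apply/andP.
  by right; apply/andP.
exact: (@measureU2 _ _ (lebesgue_type R) leb _ _ (mCr r) (lmeas_itv _)).
Qed.

(** [cut_length] is 1-Lipschitz, so it takes exactly the value [m] at the infimum. Some radius does
    reach [m], since otherwise exhausting [C] would bound its measure by [m]. *)
Lemma cut_radiusP (m : R) : (0 <= m)%R -> m%:E < leb C ->
  (0 <= cut_radius C m)%R /\ cut_length C (cut_radius C m) = m.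
Proof.
move=> m0 mltC; set S := [set r | (0 <= r)%R /\ (m <= cut_length C r)%R].
have [r1 r1S] : exists r, S r.
  apply: contrapT => H.
  have lt_m r : (0 <= r)%R -> (cut_length C r < m)%R.
    by move=> r0; rewrite ltNge; apply/negP => ?; apply: H; exists r.
  have : leb C <= m%:E.
    rewrite -[leb C]mul1e -int_cst// (_ : C = \bigcup_n (C `&` `]0%R, n%:R[%classic)).
      apply: int_exhaust_le.
      - move=> n n' nn'; rewrite subsetEset; apply: setIS => x /=.
        by rewrite !in_itv/= => /andP[-> /lt_le_trans]; apply; rewrite ler_nat.
      - by move=> n; exact: mCr.
      - exact: lmfun_cst.
      - by move=> *; exact: lee01.
      - by move=> n; rewrite int_cst// mul1e cut_lengthE lee_fin ltW// lt_m.
    apply/seteqP; split => x; last by case=> n _ [].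
    move=> Cx; exists (Num.truncn `|x|).+1 => //; split => //=.
    have := C0 Cx; rewrite /= !in_itv/= andbT => -> /=.
    by rewrite (le_lt_trans (ler_norm x))// truncnS_gt.
  by rewrite leNgt mltC.
have lbS : has_lbound S by exists 0%R => r [].
have hS : has_inf S by split => //; exists r1.
have rad0 : (0 <= cut_radius C m)%R by apply: lb_le_inf; [exists r1|move=> r []].
split => //; apply/eqP; rewrite eq_le; apply/andP; split.
- apply/ler_addgt0Pr => e e0.
  have [re|er] := leP (cut_radius C m) e.
    apply: le_trans (cut_length_lip (lexx 0%R) rad0) _.
    rewrite [X in (X + _)%R](_ : _ = 0%R); last first.
      by rewrite /cut_length set_itvoo0 setI0 leb0.
    by rewrite subr0 add0r (le_trans re)// lerDr.
  pose r := (cut_radius C m - e)%R.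
  have r0 : (0 <= r)%R by rewrite subr_ge0 ltW.
  have rr : (r < cut_radius C m)%R by rewrite ltrBlDr ltrDl.
  apply: le_trans (cut_length_lip r0 (ltW rr)) _.
  rewrite lerD//; last by rewrite /r subKr.
  rewrite leNgt; apply/negP => mr.
  move: rr; rewrite ltNge => /negP; apply; apply: ge_inf => //.
  by split => //; exact: ltW.
- apply/ler_addgt0Pr => e e0.
  have [r [r0 rm] re] := inf_adherent e0 hS.
  have rr : (cut_radius C m <= r)%R by apply: ge_inf => //; split => //.
  apply: le_trans rm _.
  rewrite (le_trans (cut_length_lip rad0 rr))// lerD2l.
  by rewrite lerBlDl ltW.
Qed.

Lemma le_cut_radius (m m' : R) : (m <= m')%R -> (0 <= m')%R -> m'%:E < leb C ->
  (cut_radius C m <= cut_radius C m')%R.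
Proof.
move=> mm' m'0 m'C; have [r0 rE] := cut_radiusP m'0 m'C.
apply: ge_inf; first by exists 0%R => r [].
by split => //; rewrite rE.
Qed.

End cut.

Section near_optimal.
Context {R : realType}.
Variables (a : \bar R) (f : R -> R) (d : R).
Local Notation I := (interval0 a).
Hypotheses (mf : L0 I f) (d0 : (0 < d)%R).
Hypothesis ffin : forall y, I y -> rearr leb I f y < +oo.

(* B y below consists of the top levels of |f|, quantized in steps of d, the last
   level being cut so that B y has measure y. Without quantization that last level
   could be too small when leb I = +oo, as f* may exceed |f| everywhere. *)
Let V k := I `&` [set x | (d * k%:R <= `|f x|)%R].
Let C k := V k `\` V k.+1.

Let mI : lebesgue_measurable I. Proof. exact: lmeas_interval0. Qed.

Let mV k : lebesgue_measurable (V k).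
Proof.
have /lmfun_EFin mf' : L0 I (fun x => `|f x|%R) by exact: L0_normr.
rewrite (_ : V k = I `&` [set x | (d * k%:R)%:E <= (EFin \o (fun x => `|f x|%R)) x]).
  exact: lmeas_ge.
by apply/seteqP; split => x [Ix /=]; rewrite ?lee_fin.
Qed.

Let mC k : lebesgue_measurable (C k). Proof. exact: lmeasD. Qed.

Let CI k : C k `<=` `]0%R, +oo[%classic.
Proof. by move=> x [[[x0 _] _] _]; rewrite /= in_itv/= x0. Qed.

Let V_anti k k' : (k <= k')%N -> V k' `<=` V k.
Proof.
move=> kk' x [Ix /= fx]; split => //=; apply: le_trans fx.
by rewrite ler_pM2l// ler_nat.
Qed.

Let level_ex y : I y -> exists k, `[< leb (V k.+1) <= y%:E >].
Proof.
move=> Iy.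
have [s s0 sy] : exists2 s : R, (0 < s)%R & tail leb I f s <= y%:E.
  have [_ [s [s0 sy] _] _] := ereal_inf_lt (ffin Iy).
  by exists s.
exists (Num.truncn (s / d)); apply/asboolP; apply: le_trans sy.
apply: le_leb => //; first exact: lmeas_tail.
move=> x [Ix /= fx]; split => //=; apply: lt_le_trans fx.
by rewrite mulrC -ltr_pdivrMr// truncnS_gt.
Qed.

(** Index of the layer that has to be cut to obtain measure [y]: [V k.+1] still fits, [V k] is too
    large. *)
Let level y : nat := if pselect (I y) is left Iy then ex_minn (level_ex Iy) else 0%N.

Let levelP y : I y -> leb (V (level y).+1) <= y%:E /\ y%:E < leb (V (level y)).
Proof.
move=> Iy; rewrite /level; case: pselect => // Iy'.
case: ex_minnP => k /asboolP ky kmin; split => //.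
case: k ky kmin => [|k] _ kmin; last first.
  by rewrite ltNge; apply/negP => /asboolP/kmin; rewrite ltnn.
have [y0 ya] := Iy; rewrite (_ : V 0 = I) ?leb_interval0//.
  by apply: ltW; apply: lt_trans ya.
by apply/seteqP; split => x; [case|move=> Ix; split => //=; rewrite mulr0].
Qed.

Let level_anti y y' : I y -> I y' -> (y <= y')%R -> (level y' <= level y)%N.
Proof.
move=> Iy Iy' yy'; have [ly _] := levelP Iy.
rewrite {1}/level; case: pselect => // Iy''; case: ex_minnP => k _; apply.
by apply/asboolP; apply: le_trans ly _; rewrite lee_fin.
Qed.

(** Measure still missing once [V (level y).+1] has been taken; it is cut out of the layer
    [C (level y)]. *)
Let excess y : R := (y - fine (leb (V (level y).+1)))%R.

Let excessE y : I y -> leb (V (level y).+1) = (y - excess y)%:E.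
Proof.
move=> Iy; rewrite /excess subKr fineK// ge0_fin_numE ?leb_ge0//.
by apply: le_lt_trans (levelP Iy).1 _; rewrite ltry.
Qed.

Let excessP y : I y -> (0 <= excess y)%R /\ (excess y)%:E < leb (C (level y)).
Proof.
move=> Iy; have [ly yl] := levelP Iy; split.
  by move: ly; rewrite excessE// lee_fin; lra.
have : leb (V (level y)) <= leb (V (level y).+1) + leb (C (level y)).
  apply: (@le_trans _ _ (leb (V (level y).+1 `|` C (level y)))).
    apply: le_leb => //; first exact: lmeasU.
    by move=> x Vx; have [?|?] := pselect (V (level y).+1 x); [left|right].
  exact: (@measureU2 _ _ (lebesgue_type R) leb _ _ (mV _) (mC _)).
move=> /(lt_le_trans yl); rewrite excessE//.
by case: (leb _) => [r| |]; rewrite ?ltry// -EFinD !lte_fin; lra.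
Qed.

Let A y : set R := if (y <= 0)%R then set0 else
  V (level y).+1 `|` (C (level y) `&` `]0%R, (cut_radius (C (level y)) (excess y))[%classic).

Let mA y : lebesgue_measurable (A y).
Proof.
rewrite /A; case: ifP => _; first exact: lmeas0.
by apply: lmeasU => //; apply: lmeasI => //; exact: lmeas_itv.
Qed.

Let A_sub y : A y `<=` V (level y).
Proof.
rewrite /A; case: ifP => _ // x [|[[]]]//; exact: V_anti.
Qed.

Let lebA y : (0 <= y)%R -> y%:E < a -> leb (A y) = y%:E.
Proof.
move=> y0 ya; rewrite /A; case: ifP => [y0'|/negbT]; last rewrite -ltNge => y1.
  by rewrite leb0; congr EFin; apply/eqP; rewrite eq_le y0 y0'.
have Iy : I y by [].
set K := C (level y) `&` _.
have mK : lebesgue_measurable K by apply: lmeasI => //; exact: lmeas_itv.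
rewrite -[leb _]mul1e -int_cst; last exact: lmeasU.
rewrite int_setU; [|by []|by []|exact: lmfun_cst|by move=> *; exact: lee01|]; last first.
  by apply/seteqP; split => // x [Vx [[]]].
rewrite !int_cst// !mul1e.
have [e0 eC] := excessP Iy.
have [_ cE] := cut_radiusP (mC _) (@CI _) e0 eC.
by rewrite cut_lengthE// cE excessE// -EFinD subrK.
Qed.

Lemma near_optimal_sets : exists B : R -> set R, [/\
  (forall y, lebesgue_measurable (B y) /\ B y `<=` I),
  (forall y y', (y <= y')%R -> y'%:E < a -> B y `<=` B y'),
  (forall y, (0 <= y)%R -> y%:E < a -> leb (B y) = y%:E) &
  (forall y, (0 <= y)%R -> y%:E < a -> \int[leb]_(t in `]0%R, y]) rearr leb I f t
     <= \int[leb]_(x in B y) `|f x|%:E + (d * y)%:E)].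
Proof.
exists A; split => //.
- by move=> y; split => // x /A_sub[].
- move=> y y' yy' y'a.
  rewrite /A; case: (leP y 0%R) => [_|y0]; first by move=> x [].
  have y'0 := lt_le_trans y0 yy'; rewrite [(y' <= 0)%R]leNgt y'0 /=.
  have ya : y%:E < a by apply: le_lt_trans y'a; rewrite lee_fin.
  (* If the level drops, [A y] lies in [V (level y)], hence in the uncut part of [A y']; otherwise
     both sets cut the same layer and the radii are ordered. *)
  have := @level_anti y y' (conj y0 ya) (conj y'0 y'a) yy'.
  rewrite leq_eqVlt => /predU1P[ll|ll]; last first.
    by move=> x [|[[]]] Vx; left; apply: V_anti Vx; rewrite // ltnS ltnW.
  rewrite ll; apply: setUS; apply: setIS; apply: subset_itvl; rewrite bnd_simp.
  have [e0 eC] := excessP (conj y'0 y'a).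
  rewrite ll in eC; apply: le_cut_radius => //.
  by rewrite /excess ll lerD2r.
move=> y y0 ya.
have mfn : lebesgue_mfun I (EFin \o (fun x => `|f x|%R)).
  by apply/lmfun_EFin; exact: L0_normr.
have mfA : lebesgue_mfun (A y) (EFin \o (fun x => `|f x|%R)).
  by apply: lmfunS mfn => // x /A_sub[].
have [y1|y1] := leP y 0%R.
  rewrite set_itv_ge ?int_set0 -?leNgt ?bnd_simp//.
  by rewrite adde_ge0 ?int_ge0 ?lee_fin ?mulr_ge0// ltW.
have Iy : I y by [].
(* The error [d * y] is a shift of [|f|] by [d] on a set of measure [y], which allows a comparison
   level by level. *)
have -> : \int[leb]_(x in A y) `|f x|%:E + (d * y)%:E =
          \int[leb]_(x in A y) (`|f x| + d)%:E.
  rewrite EFinM -(lebA y0 ya) -int_cst// -intD//; first exact: lmfun_cst.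
  by move=> *; rewrite lee_fin ltW.
rewrite -[leLHS](@int_eq _ _ (fun x => rearr leb I f x * 1)); last first.
  by move=> x _; rewrite mule1.
rewrite -[leRHS](@int_eq _ _ (fun x => (`|f x| + d)%:E * 1)); last first.
  by move=> x _; rewrite mule1.
have md : lebesgue_mfun (A y) (EFin \o (fun x => (`|f x| + d)%R)).
  apply/lmfun_EFin; move/lmfun_EFin: mfA => mfA.
  by apply: measurable_funD => //; exact: measurable_cst.
have mitv : lebesgue_measurable `]0%R, y]%classic by exact: lmeas_itv.
have mr : lebesgue_mfun `]0%R, y]%classic (rearr leb I f).
  by apply: lmfun_rearr; exact: interval_is_interval.
have mS (s : R) : lebesgue_measurable (`]0%R, y] `&` [set t | s%:E < rearr leb I f t]).
  exact: lmeas_gt.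
have mT (s : R) : lebesgue_measurable (A y `&` [set x | s%:E < (`|f x| + d)%:E]).
  exact: (lmeas_gt _ (mA y) md).
rewrite (@layer_cake_lt _ _ (rearr leb I f) (fun=> 1) mitv mr (@lmfun_cst R _ 1)); last 2 first.
- by move=> x _; exact: rearr_ge0.
- by move=> x _; exact: lee01.
rewrite (@layer_cake_lt _ _ (fun x => (`|f x| + d)%:E) (fun=> 1) (mA y) md
  (@lmfun_cst R _ 1)); last 2 first.
- by move=> x _; rewrite lee_fin addr_ge0// ltW.
- by move=> x _; exact: lee01.
apply: int_le.
- exact: lmeas_itv.
- apply: lmfun_antitone; first exact: interval_is_interval.
  move=> s s' _ _ ss'; apply: int_subset => //; first exact: lmfun_cst.
  by move=> x [Dx /= H]; split => //=; apply: le_lt_trans H; rewrite lee_fin.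
- apply: lmfun_antitone; first exact: interval_is_interval.
  move=> s s' _ _ ss'; apply: int_subset => //; first exact: lmfun_cst.
  by move=> x [Dx /= H]; split => //=; apply: le_lt_trans H; rewrite lee_fin.
- by move=> s _; apply: int_ge0.
move=> s; rewrite /= in_itv/= andbT => s0.
rewrite !int_cst// !mul1e.
(* Below this height the shifted function exceeds [s] on all of [A y], of measure [y]; from it on,
   the set where [|f| > s] lies in [V (level y).+1], which [A y] contains. *)
have [sd|ds] := ltP s (d * (level y).+1%:R)%R.
  apply: (@le_trans _ _ (leb `]0%R, y]%classic)); first by apply: le_leb.
  rewrite leb_itv_oc// subr0 -(lebA y0 ya); apply: le_leb => // x Ax; split => //=.
  rewrite lte_fin (lt_le_trans sd)// -natr1 mulrDr mulr1 lerD2r.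
  by have [] := A_sub Ax.
apply: (@le_trans _ _ (tail leb I f s)).
  rewrite -[leRHS]leb_interval0 ?leb_ge0//; apply: le_leb => //.
    exact: lmeas_interval0.
  move=> t [/=]; rewrite in_itv/= => /andP[t0 _] st; split => //.
  exact: lt_rearr_tail.
apply: le_leb => //; first exact: lmeas_tail.
move=> x [Ix /= sf]; split; last first.
  by rewrite /= lte_fin (lt_le_trans sf)// lerDl ltW.
rewrite /A ifF; last by apply/negbTE; rewrite -ltNge.
by left; split => //=; apply: le_trans ds _; exact: ltW.
Qed.

End near_optimal.

(** * The level function *)

Opaque primitive.

Lemma expr_unbounded {R : realType} (x r : R) : (1 < r)%R ->
  exists n, (x <= r ^+ n)%R.
Proof.
move=> r1; have r0 : (0 < r - 1)%R by rewrite subr_gt0.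
have bernoulli n : (1 + n%:R * (r - 1) <= r ^+ n)%R.
  elim: n => [|n IH]; first by rewrite expr0 mul0r addr0.
  rewrite exprS; apply: le_trans (ler_wpM2l _ IH); last by rewrite ltW// (lt_trans ltr01).
  by have := mulr_ge0 (ler0n R n) (sqr_ge0 (r - 1)); rewrite -natr1; lra.
exists (Num.truncn (`|x| / (r - 1))).+1; apply: le_trans (bernoulli _).
apply: (@le_trans _ _ `|x|%R); first exact: ler_norm.
by rewrite -[leLHS]add0r lerD// -ler_pdivrMr// ltW// truncnS_gt.
Qed.

Section level_function.
Context {R : realType}.
Variables (a : \bar R) (u w : R -> R).
Local Notation I := (interval0 a).
Hypotheses (hu : decreasing_weight a u) (hw : decreasing_weight a w).
Hypothesis w_gt0 : forall x, I x -> (0 < w x)%R.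
Hypothesis u_right : forall t (c : R), I t ->
  (forall y, I y -> (t < y)%R -> (u y <= c)%R) -> (u t <= c)%R.
Local Notation F := (primitive u).
Local Notation W := (primitive w).
Hypothesis F_le_W : forall t, I t -> exists C : R,
  forall y, I y -> (t <= y)%R -> (F y <= C * W y)%R.
Implicit Types (l s t x y z r : R).
Local Open Scope ring_scope.

(* The largest record point is the last maximum point of F - l W on I, that is
   the point where the slope of the least concave majorant of F as a function of
   W falls below l; hence level t is the slope of this majorant at t. *)
Definition record_point l x := [/\ 0 <= x, (x%:E < a)%E &
  forall y, 0 <= y -> y <= x -> F y - l * W y <= F x - l * W x].

(** Keeps its meaning when the record points of [l] have no largest element in [I], unlike
    [last_record]. *)
Definition below_record l t := exists2 y, record_point l y & t < y.

(* Junk value 0 when the record points are unbounded. *)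
Definition last_record l := sup [set x | record_point l x].

Definition level t := inf [set l | 0 < l /\ ~ below_record l t].

Definition level_weight t := if level t == 0 then w t else u t / level t.

Lemma record_point0 l : record_point l 0.
Proof.
split => //; first exact: (dw_pos hu).
by move=> y y0 y0'; rewrite (_ : y = 0)//; apply/eqP; rewrite eq_le y0 y0'.
Qed.

(** Lowering the slope adds the nondecreasing function [(l' - l) W], which preserves record
    points. *)
Lemma record_point_anti l l' x : l <= l' -> record_point l' x -> record_point l x.
Proof.
move=> ll' [x0 xa H]; split => // y y0 yx; have := H y y0 yx.
have := primitive_mono hw y0 yx xa; nra.
Qed.

Lemma below_record_anti l l' t : l <= l' -> below_record l' t -> below_record l t.
Proof. by move=> ll' [y ry ty]; exists y => //; exact: record_point_anti ry. Qed.

Lemma below_record_le l t t' : t <= t' -> below_record l t' -> below_record l t.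
Proof. by move=> tt' [y ry ty]; exists y => //; exact: le_lt_trans ty. Qed.

Lemma W_gt0 y : I y -> 0 < W y.
Proof.
move=> [y0 ya]; have y2 : I (y / 2).
  split; first by rewrite divr_gt0.
  by apply: lt_trans ya; rewrite lte_fin ltr_pdivrMr// ltr_pMr// ltr1n.
have h : y / 2 <= y by rewrite ler_pdivrMr// ler_pMr// ler1n.
have := primitive_lower hw (lexx 0) (ltW y0) ya (dw_ge0 hw (conj y0 ya)).
rewrite (@primitive_le0 R w 0 (lexx 0)) !subr0 => H; apply: lt_le_trans (H _).
  by rewrite mulr_gt0// w_gt0.
by move=> t t0 ty; apply: (dw_anti hw) => //; [split => //; apply: lt_trans ya|exact: ltW].
Qed.

(** A record point [y > t] has [F y >= l W y], by comparison with the value at 0; this contradicts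
    [F <= C W] beyond [t] once [l > C]. *)
Lemma below_record_bounded t : I t -> exists2 l, 0 < l & ~ below_record l t.
Proof.
move=> It; have [C HC] := F_le_W It; exists (`|C| + 1); first by rewrite ltr_wpDl.
move=> [y [y0 ya Hy] ty]; have Iy : I y by split => //; apply: lt_trans ty; case: It.
have := Hy 0 (lexx _) y0; rewrite !(@primitive_le0 R _ 0 (lexx 0)) mulr0 subrr.
have := HC y Iy (ltW ty); have := W_gt0 Iy; have := ler_norm C; nra.
Qed.

Section last_record.
Variables (l t : R).
Hypotheses (l0 : 0 < l) (It : I t) (nB : ~ below_record l t).

Let ub : ubound [set x | record_point l x] t.
Proof. by move=> y ry; rewrite leNgt; apply/negP => ty; apply: nB; exists y. Qed.

Let hs : has_sup [set x | record_point l x].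
Proof. by split; [exists 0; exact: record_point0|exists t]. Qed.

Lemma le_last_record x : record_point l x -> x <= last_record l.
Proof. by move=> rx; apply: ub_le_sup => //; exists t. Qed.

Lemma last_record_le : last_record l <= t.
Proof. by apply: ge_sup => //; exists 0; exact: record_point0. Qed.

Lemma last_record_ge0 : 0 <= last_record l.
Proof. by apply: le_last_record; exact: record_point0. Qed.

Lemma lt_last_record s : s < last_record l -> below_record l s.
Proof. by move=> /(sup_gt (ex_intro _ 0 (record_point0 l)))[y ry sy]; exists y. Qed.

Lemma last_record_lta : ((last_record l)%:E < a)%E.
Proof. by case: It => _; apply: le_lt_trans; rewrite lee_fin; exact: last_record_le. Qed.

(** A record [z'] near the supremum and not before [y] beats [y]; going on from [z'] to the supremum
    does not lower [F] and costs at most [e] in [l W]. *)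
Lemma last_recordP : record_point l (last_record l).
Proof.
split; [exact: last_record_ge0|exact: last_record_lta|].
move=> y y0; rewrite le_eqVlt => /predU1P[->//|yx].
apply/ler_addgt0Pr => e e0.
have el : 0 < e / l by rewrite divr_gt0.
have [d d0 Hd] := primitive_modulus hw last_record_lta el.
have [z rz zd] := sup_adherent d0 hs.
have [z' [rz' z'd yz']] : exists z', [/\ record_point l z', last_record l - d < z' & y <= z'].
  have [z' rz' yz'] := lt_last_record yx.
  have [zz|zz] := leP z z'; [exists z'|exists z]; split => //.
  - exact: lt_le_trans zz.
  - exact: ltW.
  - by rewrite ltW// (lt_trans yz').
have [z'0 z'a Hz'] := rz'.
have z'x := le_last_record rz'.
have := Hz' y y0 yz'.
have := Hd _ _ z'0 z'x (lexx _).
rewrite ltrBlDl addrC -ltrBlDl => /(_ _)/= Hd'.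
have {}Hd' : W (last_record l) - W z' <= e / l.
  by apply: Hd' => //; rewrite ltrBlDr addrC -ltrBlDr.
have := primitive_mono hu z'0 z'x last_record_lta.
have : l * (W (last_record l) - W z') <= e.
  by rewrite mulrC -ler_pdivlMr.
lra.
Qed.

(** A maximum point of [F - l W] on [[0, y]] is a record point, hence does not exceed the last one,
    which beats it. *)
Lemma last_record_max y : 0 <= y -> (y%:E < a)%E ->
  F y - l * W y <= F (last_record l) - l * W (last_record l).
Proof.
move=> y0 ya.
have cG : {within `[0, y], continuous (fun x => F x - l * W x)}.
  move=> x; apply: cvgB; first exact: (primitive_continuous hu ya).
  by apply: cvgM; [exact: cvg_cst|exact: (primitive_continuous hw ya)].
have [c + cmax] := EVT_max y0 cG; rewrite in_itv/= => /andP[c0 cy].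
have rc : record_point l c.
  split => //; first by apply: le_lt_trans ya; rewrite lee_fin.
  by move=> z z0 zc; apply: cmax; rewrite in_itv/= z0 (le_trans zc).
apply: (le_trans (cmax y _)); first by rewrite in_itv/= y0 lexx.
by have [_ _] := last_recordP; apply => //; exact: le_last_record.
Qed.

Lemma le_after_last_record y : I y -> last_record l <= y -> ~ below_record l y.
Proof.
move=> Iy xy [z rz]; apply/negP; rewrite -leNgt; apply: le_trans xy.
exact: le_last_record.
Qed.

(** With [x] the last record, [u y (y - x) <= F y - F x <= l (W y - W x) <= l w(x) (y - x)].
    Dividing asks for [y > x], while [t = x] is allowed; right continuity of [u] carries the bound
    down to [t]. *)
Lemma weight_le_after : 0 < last_record l -> u t <= l * w (last_record l).
Proof.
move=> x0; have [t0 ta] := It; set x := last_record l.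
have Ix : I x by split => //; exact: last_record_lta.
apply: u_right => // y [y0 ya] ty.
have xy : x < y by apply: le_lt_trans ty; exact: last_record_le.
have := last_record_max (ltW y0) ya; rewrite -/x => H.
have yx0 : 0 < y - x by rewrite subr_gt0.
rewrite -(ler_pM2r yx0).
have H1 : u y * (y - x) <= F y - F x.
  apply: (primitive_lower hu (ltW x0) (ltW xy) ya (dw_ge0 hu (conj y0 ya))) => s xs sy.
  apply: (dw_anti hu) => //; last exact: ltW.
  by split; [exact: lt_trans xs|apply: lt_trans ya].
have H2 : W y - W x <= w x * (y - x).
  apply: (primitive_upper hw (ltW x0) (ltW xy) ya) => s xs sy.
  apply: (dw_anti hw) => //; last exact: ltW.
  by split; [exact: lt_trans xs|apply: lt_trans ya].
have := ler_wpM2l (ltW l0) H2; lra.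
Qed.

End last_record.

(** Mirror image of [weight_le_after]: chords of [F] against [W] that end at a record point have
    slope at least [l]. *)
Lemma weight_ge_before l s x : 0 <= l -> record_point l x -> 0 < s -> s < x ->
  l * w x <= u s.
Proof.
move=> l0 [x0 xa H] s0 sx.
have Ix : I x by split => //; exact: lt_trans sx.
have Is : I s by split => //; apply: lt_trans xa.
have := H s (ltW s0) (ltW sx) => H0.
have xs0 : 0 < x - s by rewrite subr_gt0.
rewrite -(ler_pM2r xs0).
have H1 : w x * (x - s) <= W x - W s.
  apply: (primitive_lower hw (ltW s0) (ltW sx) xa (dw_ge0 hw Ix)) => t st tx.
  apply: (dw_anti hw) => //; last exact: ltW.
  by split; [exact: lt_trans st|apply: lt_trans xa].
have H2 : F x - F s <= u s * (x - s).
  apply: (primitive_upper hu (ltW s0) (ltW sx) xa) => t st tx.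
  apply: (dw_anti hu) => //; last exact: ltW.
  by split; [exact: lt_trans st|apply: lt_trans xa].
have := ler_wpM2l l0 H1; lra.
Qed.

Lemma level_ge0 t : I t -> 0 <= level t.
Proof.
move=> It; apply: lb_le_inf; last by move=> l [/ltW].
by have [l l0 nB] := below_record_bounded It; exists l.
Qed.

Let has_inf_level t : I t -> has_inf [set l | 0 < l /\ ~ below_record l t].
Proof.
move=> It; split; last by exists 0 => l [/ltW].
by have [l l0 nB] := below_record_bounded It; exists l.
Qed.

Lemma lt_level l t : I t -> 0 < l -> l < level t -> below_record l t.
Proof.
move=> It l0; apply: contraPP => nB; apply/negP; rewrite -leNgt.
by apply: ge_inf; [exact: (has_inf_level It).2|].
Qed.

Lemma level_lt l t : I t -> level t < l -> ~ below_record l t.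
Proof.
move=> It /(inf_lt (has_inf_level It).1)[l' [l'0 nB] l'l] B.
by apply: nB; apply: below_record_anti B; exact: ltW.
Qed.

Lemma level_le l t : I t -> 0 < l -> ~ below_record l t -> level t <= l.
Proof.
by move=> It l0 nB; rewrite leNgt; apply/negP => /(lt_level It l0).
Qed.

Lemma level_anti s t : I s -> I t -> s <= t -> level t <= level s.
Proof.
move=> Is It st; apply: lb_le_inf; first exact: (has_inf_level Is).1.
move=> l [l0 nB]; apply: level_le => //; apply: contra_not nB.
exact: below_record_le.
Qed.

(** At level 0 every slope [l > 0] has its last record no later than [t], and beyond that record [F]
    gains at most [l W y] up to [y]; [l] is chosen to make this equal to [e]. *)
Lemma level_eq0 t : I t -> level t = 0 -> u t = 0.
Proof.
move=> It lt0; apply/eqP; rewrite eq_le (dw_ge0 hu)// andbT.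
have [t0 ta] := It.
apply: u_right => // y [y0 ya] ty.
have yt : 0 < y - t by rewrite subr_gt0.
rewrite -(pmulr_lle0 _ yt); apply/ler_addgt0Pr => e e0; rewrite add0r.
have Wy : 0 < W y by apply: W_gt0.
pose l := e / W y; have l0 : 0 < l by rewrite divr_gt0.
have nB : ~ below_record l t by apply: level_lt => //; rewrite lt0.
have x0 := last_record_ge0 nB; have xt := last_record_le nB.
have xa := last_record_lta It nB.
have := last_record_max l0 It nB (ltW y0) ya.
have xy : last_record l <= y by apply: le_trans (ltW ty).
have lW : l * W y = e by rewrite /l divfK// gt_eqF.
have H1 : u y * (y - last_record l) <= F y - F (last_record l).
  apply: (primitive_lower hu x0 xy ya (dw_ge0 hu (conj y0 ya))) => s xs sy.
  apply: (dw_anti hu) => //; last exact: ltW.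
  by split; [exact: le_lt_trans xs|apply: lt_trans ya].
have := primitive_ge0 hw xa.
have := dw_ge0 hu (conj y0 ya).
nra.
Qed.

Lemma level_gt0 t : I t -> 0 < level t -> 0 < u t.
Proof.
move=> It lt0; have l2 : 0 < level t / 2 by rewrite divr_gt0.
have [] := lt_level It l2.
  by rewrite ltr_pdivrMr// ltr_pMr// ltr1n.
move=> y ry ty; apply: lt_le_trans (weight_ge_before (ltW l2) ry _ ty); last by case: It.
have [_ ya _] := ry.
by rewrite mulr_gt0// w_gt0//; split => //; apply: lt_trans ty; case: It.
Qed.

Lemma level_weight_gt0 t : I t -> 0 < level_weight t.
Proof.
move=> It; rewrite /level_weight; case: eqVneq => [_|l0]; first exact: w_gt0.
have lt0 : 0 < level t by rewrite lt_neqAle eq_sym l0 level_ge0.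
by rewrite divr_gt0//; exact: level_gt0.
Qed.

Lemma level_weightE t : I t -> u t = level t * level_weight t.
Proof.
move=> It; rewrite /level_weight; case: eqVneq => [l0|l0].
  by rewrite l0 mul0r level_eq0.
by rewrite mulrC divfK.
Qed.

(** If the level drops between [s] and [t], the last record [x] of an intermediate slope lies in
    []s, t]], and [w x] separates the two values. If it does not drop, [level_weight] is [w], or [u]
    over a constant, at both points. *)
Lemma level_weight_anti s t : I s -> I t -> s <= t -> level_weight t <= level_weight s.
Proof.
move=> Is It; rewrite le_eqVlt => /predU1P[->//|st].
have lst := level_anti Is It (ltW st).
have ls0 := level_ge0 Is; have lt0 := level_ge0 It.
rewrite {2}/level_weight; case: eqVneq => [ls|ls].
  rewrite /level_weight ifT; first by apply: (dw_anti hw) => //; exact: ltW.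
  by rewrite eq_le lt0 -ls lst.
have {ls0 ls}ls0 : 0 < level s by rewrite lt_neqAle eq_sym ls.
have [lE|lN] := eqVneq (level t) (level s).
  rewrite /level_weight lE gt_eqF// ler_pM2r ?invr_gt0//.
  by apply: (dw_anti hu) => //; exact: ltW.
have {}lst : level t < level s by rewrite lt_neqAle lN.
pose l := (level t + level s) / 2.
have [tl ls] : level t < l /\ l < level s by rewrite /l !midf_lt.
have l0 : 0 < l by exact: le_lt_trans tl.
have nB := level_lt It tl.
set x := last_record l.
have xt : x <= t by exact: last_record_le nB.
have [s0 sa] := Is; have [t0 ta] := It.
have sx : s < x.
  have [y ry sy] := lt_level Is l0 ls.
  by apply: lt_le_trans sy _; exact: le_last_record nB _ ry.
have x0 : 0 < x by exact: lt_trans sx.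
have Ix : I x by split => //; exact: last_record_lta It nB.
apply: (@le_trans _ _ (w x)).
  rewrite /level_weight; case: eqVneq => [_|lt0']; first exact: (dw_anti hw).
  have {lt0 lt0'}lt0 : 0 < level t by rewrite lt_neqAle eq_sym lt0'.
  rewrite ler_pdivrMr// mulrC.
  apply/ler_addgt0Pr => e e0.
  (* Lowering the slope towards [level t] can only move its last record to the right of [x], where
     [w] is at most [w x]; the excess over [level t] costs at most [e]. *)
  pose l' := Order.min l (level t + e / w x).
  have wx0 := w_gt0 Ix.
  have l't : level t < l' by rewrite /l' lt_min tl ltrDl divr_gt0.
  have l'l : l' <= l by rewrite /l' ge_min lexx.
  have l'e : l' <= level t + e / w x by rewrite /l' ge_min lexx orbT.
  have nB' := level_lt It l't.
  have l'0 : 0 < l' by exact: lt_trans l't.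
  have xx' : x <= last_record l'.
    apply: (le_last_record nB'); apply: record_point_anti l'l _.
    exact: last_recordP l0 It nB.
  have x'0 : 0 < last_record l' by exact: lt_le_trans xx'.
  apply: le_trans (weight_le_after l'0 It nB' x'0) _.
  apply: (@le_trans _ _ (l' * w x)).
    rewrite ler_pM2l//; apply: (dw_anti hw) => //.
    by split => //; exact: last_record_lta It nB'.
  apply: (@le_trans _ _ ((level t + e / w x) * w x)).
    by rewrite ler_pM2r.
  by rewrite mulrDl divfK// gt_eqF.
rewrite ler_pdivlMr// mulrC.
apply/ler_addgt0Pr => e e0.
have wx0 := w_gt0 Ix.
(* Raising the slope towards [level s] leaves a record past [s], not after [x], where [w] is at
   least [w x]. *)
pose l' := Order.max l (level s - e / w x).
have l's : l' < level s by rewrite /l' gt_max ls ltrBlDr ltrDl divr_gt0.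
have ll' : l <= l' by rewrite /l' le_max lexx.
have el' : level s - e / w x <= l' by rewrite /l' le_max lexx orbT.
have l'0 : 0 < l' by exact: lt_le_trans ll'.
have [y ry sy] := lt_level Is l'0 l's.
have := weight_ge_before (ltW l'0) ry s0 sy.
have yx : y <= x by apply: (le_last_record nB); exact: record_point_anti ry.
have [_ ya _] := ry.
have wxy : w x <= w y.
  by apply: (dw_anti hw) => //; split => //; exact: lt_trans sy.
move=> H.
have : l' * w x <= u s by apply: le_trans H; rewrite ler_pM2l.
have : (level s - e / w x) * w x <= l' * w x by rewrite ler_pM2r.
rewrite mulrBl divfK ?gt_eqF//; lra.
Qed.

Lemma level_weight_L0 : L0 I level_weight.
Proof.
by apply: lmeas_antitoneR; [exact: interval0_is_interval|exact: level_weight_anti].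
Qed.

Let lw_lmfun x y : 0 <= x -> (y%:E < a)%E ->
  lebesgue_mfun `]x, y]%classic (EFin \o level_weight).
Proof.
move=> x0 ya; apply: (@lmfunS _ _ I); [exact: lmeas_interval0|exact: itv_interval0|].
by apply/lmfun_EFin; exact: level_weight_L0.
Qed.

Let lw_ge0 x y t : 0 <= x -> (y%:E < a)%E -> `]x, y]%classic t ->
  (0 <= (level_weight t)%:E)%E.
Proof.
move=> x0 ya xyt; rewrite lee_fin ltW//; apply: level_weight_gt0.
exact: itv_interval0 xyt.
Qed.

Let int_split x y z : 0 <= x -> x <= y -> y <= z -> (z%:E < a)%E ->
  (\int[leb]_(t in `]x, z]) (level_weight t)%:E =
   \int[leb]_(t in `]x, y]) (level_weight t)%:E +
   \int[leb]_(t in `]y, z]) (level_weight t)%:E)%E.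
Proof.
move=> x0 xy yz za.
have -> : `]x, z]%classic = `]x, y]%classic `|` `]y, z]%classic.
  by rewrite -itv_bndbnd_setU// bnd_simp.
rewrite int_setU; [by []|exact: lmeas_itv|exact: lmeas_itv| | |].
- by rewrite -itv_bndbnd_setU ?bnd_simp//; exact: lw_lmfun.
- by rewrite -itv_bndbnd_setU ?bnd_simp// => t; exact: lw_ge0.
- apply/seteqP; split => // t [/=]; rewrite !in_itv/= => /andP[_ tx] /andP[xt _].
  by move: (le_lt_trans tx xt); rewrite ltxx.
Qed.

(** On the cell [level_weight = u / level <= u / c], and [F] has chord slope at most [c * r]. The
    bound on the level is asked for strictly inside, since it may already have dropped at the right
    end. *)
Let int_level_weight_step r c x y : 0 < c -> 0 <= x -> x <= y -> (y%:E < a)%E ->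
  (forall t, x < t -> t < y -> c <= level t) ->
  F y - F x <= c * r * (W y - W x) ->
  (\int[leb]_(t in `]x, y]) (level_weight t)%:E <= (r * (W y - W x))%:E)%E.
Proof.
move=> c0 x0 xy ya H FW.
have mitv : lebesgue_measurable `]x, y]%classic by exact: lmeas_itv.
have mu' := dw_lmfun_itv hu x0 ya.
have u0 t : `]x, y]%classic t -> (0 <= (u t)%:E)%E by exact: (dw_ge0_itv hu x0 ya).
apply: (@le_trans _ _ (\int[leb]_(t in `]x, y]) ((c^-1)%R%:E * (u t)%:E))%E).
  have moo : lebesgue_measurable `]x, y[%classic by exact: lmeas_itv.
  have ooS : `]x, y[%classic `<=` `]x, y]%classic by apply: subset_itvl; rewrite bnd_simp.
  have mcu : lebesgue_mfun `]x, y]%classic (fun t => (c^-1)%:E * (u t)%:E)%E.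
    by apply: (@lmfunM _ _ (cst _)) => //; exact: lmfun_cst.
  rewrite !int_oc_oo//; [|by move=> t /u0 ?; rewrite mule_ge0// lee_fin invr_ge0 ltW|
    exact: lw_lmfun|by move=> t; exact: lw_ge0].
  apply: int_le => //.
  - by apply: (lmfunS _ ooS) => //; exact: lw_lmfun.
  - exact: (lmfunS _ ooS).
  - by move=> t /ooS; exact: lw_ge0.
  move=> t txy; have It : I t by exact: itv_interval0 (ooS _ txy).
  move: txy; rewrite /= in_itv/= => /andP[xt ty].
  have cl := H t xt ty; have l0 : 0 < level t by exact: lt_le_trans cl.
  rewrite -EFinM lee_fin /level_weight gt_eqF// mulrC ler_wpM2r ?(dw_ge0 hu)//.
  by rewrite lef_pV2.
rewrite intZl ?invr_ge0 ?(ltW c0)// (primitive_diff hu)// -EFinM lee_fin.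
by rewrite ler_pdivrMl// mulrA.
Qed.

(** The slopes [l j] grow geometrically from [r * level t], and their last records move from [t]
    towards 0. Between consecutive ones the level is at least [l j], while the chord slope of [F] is
    at most [l j.+1 = r * l j]. Finitely many cells reach [s], because large slopes have no record
    past [s]; near 0 the levels may be unbounded. *)
Lemma int_level_weight_le_aux r s t : 1 < r -> I t -> 0 < level t -> 0 < s -> s <= t ->
  (\int[leb]_(x in `]s, t]) (level_weight x)%:E <= (r * W t)%:E)%E.
Proof.
move=> r1 It lt0 s0 st; have [t0 ta] := It.
have r0 : 0 < r by exact: lt_trans r1.
pose l j := r * level t * r ^+ j.
have l0 j : 0 < l j by rewrite /l !mulr_gt0// exprn_gt0.
have lmono j j' : (j <= j')%N -> l j <= l j'.
  by move=> jj'; rewrite /l ler_pM2l ?mulr_gt0// ler_weXn2l// ltW.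
have lt_l j : level t < l j.
  by apply: lt_le_trans (lmono _ _ (leq0n j)); rewrite /l expr0 mulr1 ltr_pMl.
have nB j : ~ below_record (l j) t by exact: level_lt.
pose x j := last_record (l j).
have x0 j : 0 <= x j by exact: last_record_ge0 (nB j).
have xt j : x j <= t by exact: last_record_le (nB j).
have xa j : ((x j)%:E < a)%E by exact: last_record_lta It (nB j).
have rx j : record_point (l j) (x j) by exact: last_recordP (l0 j) It (nB j).
have xS j : x j.+1 <= x j.
  apply: (le_last_record (nB j)); apply: record_point_anti (rx j.+1); exact: lmono.
have x_s j m : ~ below_record m s -> m <= l j -> x j <= s.
  move=> nBm mj; apply: last_record_le; apply: contra_not nBm; exact: below_record_anti.
have step0 : F t - l 0%N * W t <= F (x 0%N) - l 0%N * W (x 0%N).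
  exact: (last_record_max (l0 0%N) It (nB 0%N) (ltW t0) ta).
have stepS j : F (x j) - l j.+1 * W (x j) <= F (x j.+1) - l j.+1 * W (x j.+1).
  exact: (last_record_max (l0 j.+1) It (nB j.+1) (x0 j) (xa j)).
have lE0 : l 0%N = r * level t by rewrite /l expr0 mulr1.
have lES j : l j.+1 = l j * r by rewrite /l exprSr mulrA.
have gap j y : x j.+1 < y -> y < x j -> l j <= level y.
  move=> xy yx; have Iy : I y.
    by split; [exact: le_lt_trans xy|apply: lt_trans (xa j)].
  by rewrite leNgt; apply/negP => /(level_lt Iy); apply; exact: lt_last_record.
have [j0 Hj0] : exists j, x j <= s.
  have Is : I s by split => //; apply: le_lt_trans ta; rewrite lee_fin.
  have [m m0 nBm] := below_record_bounded Is.
  have rl0 : 0 < r * level t by rewrite mulr_gt0.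
  have [j mj] := expr_unbounded (m / (r * level t)) r1.
  by exists j; apply: x_s nBm _; rewrite /l mulrC -ler_pdivrMr.
clear x_s rx nB lt_l lmono; clearbody x l.
have key j : (\int[leb]_(y in `]x j, t]) (level_weight y)%:E <= (r * (W t - W (x j)))%:E)%E.
  elim: j => [|j IH].
    apply: (@int_level_weight_step _ (level t)) => //.
      move=> y xy yt; apply: level_anti => //; last exact: ltW.
      by split; [exact: le_lt_trans xy|apply: lt_trans ta].
    by move: step0; rewrite lE0; lra.
  rewrite (int_split (x0 _) (xS _) (xt _) ta).
  have -> : (r * (W t - W (x j.+1)))%:E =
      ((r * (W (x j) - W (x j.+1)))%:E + (r * (W t - W (x j)))%:E)%E.
    by rewrite -EFinD; congr EFin; ring.
  apply: leeD IH; apply: (@int_level_weight_step _ (l j)); [exact: l0|exact: x0|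
    exact: xS|exact: xa|exact: gap|].
  by move: (stepS j); rewrite lES; lra.
apply: (@le_trans _ _ (\int[leb]_(y in `]x j0, t]) (level_weight y)%:E)%E).
  apply: int_subset; [exact: lmeas_itv|exact: lmeas_itv|exact: lw_lmfun|
    by move=> y; exact: lw_ge0|].
  by apply: subset_itvr; rewrite bnd_simp.
apply: le_trans (key j0) _; rewrite lee_fin ler_pM2l// lerBlDr lerDl.
exact: (primitive_ge0 hw).
Qed.

(** Let [p] be the supremum of the points up to [x] with positive level (0 is added to have a
    nonempty set). Before [p] the previous estimate applies with [s] tending to 0 and [r] to 1;
    after [p] the weight is [w]. *)
Lemma int_level_weight_le x : I x ->
  (\int[leb]_(t in `]0%R, x]) (level_weight t)%:E <= (W x)%:E)%E.
Proof.
move=> Ix; have [x0 xa] := Ix.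
pose S := [set t | t = 0 \/ [/\ I t, t <= x & 0 < level t]].
have hS : has_sup S.
  split; first by exists 0; left.
  by exists x => t [->|[]//]; exact: ltW.
set p := sup S.
have p0 : 0 <= p by apply: ub_le_sup; [exact: hS.2|left].
have px : p <= x.
  by apply: ge_sup; [exact: hS.1|move=> t [->|[]//]; exact: ltW].
have pa : (p%:E < a)%E by apply: le_lt_trans xa; rewrite lee_fin.
have lo t : I t -> t < p -> 0 < level t.
  move=> It /(sup_gt hS.1)[t' [->|[It' t'x l0] tt']].
    by move=> t0; have := lt_trans It.1 t0; rewrite ltxx.
  by apply: lt_le_trans l0 _; apply: level_anti => //; exact: ltW.
have hi t : p < t -> t <= x -> level_weight t = w t.
  move=> pt tx; have It : I t.
    by split; [exact: le_lt_trans pt|apply: le_lt_trans xa; rewrite lee_fin].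
  rewrite /level_weight ifT//; rewrite eq_le level_ge0// andbT leNgt.
  apply/negP => l0; move: pt; rewrite ltNge => /negP; apply.
  by apply: ub_le_sup; [exact: hS.2|right].
rewrite (int_split (lexx 0) p0 px xa).
have -> : (W x)%:E = ((W p)%:E + (W x - W p)%:E)%E by rewrite -EFinD addrC subrK.
apply: leeD; last first.
  rewrite -(primitive_diff hw)//.
  rewrite le_eqVlt; apply/orP; left; apply/eqP; apply: int_eq => t /=.
  by rewrite in_itv/= => /andP[pt tx]; rewrite hi.
have Wp0 : 0 <= W p by exact: (primitive_ge0 hw).
rewrite int_oc_oo; [|exact: lw_lmfun|by move=> t; exact: lw_ge0].
have -> : `]0, p[%classic = interval0 p%:E.
  by apply/seteqP; split => y /=; rewrite /interval0/= in_itv/= lte_fin => /andP.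
have sub : interval0 p%:E `<=` I.
  by move=> y [y0 yp]; split => //; apply: lt_trans pa.
have key r : 1 < r -> (\int[leb]_(t in interval0 p%:E) (level_weight t)%:E <= (r * W p)%:E)%E.
  move=> r1; apply: int_interval0_le.
  - by rewrite lee_fin mulr_ge0// ltW// (lt_trans _ r1).
  - apply: (lmfunS _ sub); first exact: lmeas_interval0.
    by apply/lmfun_EFin; exact: level_weight_L0.
  - by move=> y /sub Iy; rewrite lee_fin ltW// level_weight_gt0.
  - move=> s t s0 st tp; have It : I t by apply: sub; split => //; exact: lt_trans st.
    apply: le_trans (int_level_weight_le_aux r1 It (lo _ It _) s0 (ltW st)) _ => //.
    rewrite lee_fin ler_pM2l ?(lt_trans _ r1)//.
    by apply: (primitive_mono hw); [exact: ltW It.1|exact: ltW|].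
apply/lee_addgt0Pr => e e0.
apply: le_trans (key (1 + e / (W p + 1)) _) _.
  by rewrite ltrDl divr_gt0// ltr_wpDl.
rewrite -EFinD lee_fin mulrDl mul1r lerD2l mulrAC ler_pdivrMr ?ltr_wpDl//.
by rewrite ler_pM2l// lerDl.
Qed.

Lemma level_weight_decreasing : decreasing_weight a level_weight.
Proof.
split; first exact: (dw_pos hu).
- by move=> x /level_weight_gt0/ltW.
- exact: level_weight_anti.
- by move=> x /int_level_weight_le/le_lt_trans; apply; rewrite ltry.
Qed.

End level_function.

(** * Rearrangements as weights, and fully symmetric spaces *)

Section decreasing_rearrangement.
Context {R : realType}.
Implicit Types (a b : \bar R) (D : set R) (f g v w : R -> R) (E : fspace R).

Lemma ae_onW D (P : R -> Prop) : (forall x, D x -> P x) -> ae_on D P.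
Proof. by move=> H; exact: (aeW (leb : {measure set (lebesgue_type R) -> \bar R})). Qed.

Lemma ae_onS2 D (P Q S : R -> Prop) : (forall x, D x -> P x -> Q x -> S x) ->
  ae_on D P -> ae_on D Q -> ae_on D S.
Proof.
move=> H; pose mu : {measure set (lebesgue_type R) -> \bar R} := leb.
apply: (@filterS2 _ _ (ae_filter_ringOfSetsType mu)) => x Px Qx Dx.
by apply: H => //; [exact: Px|exact: Qx].
Qed.

Lemma ae_on_set D (P : R -> Prop) A : lebesgue_measurable A -> A `<=` D ->
  ae_on D P -> (forall x, A x -> ~ P x) -> leb A = 0.
Proof.
move=> mA AD [N [mN N0 sN]] nP; apply/eqP; rewrite eq_le leb_ge0 andbT -N0.
apply: le_leb => // x Ax; apply: sN => /= /(_ (AD _ Ax)); exact: nP.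
Qed.

Definition star a f : R -> R := fine \o rearr leb (interval0 a) f.

Lemma rearr_le_antitone a f t : interval0 a t ->
  (forall x, interval0 a x -> (0 <= f x)%R) ->
  (forall x y, interval0 a x -> interval0 a y -> (x <= y)%R -> (f y <= f x)%R) ->
  rearr leb (interval0 a) f t <= (f t)%:E.
Proof.
move=> It f0 fanti; have mI := @lmeas_interval0 R a.
have mf : L0 (interval0 a) f by apply: lmeas_antitoneR => //; exact: interval0_is_interval.
apply: rearr_le_tail => //; [exact: monotone_on_leb|exact: f0|].
have -> : t%:E = leb `]0%R, t]%classic by rewrite leb_itv_oc ?subr0// ltW//; case: It.
apply: le_leb; [exact: lmeas_tail|exact: lmeas_itv|].
move=> x [Ix /=]; rewrite ger0_norm ?f0// in_itv/= => ftx; have [-> _] := Ix.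
by rewrite leNgt; apply/negP => /ltW/(fanti _ _ It Ix); rewrite leNgt ftx.
Qed.

Lemma rearr_fin a f : (forall x, interval0 a x ->
    \int[leb]_(t in `]0%R, x]) rearr leb (interval0 a) f t < +oo) ->
  forall t, interval0 a t -> rearr leb (interval0 a) f t < +oo.
Proof.
move=> H t It; rewrite ltey; apply/eqP => rt.
have := H t It; rewrite (@int_eq _ _ _ (cst +oo)); last first.
  move=> x /=; rewrite in_itv/= => /andP[_ xt]; apply/eqP.
  by rewrite -leye_eq -rt; exact: rearr_antitone.
have [t0 _] := It.
rewrite int_cst; last exact: lmeas_itv.
by rewrite leb_itv_oc ?ltW// subr0 gt0_mulye ?lte_fin.
Qed.

Lemma starE a f t : rearr leb (interval0 a) f t < +oo ->
  rearr leb (interval0 a) f t = (star a f t)%:E.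
Proof. by move=> H; rewrite /star/= fineK// ge0_fin_numE// rearr_ge0. Qed.

Lemma star_ge0 a f t : (0 <= star a f t)%R.
Proof. by rewrite /star/= fine_ge0// rearr_ge0. Qed.

Section star.
Variables (a : \bar R) (f : R -> R).
Local Notation I := (interval0 a).
Hypothesis Hf : forall t, I t -> rearr leb I f t < +oo.

Lemma star_anti x y : I x -> I y -> (x <= y)%R -> (star a f y <= star a f x)%R.
Proof. by move=> Ix Iy xy; rewrite -lee_fin -!starE ?Hf//; exact: rearr_antitone. Qed.

Lemma int_star x : x%:E < a -> \int[leb]_(t in `]0%R, x]) rearr leb I f t =
   \int[leb]_(t in `]0%R, x]) (star a f t)%:E.
Proof.
move=> xa; apply: int_eq => t /=; rewrite in_itv/= => /andP[t0 tx].
by apply: starE; apply: Hf; split => //; apply: le_lt_trans xa; rewrite lee_fin.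
Qed.

End star.

Lemma star_decreasing a f : 0 < a -> (forall x, interval0 a x ->
    \int[leb]_(t in `]0%R, x]) rearr leb (interval0 a) f t < +oo) ->
  decreasing_weight a (star a f).
Proof.
move=> a0 H; have Hf := rearr_fin H; split => //.
- by move=> x _; exact: star_ge0.
- by move=> x y; exact: star_anti.
- by move=> x Ix; rewrite -int_star//; [exact: H|case: Ix].
Qed.

(** An integral that is infinite for one [x] is infinite for all [x]. Then [h] dominates every
    multiple of the indicator of []0, x0]] in the sense of [prec], which forces that indicator to
    have norm 0. *)
Lemma fully_symmetric_locally_integrable b E h : 0 < b ->
  fully_symmetric (interval0 b) E -> has_support (interval0 b) E ->
  carrier E h -> forall x, interval0 b x ->
  \int[leb]_(t in `]0%R, x]) rearr leb (interval0 b) h t < +oo.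
Proof.
move=> b0 fsE supE Eh x0 Jx0; rewrite ltey; apply/eqP => x0oo.
set J := interval0 b in fsE supE Jx0 x0oo *.
have mr A : is_interval A -> lebesgue_mfun A (rearr leb J h) by exact: lmfun_rearr.
have infx x : J x -> \int[leb]_(t in `]0%R, x]) rearr leb J h t = +oo.
  move=> Jx; have [x00 _] := Jx0; have [xp _] := Jx.
  have mi y z : lebesgue_measurable `]y, z]%classic by exact: lmeas_itv.
  have mri y z : lebesgue_mfun `]y, z]%classic (rearr leb J h).
    by apply: mr; exact: interval_is_interval.
  have [x0x|xx0] := leP x0 x.
    apply/eqP; rewrite -leye_eq -x0oo; apply: int_subset => //.
      by move=> t _; exact: rearr_ge0.
    by apply: subset_itvl; rewrite bnd_simp.
  apply/eqP; rewrite eq_le leey/= leNgt; apply/negP => xfin.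
  have rx : rearr leb J h x < +oo.
    rewrite ltey; apply/eqP => rx; move: xfin.
    rewrite (@int_eq _ _ _ (cst +oo)); last first.
      move=> t /=; rewrite in_itv/= => /andP[_ tx]; apply/eqP.
      by rewrite -leye_eq -rx; exact: rearr_antitone.
    by rewrite int_cst// leb_itv_oc ?ltW// subr0 gt0_mulye ?lte_fin.
  have : \int[leb]_(t in `]0%R, x0]) rearr leb J h t < +oo; last by rewrite x0oo.
  have -> : `]0%R, x0]%classic = `]0%R, x]%classic `|` `]x, x0]%classic.
    by rewrite -itv_bndbnd_setU// bnd_simp ltW.
  rewrite int_setU; [|by []|by []| | |].
  - apply: lte_add_pinfty => //.
    apply: (@le_lt_trans _ _ (\int[leb]_(t in `]x, x0]) (rearr leb J h x))).
      apply: int_le => //; [exact: lmfun_cst|by move=> t _; exact: rearr_ge0|].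
      move=> t /=; rewrite in_itv/= => /andP[/ltW xt _]; exact: rearr_antitone.
    rewrite int_cst// leb_itv_oc ?ltW//.
    move: rx; rewrite -ge0_fin_numE ?rearr_ge0// => rx.
    by rewrite -(fineK rx) -EFinM ltry.
  - by rewrite -itv_bndbnd_setU ?bnd_simp ?(ltW xx0)//; exact: ltW.
  - by move=> t _; exact: rearr_ge0.
  - apply/seteqP; split => // t [/=]; rewrite !in_itv/= => /andP[_ tx] /andP[xt _].
    by move: (le_lt_trans tx xt); rewrite ltxx.
have bfs := fs_bfs fsE.
pose A : set R := `]0%R, x0]%classic.
have mA : lebesgue_measurable A by exact: lmeas_itv.
have [x00 x0b] := Jx0.
have AJ : A `<=` J.
  by move=> t; rewrite /A/= in_itv/= => /andP[t0 tx]; split => //;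
    apply: le_lt_trans x0b; rewrite lee_fin.
have lA : leb A = x0%:E by rewrite leb_itv_oc ?subr0// ltW.
have EA : carrier E (\1_A : R -> R) by apply: supE => //; rewrite lA ltry.
have Ec (c : R) : `|c|%:E * gauge E (\1_A : R -> R) <= gauge E h.
  rewrite -(bfs_normZ bfs)//.
  apply: (fs_prec fsE _ Eh _).2.
    by apply: (bfs_measurable bfs); exact: (bfs_scale bfs).
  by move=> x Jx; rewrite infx// leey.
have /andP[g0 goo] := bfs_fin bfs EA.
have /andP[h0 hoo] := bfs_fin bfs Eh.
have gfin : gauge E (\1_A : R -> R) \is a fin_num by rewrite ge0_fin_numE.
have hfin : gauge E h \is a fin_num by rewrite ge0_fin_numE.
have gA0 : gauge E (\1_A : R -> R) = 0.
  apply/eqP; rewrite eq_le g0 andbT leNgt; apply/negP => gp.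
  move: gp Ec; rewrite -(fineK gfin) -(fineK hfin) lte_fin => gp Ec.
  have := Ec ((fine (gauge E h) + 1) / fine (gauge E (\1_A : R -> R)))%R.
  rewrite -EFinM lee_fin ger0_norm.
    by rewrite divfK ?gt_eqF//; lra.
  by rewrite divr_ge0 ?addr_ge0 ?fine_ge0.
have := ae_on_set mA AJ (bfs_eq0 bfs EA gA0).
rewrite lA => H; have : x0%:E = 0.
  by apply: H => t At; rewrite /= indicE mem_set// => /eqP; rewrite oner_eq0.
by case=> x00'; move: x00; rewrite x00' ltxx.
Qed.

(** Admits test functions: a comparison of [(g#)#w] with an element of [E] in the order [prec]
    controls the norm of [g]. *)
Lemma Lambda_mem a b E w g h : L0 (interval0 a) g ->
  let I := interval0 a in let J := interval0 b in
  let q := rearr (density w) I (fine \o rearr leb I g) in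
  fully_symmetric J E ->
  (forall t, I t -> rearr leb I g t < +oo) ->
  (forall t, J t -> q t < +oo) ->
  carrier E h -> prec J (fine \o q) h ->
  carrier (Lambda I J E w) g /\ gauge (Lambda I J E w) g <= gauge E h.
Proof.
move=> mg I J q fsE gfin qfin Eh qh.
have mq : L0 J (fine \o q).
  apply: lmeas_antitoneR; first exact: interval0_is_interval.
  move=> x y Jx Jy xy /=; rewrite fine_le ?ge0_fin_numE ?rearr_ge0//; [exact: qfin|exact: qfin|].
  exact: rearr_antitone.
have [Eq Eqh] := fs_prec fsE mq Eh qh.
have qmem : emem J E q.
  by split => //; apply: ae_onW => x Jx; rewrite ge0_fin_numE ?rearr_ge0//; exact: qfin.
have mstar : L0 I (fine \o rearr leb I g).
  apply: lmeas_antitoneR; first exact: interval0_is_interval.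
  by move=> x y Ix Iy xy; exact: (star_anti gfin).
have Fw : carrier (weighted_space I J E w) (fine \o rearr leb I g) by [].
have gmem : emem I (weighted_space I J E w) (rearr leb I g).
  by split => //; apply: ae_onW => x Ix; rewrite ge0_fin_numE ?rearr_ge0//; exact: gfin.
split; first by [].
by rewrite /Lambda/guarded/= asboolT// asboolT.
Qed.

End decreasing_rearrangement.

(** * Step functions as test functions *)

(** The part of [A] where [|f| > s] has measure at most [y], and the rearrangement is at least [s]
    on the initial interval of that length; layer cakes do the rest. *)
Lemma int_set_le_rearr {R : realType} (a : \bar R) (f : R -> R) (A : set R) (y : R) :
  let I := interval0 a in L0 I f -> lebesgue_measurable A -> A `<=` I ->
  leb A <= y%:E ->
  \int[leb]_(x in A) `|f x|%:E <= \int[leb]_(t in `]0%R, y]) rearr leb I f t.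
Proof.
move=> I mf mA AI Ay; have mI : lebesgue_measurable I by exact: lmeas_interval0.
have mfA : lebesgue_mfun A (EFin \o (fun x => `|f x|%R)).
  by apply: (lmfunS mI AI); apply/lmfun_EFin; exact: L0_normr.
have mi : lebesgue_measurable `]0%R, y]%classic by exact: lmeas_itv.
have mr : lebesgue_mfun `]0%R, y]%classic (rearr leb I f).
  by apply: lmfun_rearr; exact: interval_is_interval.
have iE : is_interval (`]0%R, +oo[%classic : set R) by exact: interval_is_interval.
rewrite (@int_eq _ _ _ (fun x => (EFin \o (fun x => `|f x|%R)) x * 1)); last first.
  by move=> x _; rewrite mule1.
rewrite [leRHS](@int_eq _ _ _ (fun x => rearr leb I f x * 1)); last first.
  by move=> x _; rewrite mule1.
rewrite layer_cake_lt//; [|exact: lmfun_cst|by move=> *; rewrite lee_fin].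
rewrite (@layer_cake_le _ _ (rearr leb I f) (fun=> 1) mi mr (@lmfun_cst R _ 1)); last 2 first.
- by move=> x _; exact: rearr_ge0.
- by move=> x _; exact: lee01.
have mS (s : R) : lebesgue_measurable (A `&` [set x | s%:E < `|f x|%:E]) by exact: lmeas_gt.
have mT (s : R) : lebesgue_measurable (`]0%R, y] `&` [set t | s%:E <= rearr leb I f t]).
  exact: lmeas_ge.
apply: int_le.
- exact: lmeas_itv.
- apply: lmfun_antitone => // s s' _ _ ss'; apply: int_subset => //; first exact: lmfun_cst.
  by move=> x [Dx /= H]; split => //=; apply: le_lt_trans H; rewrite lee_fin.
- apply: lmfun_antitone => // s s' _ _ ss'; apply: int_subset => //; first exact: lmfun_cst.
  by move=> x [Dx /= H]; split => //=; apply: le_trans H; rewrite lee_fin.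
- by move=> s _; apply: int_ge0.
move=> s _; rewrite !int_cst// !mul1e.
rewrite -[leLHS]leb_interval0 ?leb_ge0//; apply: le_leb => //.
  exact: lmeas_interval0.
move=> t [t0 tA]; split => /=.
  rewrite in_itv/= t0 -lee_fin ltW//; apply: (lt_le_trans tA); apply: le_trans Ay.
  by apply: le_leb.
apply: tail_le_rearr => //; first exact: monotone_on_leb.
apply: (lt_le_trans tA); apply: le_leb => //; first exact: lmeas_tail.
by move=> x [/AI Ix /=]; rewrite lte_fin.
Qed.

Section step_function.
Context {R : realType}.
Variables (K : nat) (k : nat -> R) (B : nat -> set R).
Hypothesis B_nested : forall i j, (i <= j)%N -> (j <= K)%N -> B i `<=` B j.

Definition step_fun x : R := (\sum_(i < K) k i * \1_(B i.+1 `\` B i) x)%R.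

Lemma step_fun_on i x : (i < K)%N -> B i.+1 x -> ~ B i x -> step_fun x = k i.
Proof.
move=> iK Bi nBi; rewrite /step_fun (bigD1 (Ordinal iK))//= big1.
  by rewrite addr0 indicE mem_set ?mulr1.
move=> j; rewrite -val_eqE/= neq_ltn => /orP[ji|ij].
  rewrite indicE memNset ?mulr0// => -[Bj _]; apply: nBi.
  by apply: B_nested Bj => //; exact: ltnW.
rewrite indicE memNset ?mulr0// => -[_ nBj]; apply: nBj.
by apply: B_nested Bi => //; exact: ltnW.
Qed.

Lemma step_funP x : step_fun x = 0%R \/
  exists i, [/\ (i < K)%N, B i.+1 x, ~ B i x & step_fun x = k i].
Proof.
have [[i [iK Bi nBi]]|H] := pselect (exists i, [/\ (i < K)%N, B i.+1 x & ~ B i x]).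
  by right; exists i; split => //; exact: step_fun_on.
left; rewrite /step_fun big1// => i _; rewrite indicE memNset ?mulr0// => -[Bi nBi].
by apply: H; exists i.
Qed.

Lemma step_fun_L0 (D : set R) : (forall i, lebesgue_measurable (B i)) -> L0 D step_fun.
Proof.
move=> mB; rewrite /step_fun.
apply: (@measurable_sum _ (lebesgue_type R)) => i.
apply: measurable_funM; first exact: measurable_cst.
by apply: measurable_indic; exact: lmeasD.
Qed.

Hypothesis k_ge0 : forall i, (i < K)%N -> (0 <= k i)%R.
Hypothesis k_anti : forall i j, (i <= j)%N -> (j < K)%N -> (k j <= k i)%R.

Lemma step_fun_ge0 x : (0 <= step_fun x)%R.
Proof. by have [->//|[i [iK _ _ ->]]] := step_funP x; exact: k_ge0. Qed.

Lemma step_fun_le i x : (i < K)%N -> ~ B i x -> (step_fun x <= k i)%R.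
Proof.
move=> iK nBi; have [->|[j [jK Bj _ ->]]] := step_funP x; first exact: k_ge0.
apply: k_anti => //; rewrite leqNgt; apply/negP => ji; apply: nBi.
by apply: B_nested Bj => //; exact: ltnW.
Qed.

Lemma step_fun_out x : ~ B K x -> step_fun x = 0%R.
Proof.
move=> nBK; have [//|[j [jK Bj _ _]]] := step_funP x.
by case: nBK; exact: B_nested Bj.
Qed.

End step_function.

(** * Testing the dual norm on a finite chain of cells *)

Section chain_test.
Context {R : realType}.
Variables (a : \bar R) (w : R -> R) (E : fspace R).
Local Notation I := (interval0 a).
Let b := \int[leb]_(x in I) (w x)%:E.
Local Notation J := (interval0 b).
Hypothesis hw : decreasing_weight a w.
Hypothesis w_gt0 : forall x, I x -> (0 < w x)%R.
Local Notation W := (primitive w).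

Lemma exists_between_top x : x%:E < a -> exists2 y : R, (x < y)%R & y%:E < a.
Proof.
case: a => [r| |]//.
  by rewrite lte_fin => xr; exists ((x + r) / 2)%R; rewrite ?lte_fin midf_lt.
by move=> _; exists (x + 1)%R; rewrite ?ltry ?ltrDl.
Qed.

Lemma primitive_lt x y : (0 <= x)%R -> (x < y)%R -> y%:E < a -> (W x < W y)%R.
Proof.
move=> x0 xy ya; have Iy : I y by split => //; exact: le_lt_trans xy.
rewrite -subr_gt0; apply: (@lt_le_trans _ _ (w y * (y - x))%R).
  by rewrite mulr_gt0 ?w_gt0// subr_gt0.
apply: (primitive_lower hw) => //; [exact: ltW|exact: (dw_ge0 hw)|].
move=> t xt ty; apply: (dw_anti hw) => //; last exact: ltW.
by split; [exact: le_lt_trans xt|apply: lt_trans ya].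
Qed.

Lemma primitive_le_total x : x%:E < a -> (W x)%:E <= b.
Proof.
move=> xa; rewrite -(primitiveE hw xa); apply: int_subset.
- exact: lmeas_itv.
- exact: lmeas_interval0.
- exact: (dw_lmfun hw).
- by move=> y Iy; rewrite lee_fin (dw_ge0 hw).
- exact: itv_interval0.
Qed.

Lemma primitive_lt_total x : (0 <= x)%R -> x%:E < a -> (W x)%:E < b.
Proof.
move=> x0 xa; have [y xy ya] := exists_between_top xa.
by apply: lt_le_trans (primitive_le_total ya); rewrite lte_fin primitive_lt.
Qed.

Lemma total_gt0 : 0 < b.
Proof.
by have := primitive_lt_total (lexx 0%R) (dw_pos hw); rewrite primitive_le0.
Qed.

Lemma primitive_interval0 x : (0 < x)%R -> x%:E < a -> J (W x).
Proof.
move=> x0 xa; split; last by apply: primitive_lt_total => //; exact: ltW.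
by have := primitive_lt (lexx 0%R) x0 xa; rewrite primitive_le0.
Qed.

Lemma density_le_primitive A z : lebesgue_measurable A -> A `<=` I -> z%:E < a ->
  (forall x, A x -> (x <= z)%R) -> density w A <= (W z)%:E.
Proof.
move=> mA AI za Az; rewrite -(primitiveE hw za); apply: int_subset => //.
- exact: lmeas_itv.
- exact: (dw_lmfun_itv hw).
- by move=> t; exact: (dw_ge0_itv hw).
- by move=> x Ax; rewrite /= in_itv/= Az// andbT; case: (AI _ Ax).
Qed.

Variables (f : R -> R) (N : R) (h : R -> R).
Hypotheses (fsE : fully_symmetric J E) (mf : L0 I f).
Hypothesis fN : kothe_gauge I (Lambda I J E w) f <= N%:E.
Hypothesis f_int : forall x, I x -> \int[leb]_(t in `]0%R, x]) rearr leb I f t < +oo.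
Hypotheses (Eh : carrier E h) (h1 : gauge E h <= 1).
Hypothesis h_int : forall x, J x -> \int[leb]_(t in `]0%R, x]) rearr leb J h t < +oo.
Local Notation F := (primitive (star a f)).
Local Notation H := (primitive (star b h)).

Variables (K : nat) (z : nat -> R).
Hypotheses (z0 : z 0%N = 0%R) (zK : (z K)%:E < a).
Hypothesis zS : forall i, (i < K)%N -> (z i < z i.+1)%R.

(** Mean of [h*] over the image []W (z i), W (z i.+1)]] of a cell. *)
Let k i := ((H (W (z i.+1)) - H (W (z i))) / (W (z i.+1) - W (z i)))%R.

Let hu : decreasing_weight a (star a f).
Proof. by apply: star_decreasing f_int; exact: dw_pos hw. Qed.
Let hh : decreasing_weight b (star b h).
Proof. by apply: star_decreasing h_int; exact: total_gt0. Qed.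

Let z_mono i j : (i <= j)%N -> (j <= K)%N -> (z i <= z j)%R.
Proof.
elim: j => [|j IH]; first by rewrite leqn0 => /eqP ->.
rewrite leq_eqVlt => /predU1P[->//|ij] jK.
by apply: le_trans (IH ij (ltnW jK)) _; rewrite ltW// zS.
Qed.

Let z_ge0 i : (i <= K)%N -> (0 <= z i)%R.
Proof. by move=> iK; rewrite -z0; exact: z_mono. Qed.

Let z_lta i : (i <= K)%N -> (z i)%:E < a.
Proof. by move=> iK; apply: le_lt_trans zK; rewrite lee_fin z_mono. Qed.

Let Zlt i : (i < K)%N -> (W (z i) < W (z i.+1))%R.
Proof. by move=> iK; apply: primitive_lt; [exact/z_ge0/ltnW|exact: zS|exact: z_lta]. Qed.

Let Z0 : W (z 0%N) = 0%R. Proof. by rewrite z0 primitive_le0. Qed.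

Let Z_mono i j : (i <= j)%N -> (j <= K)%N -> (W (z i) <= W (z j))%R.
Proof.
move=> ij jK; apply: (primitive_mono hw); [|exact: z_mono|exact: z_lta].
by apply: z_ge0; exact: leq_trans jK.
Qed.

Let Z_ge0 i : (i <= K)%N -> (0 <= W (z i))%R.
Proof. by move=> iK; rewrite -Z0 Z_mono. Qed.

Let Z_ltb i : (i <= K)%N -> (W (z i))%:E < b.
Proof. by move=> iK; apply: primitive_lt_total; [exact: z_ge0|exact: z_lta]. Qed.

Let H_slope_ge x y : (0 <= x)%R -> (x < y)%R -> y%:E < b ->
  (star b h y * (y - x) <= H y - H x)%R.
Proof.
move=> x0 xy yb; have Jy : J y by split => //; exact: le_lt_trans xy.
apply: (primitive_lower hh) => //; [exact: ltW|exact: star_ge0|].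
move=> t xt ty; apply: (dw_anti hh) => //; last exact: ltW.
by split; [exact: le_lt_trans xt|apply: lt_trans yb].
Qed.

Let H_slope_le x y : (0 < x)%R -> (x <= y)%R -> y%:E < b ->
  (H y - H x <= star b h x * (y - x))%R.
Proof.
move=> x0 xy yb; have Jx : J x by split => //; apply: le_lt_trans yb; rewrite lee_fin.
apply: (primitive_upper hh) => //; first exact: ltW.
move=> t xt ty; apply: (dw_anti hh) => //; last exact: ltW.
by split; [exact: lt_trans xt|apply: lt_trans yb].
Qed.

Let k_ge i : (i < K)%N -> (star b h (W (z i.+1)) <= k i)%R.
Proof.
move=> iK; rewrite /k ler_pdivlMr ?subr_gt0 ?Zlt//.
by apply: H_slope_ge; [exact/Z_ge0/ltnW|exact: Zlt|exact: Z_ltb].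
Qed.

Let k_ge0 i : (i < K)%N -> (0 <= k i)%R.
Proof. by move=> iK; apply: le_trans (k_ge iK); exact: star_ge0. Qed.

Let k_le i : (i.+1 < K)%N -> (k i.+1 <= star b h (W (z i.+1)))%R.
Proof.
move=> iK; rewrite /k ler_pdivrMr ?subr_gt0 ?Zlt//.
apply: H_slope_le; [|exact/ltW/Zlt|exact: Z_ltb].
by apply: le_lt_trans (Zlt (ltnW iK)); apply: Z_ge0; do 2 apply: ltnW.
Qed.

(** Neighbouring means are separated by the value of [h*] at their common end point. *)
Let k_anti i j : (i <= j)%N -> (j < K)%N -> (k j <= k i)%R.
Proof.
elim: j => [|j IH]; first by rewrite leqn0 => /eqP ->.
rewrite leq_eqVlt => /predU1P[->//|ij] jK.
apply: le_trans (IH ij (ltnW jK)); apply: le_trans (k_le jK) _.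
by apply: k_ge; exact: ltnW.
Qed.

(** Concavity of [H]: its slopes on the two sides of [x] are separated by the value of [h*] at
    [x]. *)
Let k_chord i x : (i < K)%N -> (W (z i) < x)%R -> (x <= W (z i.+1))%R ->
  (k i * (x - W (z i)) <= H x - H (W (z i)))%R.
Proof.
move=> iK zx xz; have x0 : (0 < x)%R by apply: le_lt_trans zx; exact/Z_ge0/ltnW.
have xb : x%:E < b by apply: le_lt_trans (Z_ltb iK); rewrite lee_fin.
have := H_slope_ge (Z_ge0 (ltnW iK)) zx xb.
have := H_slope_le x0 xz (Z_ltb iK).
have D0 : (0 < W (z i.+1) - W (z i))%R by rewrite subr_gt0 Zlt.
rewrite /k mulrAC ler_pdivrMr//.
set c := star b h x; move: (H x) (H (W (z i))) (H (W (z i.+1))) => hx hi hi1.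
move: (W (z i)) (W (z i.+1)) zx xz D0 => zi zi1 zx xz D0 A1 A2.
have P1 : (0 <= x - zi)%R by lra.
have P2 : (0 <= zi1 - x)%R by lra.
have := ler_wpM2l P1 A1; have := ler_wpM2l P2 A2; lra.
Qed.

(** The primitive of the means interpolates [H] linearly between the nodes [W (z i)], hence stays
    below it. The statement takes any [phi] below the steps, because the rearrangement in question
    is bounded from above only. *)
Lemma int_steps_le (phi : R -> \bar R) : lebesgue_mfun J phi ->
  (forall t, 0 <= phi t) ->
  (forall t i, J t -> (i < K)%N -> (W (z i) <= t)%R -> phi t <= (k i)%:E) ->
  (forall t, J t -> (W (z K) <= t)%R -> phi t = 0) ->
  forall x, J x -> \int[leb]_(t in `]0%R, x]) phi t <= (H x)%:E.
Proof.
move=> mphi phi0 phik phi_out.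
have mi x y : lebesgue_measurable `]x, y]%classic by exact: lmeas_itv.
have mphii x y : (0 <= x)%R -> y%:E < b -> lebesgue_mfun `]x, y]%classic phi.
  move=> x0 yb; apply: (lmfunS _ _ mphi); first exact: lmeas_interval0.
  exact: itv_interval0.
have split_le x y c : (0 <= x)%R -> (x < y)%R -> y%:E < b -> (0 <= c)%R ->
    \int[leb]_(t in `]0%R, x]) phi t <= (H x)%:E ->
    (forall t, (x < t)%R -> (t <= y)%R -> phi t <= c%:E) ->
    (c * (y - x) <= H y - H x)%R ->
    \int[leb]_(t in `]0%R, y]) phi t <= (H y)%:E.
  move=> x0 xy yb c0 IH Hc Hy.
  have U : `]0%R, y]%classic = `]0%R, x]%classic `|` `]x, y]%classic.
    by rewrite -itv_bndbnd_setU// bnd_simp// ltW.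
  rewrite U int_setU//; last 2 first.
    by rewrite -U; exact: mphii.
    apply/seteqP; split => // t [/=]; rewrite !in_itv/= => /andP[_ tx] /andP[xt _].
    by move: (le_lt_trans tx xt); rewrite ltxx.
  apply: (@le_trans _ _ ((H x)%:E + (c * (y - x))%R%:E)); last first.
    by rewrite -EFinD lee_fin; lra.
  apply: leeD => //; rewrite EFinM -(leb_itv_oc (ltW xy)) -int_cst//.
  apply: int_le => //; [exact: mphii|exact: lmfun_cst|].
  by move=> t /=; rewrite in_itv/= => /andP[xt ty]; exact: Hc.
have key i : (i <= K)%N -> forall x, (x <= W (z i))%R ->
    \int[leb]_(t in `]0%R, x]) phi t <= (H x)%:E.
  elim: i => [|i IH] iK x xz.
    rewrite set_itv_ge ?int_set0 ?primitive_le0//; first by rewrite -Z0.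
    by rewrite bnd_simp -leNgt -Z0.
  have [xz'|zx] := leP x (W (z i)); first by apply: IH => //; exact: ltnW.
  have xb : x%:E < b by apply: le_lt_trans (Z_ltb iK); rewrite lee_fin.
  apply: (split_le (W (z i)) x (k i)) => //.
  - exact/Z_ge0/ltnW.
  - exact: k_ge0.
  - by apply: IH => //; exact: ltnW.
  - move=> t zt tx; apply: phik => //; last exact: ltW.
    split; first by apply: le_lt_trans zt; exact/Z_ge0/ltnW.
    by apply: le_lt_trans xb; rewrite lee_fin.
  - exact: k_chord.
move=> x [x0 xb]; have [xz|zx] := leP x (W (z K)); first exact: (key K).
apply: (split_le (W (z K)) x 0%R) => //.
- exact: Z_ge0.
- exact: (key K).
- move=> t zt tx; rewrite phi_out//; last exact: ltW.
  split; first by apply: le_lt_trans zt; exact: Z_ge0.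
  by apply: le_lt_trans xb; rewrite lee_fin.
- rewrite mul0r subr_ge0; apply: (primitive_mono hh) => //; [exact: Z_ge0|exact: ltW].
Qed.

(* The steps k average h* over the cells, so they are dominated by h in the sense
   of prec; the near-optimal sets carry them over to a function g on I whose
   rearrangement is paired with f* up to an error proportional to d. *)
Lemma chain_test_step (d : R) : (0 < d)%R ->
  (\sum_(i < K) k i * (F (z i.+1) - F (z i) - d * z i.+1) <= N)%R.
Proof.
move=> d0.
have [B0 [B0I B0n lB0 B0F]] := near_optimal_sets mf d0 (rearr_fin f_int).
pose B i := B0 (z i).
have mB i : lebesgue_measurable (B i) by case: (B0I (z i)).
have BI i : B i `<=` I by case: (B0I (z i)).
have Bn i j : (i <= j)%N -> (j <= K)%N -> B i `<=` B j.
  by move=> ij jK; apply: B0n; [exact: z_mono|exact: z_lta].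
have lB i : (i <= K)%N -> leb (B i) = (z i)%:E.
  by move=> iK; apply: lB0; [exact: z_ge0|exact: z_lta].
pose g := step_fun K k B.
have mg : L0 I g by exact: step_fun_L0.
have g0 x : (0 <= g x)%R by exact: step_fun_ge0.
have mI : lebesgue_measurable I by exact: lmeas_interval0.
(* [g] exceeds [k i] only on [B i], a set of measure [z i]. *)
have gle y i : (i < K)%N -> (z i <= y)%R -> rearr leb I g y <= (k i)%:E.
  move=> iK zy; apply: rearr_le_tail => //; [exact: monotone_on_leb|exact: k_ge0|].
  apply: (@le_trans _ _ (leb (B i))); last by rewrite lB ?lee_fin// ltnW.
  apply: le_leb => //; first exact: lmeas_tail.
  move=> x [Ix /=]; rewrite ger0_norm// => kg; apply: contrapT => nB.
  by have := @step_fun_le _ K k B Bn k_ge0 k_anti i x iK nB; rewrite leNgt kg.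
have gout y : (z K <= y)%R -> rearr leb I g y = 0.
  move=> zy; apply/eqP; rewrite eq_le rearr_ge0 andbT.
  apply: rearr_le_tail => //; [exact: monotone_on_leb|].
  apply: (@le_trans _ _ (leb (B K))); last by rewrite lB ?lee_fin.
  apply: le_leb => //; first exact: lmeas_tail.
  move=> x [Ix /=]; rewrite ger0_norm// => kg; apply: contrapT => nB.
  by move: kg; rewrite /g (step_fun_out _ Bn nB) ltxx.
have gfin t : I t -> rearr leb I g t < +oo.
  move=> [t0 _]; case: (posnP K) => [K0|K0].
    by rewrite gout ?ltry// K0 z0 ltW.
  by apply: le_lt_trans (gle t 0%N K0 _) _; rewrite ?ltry// z0 ltW.
have monw : monotone_on I (density w).
  by apply: monotone_on_density => //; [exact: dw_L0 hw|exact: dw_ge0 hw].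
pose gs := fine \o rearr leb I g.
have mgs : L0 I gs.
  apply: lmeas_antitoneR; first exact: interval0_is_interval.
  by move=> x y Ix Iy xy; exact: (star_anti gfin).
have gs0 x : (0 <= gs x)%R by rewrite fine_ge0// rearr_ge0.
pose q := rearr (density w) I gs.
(* Passing from Lebesgue measure to [w dm] moves the node [z i] to [W (z i)]. *)
have qle t i : (i < K)%N -> (W (z i) <= t)%R -> q t <= (k i)%:E.
  move=> iK Zt; apply: rearr_le_tail => //; first exact: k_ge0.
  apply: (@le_trans _ _ (W (z i))%:E); last by rewrite lee_fin.
  apply: density_le_primitive; [exact: lmeas_tail|exact: subIsetl|exact/z_lta/ltnW|].
  move=> x [Ix /=]; rewrite ger0_norm// => kx; rewrite leNgt; apply/negP => zx.
  have := gle x i iK (ltW zx); rewrite (starE (gfin x Ix)) lee_fin leNgt.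
  by rewrite /star /gs/= in kx *; rewrite kx.
have qout t : (W (z K) <= t)%R -> q t = 0.
  move=> Zt; apply/eqP; rewrite eq_le rearr_ge0 andbT.
  apply: rearr_le_tail => //.
  apply: (@le_trans _ _ (W (z K))%:E); last by rewrite lee_fin.
  apply: density_le_primitive; [exact: lmeas_tail|exact: subIsetl|exact: zK|].
  move=> x [Ix /=]; rewrite ger0_norm// => kx; rewrite leNgt; apply/negP => zx.
  by move: kx; rewrite /gs/= gout ?ltxx// ltW.
have qfin t : J t -> q t < +oo.
  move=> [t0 _]; case: (posnP K) => [K0|K0].
    by rewrite qout ?ltry// K0 Z0 ltW.
  by apply: le_lt_trans (qle t 0%N K0 _) _; rewrite ?ltry// Z0 ltW.
pose q1 := fine \o q.
have q1anti x y : J x -> J y -> (x <= y)%R -> (q1 y <= q1 x)%R.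
  move=> Jx Jy xy; rewrite /q1/= fine_le ?ge0_fin_numE ?rearr_ge0//; [exact: qfin|exact: qfin|].
  exact: rearr_antitone.
have q1q t : J t -> rearr leb J q1 t <= q t.
  move=> Jt; have -> : q t = (q1 t)%:E by rewrite /q1/= fineK// ge0_fin_numE ?rearr_ge0// qfin.
  by apply: rearr_le_antitone => // x _; rewrite /q1/= fine_ge0// rearr_ge0.
have qh : prec J q1 h.
  move=> x Jx; have [x0 xb] := Jx.
  rewrite (int_star (rearr_fin h_int) xb) (primitiveE hh xb).
  apply: int_steps_le => //.
  - by apply: lmfun_rearr; exact: interval0_is_interval.
  - by move=> t; exact: rearr_ge0.
  - by move=> t i Jt iK Zt; apply: le_trans (q1q t Jt) (qle _ _ iK Zt).
  - move=> t Jt Zt; apply/eqP; rewrite eq_le rearr_ge0 andbT.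
    by rewrite -(qout t Zt) q1q.
have [Lg gh] := Lambda_mem mg fsE gfin qfin Eh qh.
have fgN : \int[leb]_(x in I) `|f x * g x|%:E <= N%:E.
  apply: le_trans fN; apply: ereal_sup_ubound; exists g => //; split => //.
  exact: le_trans gh h1.
rewrite -lee_fin; apply: le_trans fgN.
have mfg : lebesgue_mfun I (EFin \o (fun x => `|f x * g x|%R)).
  by apply/lmfun_EFin/L0_normr; exact: measurable_funM.
have mfa : lebesgue_mfun I (EFin \o (fun x => `|f x|%R)).
  by apply/lmfun_EFin/L0_normr.
have intB i : (i <= K)%N -> exists r, \int[leb]_(x in B i) `|f x|%:E = r%:E /\
    (F (z i) - d * z i <= r <= F (z i))%R.
  move=> iK; have up : \int[leb]_(x in B i) `|f x|%:E <= (F (z i))%:E.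
    rewrite -(primitiveE hu (z_lta iK)) -(int_star (rearr_fin f_int) (z_lta iK)).
    by apply: int_set_le_rearr => //; rewrite lB.
  have lo := B0F (z i) (z_ge0 iK) (z_lta iK).
  rewrite (int_star (rearr_fin f_int) (z_lta iK)) (primitiveE hu (z_lta iK)) in lo.
  have rfin : \int[leb]_(x in B i) `|f x|%:E \is a fin_num.
    by rewrite ge0_fin_numE ?int_ge0//; apply: le_lt_trans up _; rewrite ltry.
  move: up lo; rewrite -/(B i) -(fineK rfin); move: (fine _) => r up lo.
  exists r; split => //; move: up lo; rewrite -EFinD !lee_fin => up lo.
  by apply/andP; split => //; lra.
(* On the difference of [B m.+1] and [B m] the integral of [|f|] is at least
   [F (z m.+1) - d * z m.+1 - F (z m)]: only the outer set pays the error. *)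
have step m : (m <= K)%N -> (\sum_(i < m) k i * (F (z i.+1) - F (z i) - d * z i.+1))%R%:E
    <= \int[leb]_(x in B m) `|f x * g x|%:E.
  elim: m => [|m IH] mK; first by rewrite big_ord0; apply: int_ge0.
  have U : B m.+1 = B m `|` (B m.+1 `\` B m) by rewrite setDUK//; exact: Bn.
  rewrite U int_setU; [|by []|exact: lmeasD| |by move=> *; rewrite lee_fin|]; last 2 first.
  - by apply: lmfunS mfg => //; rewrite -U.
  - by apply/seteqP; split => // x [Bx []].
  rewrite big_ord_recr/= EFinD; apply: leeD; first by apply: IH; exact: ltnW.
  rewrite (@int_eq _ _ _ (fun x => (k m)%:E * `|f x|%:E)); last first.
    move=> x [Bx nBx]; rewrite /g (@step_fun_on _ K k B Bn m x)// normrM mulrC EFinM.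
    by rewrite [X in (X%:E * _)]ger0_norm// k_ge0.
  have mfa' : lebesgue_mfun (B m.+1 `\` B m) (EFin \o (fun x => `|f x|%R)).
    by apply: lmfunS mfa => // x [/BI].
  rewrite intZl ?k_ge0//; last exact: lmeasD.
  rewrite EFinM; apply: lee_wpmul2l; first by rewrite lee_fin k_ge0.
  have [r1 [r1E /andP[r1lo r1up]]] := intB m (ltnW mK).
  have [r2 [r2E /andP[r2lo r2up]]] := intB m.+1 mK.
  move: r2E; rewrite {1}U int_setU; [|by []|exact: lmeasD| |
    by move=> *; rewrite lee_fin|]; last 2 first.
  - by apply: lmfunS mfa => //; rewrite -U.
  - by apply/seteqP; split => // x [Bx []].
  rewrite r1E; case: (\int[leb]_(_ in _ `\` _) _) => [r| |]//.
  by rewrite -EFinD => -[rE]; rewrite lee_fin; lra.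
apply: (le_trans (step K (leqnn K))); apply: int_subset => //.
Qed.

(** The error is [d] times a sum [M] that does not depend on [d], so [d] can tend to 0. *)
Lemma chain_test : (\sum_(i < K) (H (W (z i.+1)) - H (W (z i))) / (W (z i.+1) - W (z i)) *
  (F (z i.+1) - F (z i)) <= N)%R.
Proof.
set S := (X in (X <= _)%R); pose M := (\sum_(i < K) k i * z i.+1)%R.
have SM d : (0 < d)%R -> (S - d * M <= N)%R.
  move=> /chain_test_step; rewrite /S /M mulr_sumr -sumrB; congr (_ <= _)%R.
  by apply: eq_bigr => i _; rewrite -/(k i); ring.
apply/ler_addgt0Pr => e e0; rewrite -lerBlDr.
have M0 : (0 < `|M| + 1)%R by rewrite ltr_wpDl.
apply: le_trans (SM (e / (`|M| + 1))%R _); last by rewrite divr_gt0.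
rewrite lerD2l lerN2 mulrAC ler_pdivrMr// ler_pM2l//.
by rewrite (le_trans (ler_norm _))// lerDl.
Qed.

End chain_test.

(** * Local integrability of the rearrangement of a dual element *)

Section dual_rearrangement_bound.
Context {R : realType}.
Variables (a : \bar R) (w : R -> R) (E : fspace R).
Local Notation I := (interval0 a).
Let b := \int[leb]_(x in I) (w x)%:E.
Local Notation J := (interval0 b).
Hypothesis hw : decreasing_weight a w.
Hypothesis w_gt0 : forall x, I x -> (0 < w x)%R.
Local Notation W := (primitive w).
Variables (f : R -> R) (N : R).
Hypotheses (fsE : fully_symmetric J E) (supE : has_support J E) (mf : L0 I f).
Hypothesis fN : kothe_gauge I (Lambda I J E w) f <= N%:E.

(* chain_test presupposes that f* is locally integrable, which is clear for the
   truncations of f. *)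
Let fmin (n : nat) x : R := Order.min `|f x|%R n%:R.

Let fmin_L0 n : L0 I (fmin n).
Proof. by apply: measurable_minr; [exact: L0_normr|exact: measurable_cst]. Qed.

Let fmin_ge0 n x : (0 <= fmin n x)%R.
Proof. by rewrite /fmin le_min normr_ge0 ler0n. Qed.

Let mI : lebesgue_measurable I. Proof. exact: lmeas_interval0. Qed.

Let fmin_kothe n : kothe_gauge I (Lambda I J E w) (fmin n) <= N%:E.
Proof.
apply: ge_ereal_sup => _ [g [Lg g1] <-].
apply: le_trans fN; apply: le_trans (ereal_sup_ubound _); last by exists g.
have mg : L0 I g by case: Lg.
apply: int_le => //.
- by apply/lmfun_EFin/L0_normr; apply: measurable_funM => //; exact: fmin_L0.
- by apply/lmfun_EFin/L0_normr; apply: measurable_funM.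
move=> x _; rewrite lee_fin !normrM ler_wpM2r//.
by rewrite ger0_norm// /fmin ge_min lexx.
Qed.

Let rearr_fmin_le n t : (0 <= t)%R -> rearr leb I (fmin n) t <= n%:R%:E.
Proof.
move=> t0; apply: rearr_le => // s ns; rewrite /tail (_ : _ `&` _ = set0).
  by rewrite leb0 lee_fin.
apply/seteqP; split => // x [_ /=]; rewrite ger0_norm// /fmin lt_min => /andP[_].
by rewrite ltNge (ltW ns).
Qed.

Let rearr_fmin_ge n t (s : R) : (s <= n%:R)%R -> s%:E <= rearr leb I f t ->
  s%:E <= rearr leb I (fmin n) t.
Proof.
move=> sn sf; apply: le_ereal_inf_tmp => _ [r [r0 tr] <-]; rewrite lee_fin leNgt.
apply/negP => rs; have : rearr leb I f t <= r%:E.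
  apply: ereal_inf_lbound; exists r => //; split => //; apply: le_trans tr.
  apply: le_leb; [exact: lmeas_tail|exact: lmeas_tail|].
  move=> x [Ix /= rf]; split => //=; rewrite ger0_norm// /fmin lt_min rf.
  exact: lt_le_trans sn.
by move=> /(le_trans sf); rewrite lee_fin leNgt rs.
Qed.

Let fmin_int n x : I x -> \int[leb]_(t in `]0%R, x]) rearr leb I (fmin n) t < +oo.
Proof.
move=> [x0 xa]; apply: (@le_lt_trans _ _ (\int[leb]_(t in `]0%R, x]) n%:R%:E)).
  apply: int_le; [exact: lmeas_itv| |exact: lmfun_cst| |].
  - by apply: lmfun_rearr; exact: interval_is_interval.
  - by move=> *; exact: rearr_ge0.
  - by move=> t /=; rewrite in_itv/= => /andP[/ltW t0 _]; exact: rearr_fmin_le.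
by rewrite int_cst ?leb_itv_oc ?ltW// -?EFinM ?ltry//; exact: lmeas_itv.
Qed.

(** The chain with the single cell [(0, y)], tested with a multiple [c] of the indicator of []0, W
    t]], bounds [H (W y) / W y] times the integral by [N], and [H (W y) >= c * W t] for [y >= t].
    The resulting constant is the same for all truncations. *)
Lemma dual_fmin_bound t : I t -> exists C : R, forall n y, I y -> (t <= y)%R ->
  \int[leb]_(x in `]0%R, y]) rearr leb I (fmin n) x <= (C * W y)%:E.
Proof.
move=> It; have [t0 ta] := It.
have [Wt0 Wtb] := primitive_interval0 hw w_gt0 t0 ta.
pose A : set R := `]0%R, W t]%classic.
have mA : lebesgue_measurable A by exact: lmeas_itv.
have AJ : A `<=` J by exact: itv_interval0.
have lA : leb A = (W t)%:E by rewrite leb_itv_oc ?subr0// ltW.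
have EA : carrier E (\1_A : R -> R) by apply: supE => //; rewrite lA ltry.
have bfs := fs_bfs fsE.
have /andP[g0 goo] := bfs_fin bfs EA.
have gfin : gauge E (\1_A : R -> R) \is a fin_num by rewrite ge0_fin_numE.
(* Scales the indicator into the unit ball; the added 1 keeps the divisor positive. *)
pose c := (1 / (fine (gauge E (\1_A : R -> R)) + 1))%R.
have gp : (0 < fine (gauge E (\1_A : R -> R)) + 1)%R.
  by rewrite ltr_wpDl// fine_ge0.
have c0 : (0 < c)%R by rewrite divr_gt0.
pose h x := (c * \1_A x)%R.
have Eh : carrier E h by exact: (bfs_scale bfs).
have h1 : gauge E h <= 1.
  rewrite (bfs_normZ bfs)// -(fineK gfin) -EFinM lee_fin gtr0_norm//.
  by rewrite /c mulrAC mul1r ler_pdivrMr// mul1r lerDl.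
have b0 : 0 < b := total_gt0 hw w_gt0.
have h_int := fully_symmetric_locally_integrable b0 fsE supE Eh.
have hh : decreasing_weight b (star b h) by exact: star_decreasing.
have HWt : (c * W t <= primitive (star b h) (W t))%R.
  rewrite -lee_fin -(primitiveE hh Wtb) -(int_star (rearr_fin h_int) Wtb).
  have : \int[leb]_(x in A) `|h x|%:E <=
      \int[leb]_(t0 in `]0%R, (W t)]) rearr leb J h t0.
    by apply: int_set_le_rearr; rewrite ?lA//; exact: (bfs_measurable bfs).
  apply: le_trans; rewrite (@int_eq _ _ _ (cst c%:E)) ?int_cst ?lA -?EFinM//.
  by move=> x Ax; rewrite /h indicE mem_set// mulr1 gtr0_norm.
exists (N / (c * W t))%R => n y Iy ty; have [y0 ya] := Iy.
rewrite (int_star (rearr_fin (fmin_int n)) ya).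
have hf : decreasing_weight a (star a (fmin n)).
  by apply: star_decreasing; [exact: dw_pos hw|exact: fmin_int].
rewrite (primitiveE hf ya) lee_fin.
have := @chain_test R a w E hw w_gt0 (fmin n) N h fsE (fmin_L0 n) (fmin_kothe n)
  (fmin_int n) Eh h1 h_int 1%N (fun i => if i is 0%N then 0%R else y) erefl ya.
move=> /(_ _)/=; rewrite big_ord_recl big_ord0 addr0/= !(@primitive_le0 R _ 0%R (lexx 0%R)).
move=> /(_ ltac:(by case)) H.
have Wy0 : (0 < W y)%R by case: (primitive_interval0 hw w_gt0 y0 ya).
have Wty : (W t <= W y)%R by apply: (primitive_mono hw) => //; exact: ltW.
have Wyb : (W y)%:E < b by apply: primitive_lt_total => //; exact: ltW.
have HWy : (c * W t <= primitive (star b h) (W y))%R.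
  by apply: le_trans HWt _; apply: (primitive_mono hh) => //; exact: ltW.
have cW0 : (0 < c * W t)%R by rewrite mulr_gt0.
have aux (X P Y Z : R) : (0 < Y)%R -> (Y <= X)%R -> (0 <= P)%R -> (0 < Z)%R ->
    ((X - 0) / (Z - 0) * (P - 0) <= N)%R -> (P <= N / Y * Z)%R.
  move=> Y0 YX P0 Z0; rewrite !subr0 mulrAC ler_pdivrMr// => XP.
  rewrite mulrAC ler_pdivlMr//; apply: le_trans XP.
  by rewrite mulrC ler_wpM2r.
exact: aux cW0 HWy (primitive_ge0 hf ya) Wy0 H.
Qed.

(** The uniform bound passes to [f] by monotone convergence over the sets where [f*] is at most [n];
    there [f*] is dominated by the rearrangement of [fmin n]. *)
Lemma dual_rearr_bound t : I t -> exists C : R, forall y, I y -> (t <= y)%R ->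
  \int[leb]_(x in `]0%R, y]) rearr leb I f x <= (C * W y)%:E.
Proof.
move=> It; have [C HC] := dual_fmin_bound It; exists C => y Iy ty.
have [y0 ya] := Iy.
have mr g : lebesgue_mfun `]0%R, y]%classic (rearr leb I g).
  by apply: lmfun_rearr; exact: interval_is_interval.
have mi : lebesgue_measurable `]0%R, y]%classic by exact: lmeas_itv.
(* If [f*] were infinite at [x], the rearrangement of [fmin n] would be at least [n] on []0, x]],
   and [n * x] would be bounded; [n] is chosen past the bound. *)
have f_fin x : `]0%R, y]%classic x -> rearr leb I f x < +oo.
  rewrite /= in_itv/= => /andP[x0 xy]; rewrite ltey; apply/eqP => fx.
  have xa : x%:E < a by apply: le_lt_trans ya; rewrite lee_fin.
  pose n := (Num.truncn (`|(C * W y)%R|%R / x)%R).+1.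
  have : (n%:R * x)%:E <= (C * W y)%:E.
    apply: le_trans (HC n y Iy ty).
    have mx : lebesgue_measurable `]0%R, x]%classic by exact: lmeas_itv.
    have sxy : `]0%R, x]%classic `<=` `]0%R, y]%classic by apply: subset_itvl; rewrite bnd_simp.
    apply: (@le_trans _ _ (\int[leb]_(s in `]0%R, x]) rearr leb I (fmin n) s)); last first.
      by apply: int_subset => // s _; exact: rearr_ge0.
    have -> : (n%:R * x)%:E = n%:R%:E * leb `]0%R, x]%classic.
      by rewrite leb_itv_oc ?ltW// subr0.
    rewrite -int_cst//; apply: int_le => //.
    - exact: lmfun_cst.
    - exact: lmfunS (mr _).
    - move=> s /=; rewrite in_itv/= => /andP[s0 sx]; apply: rearr_fmin_ge => //.
      apply: le_trans (rearr_antitone _ _ _ sx); by rewrite fx leey.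
  rewrite lee_fin; apply/negP; rewrite -ltNge; apply: le_lt_trans (ler_norm _) _.
  by rewrite -ltr_pdivrMr// truncnS_gt.
pose S n : set R := `]0%R, y]%classic `&` [set x | rearr leb I f x <= n%:R%:E].
have iS n : is_interval (S n).
  move=> u v [/= uI un] [/= vI vn] x /andP[ux xv]; split => /=.
    move: uI vI; rewrite !in_itv/= => /andP[u0 _] /andP[_ vy].
    by rewrite (lt_le_trans u0)//= (le_trans xv).
  by apply: le_trans un; exact: rearr_antitone.
have SE : \bigcup_n S n = `]0%R, y]%classic.
  apply/seteqP; split => x; first by case=> n _ [].
  move=> xI; have := f_fin x xI; rewrite -ge0_fin_numE ?rearr_ge0// => fxfin.
  exists (Num.truncn `|fine (rearr leb I f x)|).+1 => //; split => //=.
  by rewrite -(fineK fxfin) lee_fin ltW// (le_lt_trans (ler_norm _))// truncnS_gt.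
have mS n : lebesgue_measurable (S n) by exact: lmeas_is_interval.
have SI n : S n `<=` `]0%R, y]%classic by move=> x [].
rewrite -SE; apply: int_exhaust_le => //.
- move=> n m nm; rewrite subsetEset => x [xI /= xn]; split => //=.
  by apply: le_trans xn _; rewrite lee_fin ler_nat.
- by rewrite SE.
- by move=> *; exact: rearr_ge0.
move=> n; apply: le_trans (HC n y Iy ty).
apply: (@le_trans _ _ (\int[leb]_(x in S n) rearr leb I (fmin n) x)).
  apply: int_le => //; [exact: lmfunS (mr _)|exact: lmfunS (mr _)|by move=> *; exact: rearr_ge0|].
  move=> x [xI /= xn]; have := f_fin x xI; rewrite -ge0_fin_numE ?rearr_ge0// => fxfin.
  rewrite -(fineK fxfin); apply: rearr_fmin_ge; last by rewrite fineK.
  by rewrite -lee_fin fineK.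
by apply: int_subset => // x _; exact: rearr_ge0.
Qed.

End dual_rearrangement_bound.

(** * The norm of the optimal weight *)

Section record_chains.
Context {R : realType}.
Variables (a : \bar R) (u w : R -> R).
Local Notation I := (interval0 a).
Hypotheses (hu : decreasing_weight a u) (hw : decreasing_weight a w).
Local Notation F := (primitive u).
Local Notation W := (primitive w).
Local Open Scope ring_scope.

(** Induction on [j], each step dividing the slope by [r]; the bound [L] on [rho] provides the first
    cell. A new cell runs from the last record of the previous slope to [y]: since [y] is a record,
    the chord slope there is at least [L / r ^+ j.+1], and beyond the image of the previous record
    [rho] is at most [L / r ^+ j], that is [r] times this coefficient. *)
Lemma record_chain (rho : R -> R) (r L : R) : 1 < r -> 0 < L ->
  (forall tau, rho tau <= L) ->
  (forall l t, 0 < l -> I t -> ~ below_record a u w l t -> forall tau,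
     W (last_record a u w l) <= tau -> rho tau <= l) ->
  forall j y, record_point a u w (L / r ^+ j) y ->
  exists K z c, [/\ z 0%N = 0, record_point a u w (L / r ^+ j) (z K), y <= z K,
    (forall i, (i < K)%N -> z i < z i.+1) &
    forall i, (i < K)%N -> [/\ 0 <= c i,
      c i * (W (z i.+1) - W (z i)) <= F (z i.+1) - F (z i) &
      forall tau, W (z i) <= tau -> rho tau <= r * c i]].
Proof.
move=> r1 L0 rhoL rho_le; have r0 : 0 < r by exact: lt_trans r1.
elim=> [|j IH] y ry.
  have [y0 ya Hy] := ry; have := y0; rewrite le_eqVlt => /predU1P[yE|yp].
    exists 0%N, (fun=> 0), (fun=> 0); split => //; first exact: record_point0.
    by rewrite -yE.
  exists 1%N, (fun i => if i is 0%N then 0 else y), (fun=> L); split => //.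
    by case.
  case=> // _; split; first exact: ltW.
    have := Hy 0 (lexx 0) y0; rewrite expr0 divr1.
    by rewrite !(@primitive_le0 R _ 0 (lexx 0)) mulr0 !subr0; lra.
  by move=> tau _; apply: le_trans (rhoL tau) _; rewrite ler_peMl// ltW.
have l0 : 0 < L / r ^+ j by rewrite divr_gt0// exprn_gt0.
have lE : L / r ^+ j = r * (L / r ^+ j.+1).
  by rewrite exprS invfM mulrCA mulVKf ?gt_eqF.
have l1 : 0 < L / r ^+ j.+1 by rewrite divr_gt0// exprn_gt0.
have ll : L / r ^+ j.+1 <= L / r ^+ j by rewrite lE ler_peMl// ltW.
(* A record of the previous slope at or past [y] comes with a chain that already covers [y]; this is
   why the chain may end beyond [y]. *)
have [[y' ry' yy']|H] := pselect (exists2 y', record_point a u w (L / r ^+ j) y' & y <= y').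
  have [K [z [c [z0 rz yz zS zc]]]] := IH y' ry'.
  exists K, z, c; split => //; first exact: (record_point_anti hw ll).
  exact: le_trans yz.
have [y0 ya Hy] := ry.
have nB : ~ below_record a u w (L / r ^+ j) y.
  by move=> [y' ry' yy']; apply: H; exists y' => //; exact: ltW.
have yp : 0 < y.
  rewrite ltNge; apply/negP => yn; apply: H; exists 0 => //.
  exact: record_point0.
have Iy : I y by [].
have rx := last_recordP hu hw l0 Iy nB; set x := last_record a u w (L / r ^+ j) in rx.
have [K [z [c [z0 rz xz zS zc]]]] := IH x rx.
have zx : z K = x.
  by apply/eqP; rewrite eq_le xz andbT; exact: le_last_record nB _ rz.
have xy : x < y by rewrite ltNge; apply/negP => yx; apply: H; exists x.
exists K.+1, (fun i => if (i <= K)%N then z i else y),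
  (fun i => if (i < K)%N then c i else L / r ^+ j.+1); split => //.
- by rewrite ltnn.
- by rewrite ltnn.
- move=> i iK1; have /predU1P[->|iK] : (i == K) || (i < K)%N by rewrite -leq_eqVlt -ltnS.
    by rewrite leqnn ltnn zx.
  by rewrite (ltnW iK) iK zS.
move=> i iK1; have : (i == K) || (i < K)%N by rewrite -leq_eqVlt -ltnS.
move=> /predU1P[->|iK]; last first.
  by rewrite (ltnW iK) iK; exact: zc.
rewrite leqnn ltnn; split; first exact: ltW.
- rewrite zx; have [x0 _ _] := rx.
  by have := Hy x x0 (ltW xy); lra.
- by move=> tau; rewrite zx -lE => Wx; apply: (rho_le _ y).
Qed.

End record_chains.

(** As [c i <= y i / x i], the sum is dominated, up to the factor [r], by the one that [chain_test]
    bounds. *)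
Lemma weighted_sum_le {R : realType} (K : nat) (c x y h : nat -> R) (r N : R) :
  (0 < r)%R ->
  (forall i, (i < K)%N -> [/\ 0 < x i, c i * x i <= y i & 0 <= h i]%R) ->
  (\sum_(i < K) h i / x i * y i <= N)%R ->
  (\sum_(i < K) r * c i * h i <= r * N)%R.
Proof.
move=> r0 H; rewrite -(ler_pM2l r0); apply: le_trans.
rewrite mulr_sumr; apply: ler_sum => i _; rewrite -mulrA ler_pM2l//.
have [x0 cxy h0] := H i (ltn_ord i).
by rewrite mulrAC ler_pdivlMr// mulrAC [leRHS]mulrC ler_wpM2r.
Qed.

Section level_norm.
Context {R : realType}.
Variables (a : \bar R) (w : R -> R) (E : fspace R).
Local Notation I := (interval0 a).
Let b := \int[leb]_(x in I) (w x)%:E.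
Local Notation J := (interval0 b).
Hypothesis hw : decreasing_weight a w.
Hypothesis w_gt0 : forall x, I x -> (0 < w x)%R.
Local Notation W := (primitive w).
Variables (f : R -> R) (N : R).
Hypotheses (fsE : fully_symmetric J E) (supE : has_support J E) (mf : L0 I f).
Hypothesis fN : kothe_gauge I (Lambda I J E w) f <= N%:E.
Local Notation u := (star a f).
Local Notation F := (primitive u).

Lemma dual_f_int x : I x -> \int[leb]_(t in `]0%R, x]) rearr leb I f t < +oo.
Proof.
move=> Ix; have [C HC] := dual_rearr_bound hw w_gt0 fsE supE mf fN Ix.
by apply: le_lt_trans (HC x Ix (lexx x)) _; rewrite ltry.
Qed.

Let hu : decreasing_weight a u.
Proof. by apply: star_decreasing; [exact: dw_pos hw|exact: dual_f_int]. Qed.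

Let f_fin := rearr_fin dual_f_int.

Let mI : lebesgue_measurable I. Proof. exact: lmeas_interval0. Qed.

Let u_right t (c : R) : I t ->
  (forall y, I y -> (t < y)%R -> (u y <= c)%R) -> (u t <= c)%R.
Proof.
move=> It H; have [t0 ta] := It.
rewrite -lee_fin -(starE (f_fin It)).
apply: rearr_right_lim => //; first exact: monotone_on_leb.
move=> y ty; have [ya|ya] := ltP y%:E a.
  have Iy : I y by split => //; exact: lt_trans ty.
  by rewrite (starE (f_fin Iy)) lee_fin; exact: H.
have [y' ty' y'a] := exists_between_top ta.
have Iy' : I y' by split => //; exact: lt_trans ty'.
apply: (@le_trans _ _ (rearr leb I f y')).
  by apply: rearr_antitone; rewrite -lee_fin; apply: le_trans ya; exact: ltW.
by rewrite (starE (f_fin Iy')) lee_fin; exact: H.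
Qed.

Let F_le_W t : I t -> exists C : R,
  forall y, I y -> (t <= y)%R -> (F y <= C * W y)%R.
Proof.
move=> It; have [C HC] := dual_rearr_bound hw w_gt0 fsE supE mf fN It.
exists C => y Iy ty; have [_ ya] := Iy.
by rewrite -lee_fin -(primitiveE hu ya) -(int_star f_fin ya); exact: HC.
Qed.

Local Notation v := (level_weight a u w).
Local Notation phi := (level a u w).

Lemma dual_weight_decreasing : decreasing_weight a v.
Proof. exact: level_weight_decreasing. Qed.

Lemma dual_weight_gt0 x : I x -> (0 < v x)%R.
Proof. exact: (level_weight_gt0 hu hw w_gt0 F_le_W). Qed.

Lemma dual_weight_le x : I x -> \int[leb]_(t in `]0%R, x]) (v t)%:E <= (W x)%:E.
Proof. exact: (int_level_weight_le hu hw w_gt0 u_right F_le_W). Qed.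

(** [f* = phi v] also holds where [phi] is 0, because [f*] vanishes there. *)
Lemma dual_quotientE x : I x -> rearr leb I f x * ((v x)^-1)%:E = (phi x)%:E.
Proof.
move=> Ix; rewrite (starE (f_fin Ix)) -EFinM; congr EFin.
rewrite (level_weightE hu hw w_gt0 u_right F_le_W Ix) mulfK// gt_eqF//.
exact: dual_weight_gt0.
Qed.

Let p : R -> R := fine \o (fun x => rearr leb I f x * ((v x)^-1)%:E).

Let pE x : I x -> p x = phi x.
Proof. by move=> Ix; rewrite /p/= dual_quotientE. Qed.

Lemma dual_quotient_L0 : L0 I p.
Proof.
apply: lmeas_antitoneR; first exact: interval0_is_interval.
move=> x y Ix Iy xy; rewrite !pE//.
exact: (level_anti hw w_gt0 F_le_W).
Qed.

Let rho := rearr (density v) I p.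

Let monv : monotone_on I (density v).
Proof.
apply: monotone_on_density => //; first exact: dw_L0 dual_weight_decreasing.
exact: dw_ge0 dual_weight_decreasing.
Qed.

(** From the last record [x] on, the level is at most [l]; so the set where it exceeds [l] lies in
    []0, x]] and has [v]-mass at most [W x], hence at most [tau]. *)
Let rho_le l t : (0 < l)%R -> I t -> ~ below_record a u w l t -> forall tau,
  (W (last_record a u w l) <= tau)%R -> rho tau <= l%:E.
Proof.
move=> l0 It nB tau Wtau; set x := last_record a u w l in Wtau.
apply: rearr_le_tail => //; [exact: dual_quotient_L0|exact: ltW|].
apply: (@le_trans _ _ (W x)%:E); last by rewrite lee_fin.
have x0 : (0 <= x)%R by exact: last_record_ge0 nB.
have xa : x%:E < a by exact: last_record_lta It nB.
have tail_sub : I `&` [set y | (l < `|p y|)%R] `<=` `]0%R, x]%classic.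
  move=> y [Iy /= ly]; have [y0 ya] := Iy; rewrite in_itv/= y0/= leNgt.
  apply/negP => xy; move: ly; rewrite pE// ger0_norm; last first.
    exact: (level_ge0 hw w_gt0 F_le_W).
  rewrite ltNge => /negP; apply; apply: (level_le hw w_gt0 F_le_W) => //.
  by apply: (le_after_last_record nB) => //; exact: ltW.
have mt := lmeas_tail l mI dual_quotient_L0.
have [x1|x1] := leP x 0%R.
  rewrite /tail /density (_ : _ `&` _ = set0); last first.
    apply/seteqP; split => // y /tail_sub; rewrite set_itv_ge//.
    by rewrite bnd_simp -leNgt.
  by rewrite int_set0 lee_fin (primitive_ge0 hw).
apply: le_trans (dual_weight_le (conj x1 xa)).
apply: int_subset => //; first exact: lmeas_itv.
- exact: (dw_lmfun_itv dual_weight_decreasing).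
- by move=> s; exact: (dw_ge0_itv dual_weight_decreasing).
Qed.

Lemma dual_quotient_rearr_fin tau : J tau -> rho tau < +oo.
Proof.
move=> [tau0 _]; have [t It Wt] := primitive_small hw tau0.
have [l l0 nB] := below_record_bounded hw w_gt0 F_le_W It.
apply: le_lt_trans (rho_le l0 It nB _) (ltry l).
apply: le_trans Wt; apply: (primitive_mono hw); [exact: last_record_ge0 nB|
  exact: last_record_le nB|by case: It].
Qed.

Let rho1 : R -> R := fine \o rho.

Let rho1_ge0 x : (0 <= rho1 x)%R.
Proof. by rewrite fine_ge0// rearr_ge0. Qed.

Let rhoE x : J x -> rho x = (rho1 x)%:E.
Proof. by move=> Jx; rewrite /rho1/= fineK// ge0_fin_numE ?rearr_ge0// dual_quotient_rearr_fin. Qed.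

Let rho1_anti x y : J x -> J y -> (x <= y)%R -> (rho1 y <= rho1 x)%R.
Proof. by move=> Jx Jy xy; rewrite -lee_fin -!rhoE//; exact: rearr_antitone. Qed.

Let rho1_le l t : (0 < l)%R -> I t -> ~ below_record a u w l t -> forall tau,
  (W (last_record a u w l) <= tau)%R -> (rho1 tau <= l)%R.
Proof.
move=> l0 It nB tau Wtau; have H := rho_le l0 It nB Wtau.
rewrite -lee_fin /rho1/= fineK// ge0_fin_numE ?rearr_ge0//.
by apply: le_lt_trans H _; rewrite ltry.
Qed.

Section test.
Variable (g : R -> R).
Hypotheses (Eg : carrier E g) (g1 : gauge E g <= 1).

Let b0 : 0 < b := total_gt0 hw w_gt0.
Let g_int := fully_symmetric_locally_integrable b0 fsE supE Eg.
Let hg : decreasing_weight b (star b g).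
Proof. exact: star_decreasing. Qed.
Local Notation H := (primitive (star b g)).

Let lmfun_product (A : set R) (q : R -> R) : is_interval A -> A `<=` J ->
  (forall x y, A x -> A y -> (x <= y)%R -> (q y <= q x)%R) ->
  lebesgue_mfun A (fun x => (q x * star b g x)%R%:E).
Proof.
move=> iA AJ qanti; have mA : lebesgue_measurable A by exact: lmeas_is_interval.
rewrite (_ : (fun x => _) = ((EFin \o q) \* (EFin \o star b g))); last first.
  by apply/funext => x /=; rewrite EFinM.
apply: lmfunM; first by apply/lmfun_EFin; exact: lmeas_antitoneR.
by apply: (lmfunS (lmeas_interval0 b) AJ); exact: dw_lmfun hg.
Qed.

Let sub_J x y : (0 <= x)%R -> y%:E < b -> `]x, y]%classic `<=` J.
Proof. exact: itv_interval0. Qed.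

Let int_product_le (q : R -> R) x y c : (0 <= x)%R -> (x <= y)%R -> y%:E < b ->
  (forall s t, `]x, y]%classic s -> `]x, y]%classic t -> (s <= t)%R -> (q t <= q s)%R) ->
  (forall t, `]x, y]%classic t -> (0 <= q t)%R) -> (0 <= c)%R ->
  (forall t, `]x, y]%classic t -> (q t <= c)%R) ->
  \int[leb]_(t in `]x, y]) (q t * star b g t)%R%:E <= (c * (H y - H x))%R%:E.
Proof.
move=> x0 xy yb qanti q0 c0 qc.
have mi : lebesgue_measurable `]x, y]%classic by exact: lmeas_itv.
have mg := dw_lmfun_itv hg x0 yb.
have gp t : `]x, y]%classic t -> 0 <= (star b g t)%:E by exact: (dw_ge0_itv hg).
rewrite EFinM -(primitive_diff hg x0 xy yb) -intZl//; apply: int_le => //.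
- apply: lmfun_product => //; [exact: interval_is_interval|exact: sub_J].
- by apply: (@lmfunM _ _ (cst c%:E)) => //; exact: lmfun_cst.
- by move=> t ty; rewrite lee_fin mulr_ge0// ?q0// star_ge0.
- by move=> t ty; rewrite -EFinM lee_fin ler_wpM2r ?qc// star_ge0.
Qed.

(** On each cell [q] is replaced by [r * c i], which turns the integral into increments of [H];
    [weighted_sum_le] then leads to [chain_test]. *)
Lemma dual_quotient_chain_le (q : R -> R) (r : R) (K : nat) (z c : nat -> R) :
  (1 < r)%R -> (forall x, (0 <= q x)%R) ->
  (forall x y, J x -> J y -> (x <= y)%R -> (q y <= q x)%R) ->
  z 0%N = 0%R -> (z K)%:E < a ->
  (forall i, (i < K)%N -> (z i < z i.+1)%R) ->
  (forall i, (i < K)%N -> [/\ (0 <= c i)%R,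
      (c i * (W (z i.+1) - W (z i)) <= F (z i.+1) - F (z i))%R &
      forall tau, (W (z i) <= tau)%R -> (q tau <= r * c i)%R]) ->
  \int[leb]_(t in `]0%R, W (z K)]) (q t * star b g t)%R%:E <= (r * N)%R%:E.
Proof.
move=> r1 q0 qanti z0 zK zS zc; have r0 : (0 < r)%R by exact: lt_trans r1.
have z_mono i j : (i <= j)%N -> (j <= K)%N -> (z i <= z j)%R.
  elim: j => [|j IH]; first by rewrite leqn0 => /eqP ->.
  rewrite leq_eqVlt => /predU1P[->//|ij] jK.
  by apply: le_trans (IH ij (ltnW jK)) _; rewrite ltW// zS.
have z_ge0 i : (i <= K)%N -> (0 <= z i)%R by move=> iK; rewrite -z0; exact: z_mono.
have z_lta i : (i <= K)%N -> (z i)%:E < a.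
  by move=> iK; apply: le_lt_trans zK; rewrite lee_fin z_mono.
have Wz_ge0 i : (i <= K)%N -> (0 <= W (z i))%R.
  by move=> iK; apply: (primitive_ge0 hw); exact: z_lta.
have Wz_ltb i : (i <= K)%N -> (W (z i))%:E < b.
  by move=> iK; apply: (primitive_lt_total hw w_gt0); [exact: z_ge0|exact: z_lta].
have Wlt i : (i < K)%N -> (W (z i) < W (z i.+1))%R.
  by move=> iK; apply: (primitive_lt hw w_gt0); [exact/z_ge0/ltnW|exact: zS|exact: z_lta].
have step m : (m <= K)%N -> \int[leb]_(t in `]0%R, W (z m)]) (q t * star b g t)%R%:E
    <= (\sum_(i < m) r * c i * (H (W (z i.+1)) - H (W (z i))))%R%:E.
  elim: m => [|m IH] mK.
    rewrite big_ord0 z0 (@primitive_le0 R w 0%R (lexx _)) set_itv_ge ?int_set0//.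
    by rewrite bnd_simp -leNgt.
  have [cm0 cW cq] := zc m mK.
  have U : `]0%R, W (z m.+1)]%classic = `]0%R, W (z m)]%classic `|` `]W (z m), W (z m.+1)]%classic.
    by rewrite -itv_bndbnd_setU// bnd_simp ?Wz_ge0 ?(ltnW mK)// ltW// Wlt.
  have mU : lebesgue_mfun `]0%R, W (z m.+1)]%classic (fun x => (q x * star b g x)%R%:E).
    apply: lmfun_product; [exact: interval_is_interval|exact: sub_J (lexx _) (Wz_ltb _ mK)|].
    by move=> x y Ax Ay; apply: qanti; exact: (sub_J (lexx _) (Wz_ltb _ mK)).
  rewrite U int_setU; [|exact: lmeas_itv|exact: lmeas_itv|by rewrite -U| |]; last 2 first.
  - by move=> t _; rewrite lee_fin mulr_ge0 ?star_ge0.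
  - apply/seteqP; split => // t [/=]; rewrite !in_itv/= => /andP[_ tx] /andP[xt _].
    by move: (le_lt_trans tx xt); rewrite ltxx.
  rewrite big_ord_recr/= EFinD; apply: leeD; first exact: IH (ltnW mK).
  have SJ := sub_J (Wz_ge0 _ (ltnW mK)) (Wz_ltb _ mK).
  apply: int_product_le; [exact: Wz_ge0 (ltnW mK)|exact/ltW/Wlt|exact: Wz_ltb| | | |].
  - by move=> s t As At; apply: qanti; exact: SJ.
  - by move=> t _; exact: q0.
  - by rewrite mulr_ge0// ltW.
  - by move=> t /=; rewrite in_itv/= => /andP[/ltW Wt _]; exact: cq.
apply: le_trans (step K (leqnn K)) _; rewrite lee_fin.
have := chain_test hw w_gt0 fsE mf fN dual_f_int Eg g1 g_int z0 zK zS.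
apply: (@weighted_sum_le _ K c (fun i => W (z i.+1) - W (z i))%R
  (fun i => F (z i.+1) - F (z i))%R (fun i => H (W (z i.+1)) - H (W (z i)))%R r N r0) => i iK.
have [ci0 cW _] := zc i iK; split; [by rewrite subr_gt0; exact: Wlt|exact: cW|].
rewrite subr_ge0; apply: (primitive_mono hg); [exact: Wz_ge0 (ltnW iK)|
  exact/ltW/Wlt|exact: Wz_ltb].
Qed.

(** The empty chain, whose sum is 0, already passes the test. *)
Let N_ge0 : (0 <= N)%R.
Proof.
have := chain_test hw w_gt0 fsE mf fN dual_f_int Eg g1 g_int (K := 0) (z := fun=> 0%R).
by move=> /(_ erefl (dw_pos hw) (fun i => ltac:(by [])))/=; rewrite big_ord0.
Qed.

Let W_cofinal t : t%:E < b -> exists2 x, I x & (t <= W x)%R.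
Proof.
move=> tb; apply: contrapT => nx.
have Wt x : I x -> (W x < t)%R.
  by move=> Ix; rewrite ltNge; apply/negP => ?; apply: nx; exists x.
have t0 : (0 <= t)%R.
  have [x Ix _] := primitive_small hw ltr01.
  by apply: le_trans (ltW (Wt x Ix)); apply: (primitive_ge0 hw); case: Ix.
move: tb; rewrite ltNge => /negP; apply.
apply: int_interval0_le.
- by rewrite lee_fin.
- exact: dw_lmfun hw.
- by move=> x Ix; rewrite lee_fin ltW// w_gt0.
- move=> x y x0 xy ya; have Iy : I y by split => //; exact: lt_trans xy.
  rewrite (primitive_diff hw (ltW x0) (ltW xy) ya) lee_fin.
  apply: le_trans (ltW (Wt y Iy)); rewrite lerBlDr lerDl.
  by apply: (primitive_ge0 hw); apply: le_lt_trans ya; rewrite lee_fin ltW.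
Qed.

(** Away from 0 the decreasing [rho1] is bounded by its value at [s]. Truncation at [L] leaves it
    unchanged on []s, t]] and gives the global bound from which the record chain starts. *)
Let int_quotient_approx (s t r e : R) : (0 < s)%R -> (s < t)%R -> t%:E < b ->
  (1 < r)%R -> (0 < e)%R ->
  \int[leb]_(x in `]s, t]) (rho1 x * star b g x)%R%:E <= (r * N + e * H t)%R%:E.
Proof.
move=> s0 st tb r1 e0; have r0 : (0 < r)%R by exact: lt_trans r1.
have t0 : (0 < t)%R by exact: lt_trans st.
have Js : J s by split => //; apply: lt_trans tb.
pose L := (rho1 s + 1)%R; have L0 : (0 < L)%R by rewrite ltr_wpDl.
pose q x := Order.min (rho1 x) L.
have q0 x : (0 <= q x)%R by rewrite le_min rho1_ge0 ltW.
have qL x : (q x <= L)%R by rewrite ge_min lexx orbT.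
have qrho x : (q x <= rho1 x)%R by rewrite ge_min lexx.
have qanti x y : J x -> J y -> (x <= y)%R -> (q y <= q x)%R.
  by move=> Jx Jy xy; rewrite le_min qL (le_trans (qrho y)) ?rho1_anti.
have q_le l t' : (0 < l)%R -> I t' -> ~ below_record a u w l t' -> forall tau,
    (W (last_record a u w l) <= tau)%R -> (q tau <= l)%R.
  by move=> l0 It nB tau Wt; apply: le_trans (qrho tau) _; exact: (rho1_le l0 It nB Wt).
(* Past the last record point for the level l = L / r ^ j the factor rho1 is at
   most l <= e, which accounts for the term e * H t. *)
have [j Lj] := expr_unbounded (L / e)%R r1.
pose l := (L / r ^+ j)%R; have rj0 : (0 < r ^+ j)%R by rewrite exprn_gt0.
have l0 : (0 < l)%R by rewrite divr_gt0.
have le : (l <= e)%R by rewrite ler_pdivrMr// mulrC -ler_pdivrMr.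
have mq x y : (0 <= x)%R -> y%:E < b ->
    lebesgue_mfun `]x, y]%classic (fun x => (q x * star b g x)%R%:E).
  move=> x0 yb; have S := sub_J x0 yb.
  apply: lmfun_product => //; first exact: interval_is_interval.
  by move=> x' y' /S Jx /S Jy; exact: qanti.
have qg0 x : 0 <= (q x * star b g x)%R%:E by rewrite lee_fin mulr_ge0 ?star_ge0.
have Ht0 : (0 <= H t)%R by exact: (primitive_ge0 hg).
have -> : \int[leb]_(x in `]s, t]) (rho1 x * star b g x)%R%:E =
    \int[leb]_(x in `]s, t]) (q x * star b g x)%R%:E.
  apply: int_eq => x sx; congr (EFin (_ * _)%R); apply/esym/min_idPl.
  have Jx := sub_J (ltW s0) tb sx.
  move: sx; rewrite /= in_itv/= => /andP[sx _].
  by apply: le_trans (rho1_anti Js Jx (ltW sx)) _; rewrite lerDl.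
apply: (@le_trans _ _ (\int[leb]_(x in `]0%R, t]) (q x * star b g x)%R%:E)).
  apply: int_subset; [exact: lmeas_itv|exact: lmeas_itv|exact: mq|by []|].
  by apply: subset_itvr; rewrite bnd_simp ltW.
(* Either a chain covers []0, t]], or all records of slope [l] have their image before [t]; then a
   last record exists, because [W] reaches [t] inside [I]. *)
have [[y ry tWy]|noy] := pselect (exists2 y, record_point a u w l y & (t <= W y)%R).
  have [K [z [c [z0 rz yz zS zc]]]] := record_chain hu hw r1 L0 qL q_le ry.
  have [zK0 zKa _] := rz; have [y0 ya _] := ry.
  have Wb : (W (z K))%:E < b by exact: (primitive_lt_total hw w_gt0).
  apply: (@le_trans _ _ (\int[leb]_(x in `]0%R, W (z K)]) (q x * star b g x)%R%:E)).
    apply: int_subset; [exact: lmeas_itv|exact: lmeas_itv|exact: mq|by []|].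
    apply: subset_itvl; rewrite bnd_simp; apply: le_trans tWy _.
    exact: (primitive_mono hw).
  apply: le_trans (dual_quotient_chain_le r1 q0 qanti z0 zKa zS zc) _.
  by rewrite lee_fin lerDl mulr_ge0// ltW.
have [t1 It1 tWt1] := W_cofinal tb.
have Wlt y : record_point a u w l y -> (W y < t)%R.
  by move=> ry; rewrite ltNge; apply/negP => ?; apply: noy; exists y.
have nB : ~ below_record a u w l t1.
  move=> [y ry ty]; have := Wlt y ry; rewrite ltNge => /negP; apply.
  have [t10 _] := It1; have [_ ya _] := ry.
  by apply: le_trans tWt1 _; apply: (primitive_mono hw) => //; exact: ltW.
have rx := last_recordP hu hw l0 It1 nB; set x := last_record a u w l in rx.
have [K [z [c [z0 rz xz zS zc]]]] := record_chain hu hw r1 L0 qL q_le rx.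
have zx : z K = x.
  by apply/eqP; rewrite eq_le xz andbT; exact: le_last_record nB _ rz.
have [x0 xa _] := rx; have Wxt := Wlt x rx.
have Wx0 : (0 <= W x)%R by exact: (primitive_ge0 hw).
have U : `]0%R, t]%classic = `]0%R, W x]%classic `|` `]W x, t]%classic.
  by rewrite -itv_bndbnd_setU// bnd_simp// ltW.
rewrite U int_setU; [|exact: lmeas_itv|exact: lmeas_itv|
  by rewrite -U; exact: mq|by []|]; last first.
  apply/seteqP; split => // y [/=]; rewrite !in_itv/= => /andP[_ tx] /andP[xt _].
  by move: (le_lt_trans tx xt); rewrite ltxx.
rewrite EFinD; apply: leeD.
  rewrite -{1}zx; apply: dual_quotient_chain_le r1 q0 qanti z0 _ zS zc.
  by rewrite zx.
have SJ := sub_J Wx0 tb.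
apply: (@le_trans _ _ (l * (H t - H (W x)))%R%:E).
  apply: int_product_le => //; [exact: ltW| |exact: ltW|].
  - by move=> y y' /SJ Jy /SJ Jy'; exact: qanti.
  - move=> y /=; rewrite in_itv/= => /andP[/ltW Wy _]; exact: (q_le _ _ l0 It1 nB _ Wy).
have HW : (0 <= H (W x))%R by apply: (primitive_ge0 hg); apply: lt_trans tb; rewrite lte_fin.
have HWt : (0 <= H t - H (W x))%R by rewrite subr_ge0; apply: (primitive_mono hg) => //; exact: ltW.
rewrite lee_fin; apply: (le_trans (ler_wpM2r HWt le)).
by rewrite ler_pM2l// lerBlDr lerDl.
Qed.

Let int_quotient_le (s t : R) : (0 < s)%R -> (s < t)%R -> t%:E < b ->
  \int[leb]_(x in `]s, t]) (rho1 x * star b g x)%R%:E <= N%:E.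
Proof.
move=> s0 st tb; apply/lee_addgt0Pr => e e0.
have Ht0 : (0 <= H t)%R by exact: (primitive_ge0 hg).
have e2 : (0 < e / 2)%R by rewrite divr_gt0.
have N1 : (0 < N + 1)%R by rewrite ltr_wpDl.
have H1 : (0 < H t + 1)%R by rewrite ltr_wpDl.
have r1 : (1 < 1 + e / 2 / (N + 1))%R by rewrite ltrDl divr_gt0.
have d0 : (0 < e / 2 / (H t + 1))%R by rewrite divr_gt0.
apply: le_trans (int_quotient_approx s0 st tb r1 d0) _.
rewrite -EFinD lee_fin.
have A1 : (e / 2 / (N + 1) * N <= e / 2)%R.
  by rewrite mulrAC ler_pdivrMr// ler_pM2l// lerDl.
have A2 : (e / 2 / (H t + 1) * H t <= e / 2)%R.
  by rewrite mulrAC ler_pdivrMr// ler_pM2l// lerDl.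
rewrite mulrDl mul1r; lra.
Qed.

(** Hardy-Littlewood on [J] reduces the pairing to decreasing functions, and exhaustion of [J] to
    intervals away from both ends. *)
Lemma dual_quotient_test : \int[leb]_(x in J) `|fine (rho x) * g x|%:E <= N%:E.
Proof.
have mJ : lebesgue_measurable J by exact: lmeas_interval0.
have iJ : is_interval J by exact: interval0_is_interval.
have mrho1 : L0 J rho1 by apply: lmeas_antitoneR => //; exact: rho1_anti.
have mg : L0 J g by apply: (bfs_measurable (fs_bfs fsE)).
apply: le_trans (hardy_littlewood_leb (ltW b0) mrho1 mg) _.
have mprod : lebesgue_mfun J (fun x => (rho1 x * star b g x)%R%:E).
  by apply: lmfun_product => // x y; exact: rho1_anti.
have p0 x : 0 <= (rho1 x * star b g x)%R%:E by rewrite lee_fin mulr_ge0 ?star_ge0.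
apply: (@le_trans _ _ (\int[leb]_(x in J) (rho1 x * star b g x)%R%:E)).
  apply: int_le => //.
  - by apply: lmfunM; exact: lmfun_rearr.
  - by move=> x _; rewrite mule_ge0 ?rearr_ge0.
  move=> x Jx; rewrite (starE (rearr_fin g_int Jx)) EFinM.
  rewrite lee_wpmul2r ?lee_fin ?star_ge0//.
  by apply: rearr_le_antitone => // y y' Jy Jy'; exact: rho1_anti.
by apply: int_interval0_le => //; rewrite lee_fin.
Qed.

End test.

End level_norm.

(** * The isometry *)

Section admissible_weights.
Context {R : realType}.
Variables (a : \bar R) (w : R -> R).
Local Notation I := (interval0 a).
Let b := \int[leb]_(x in I) (w x)%:E.
Local Notation J := (interval0 b).
Hypothesis hw : decreasing_weight a w.
Local Notation W := (primitive w).

Let mI : lebesgue_measurable I. Proof. exact: lmeas_interval0. Qed.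

(** Together with [int_rearr_le] it equates the primitive of a decreasing weight with that of its
    rearrangement, so that [prec] between weights becomes [V <= W]. *)
Lemma int_le_rearr v x : decreasing_weight a v -> I x ->
  \int[leb]_(t in `]0%R, x]) (v t)%:E <= \int[leb]_(t in `]0%R, x]) rearr leb I v t.
Proof.
move=> hv [x0 xa]; have S : `]0%R, x]%classic `<=` I by exact: itv_interval0.
rewrite (@int_eq _ _ _ (fun t => `|v t|%:E)).
  apply: int_set_le_rearr => //; [exact: dw_L0 hv|exact: lmeas_itv|].
  by rewrite (leb_itv_oc (ltW x0)) subr0.
by move=> t /S It; rewrite ger0_norm// (dw_ge0 hv).
Qed.

Lemma int_rearr_le v x : decreasing_weight a v -> I x ->
  \int[leb]_(t in `]0%R, x]) rearr leb I v t <= \int[leb]_(t in `]0%R, x]) (v t)%:E.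
Proof.
move=> hv [x0 xa]; apply: int_le.
- exact: lmeas_itv.
- by apply: lmfun_rearr; exact: interval_is_interval.
- exact: (dw_lmfun_itv hv).
- by move=> *; exact: rearr_ge0.
move=> t tx; have It : I t by exact: itv_interval0 tx.
by apply: rearr_le_antitone; [exact: It|exact: dw_ge0 hv|exact: dw_anti hv].
Qed.

(** Finiteness of the primitive of [v] is part of the conclusion, so [int_le_rearr] cannot be
    invoked for [v] and its argument is repeated. *)
Lemma admissible_primitive v : admissible I w v ->
  decreasing_weight a v /\ forall x, I x ->
    \int[leb]_(t in `]0%R, x]) (v t)%:E <= (W x)%:E.
Proof.
move=> [[v0 vanti] vw].
have iI : is_interval I by exact: interval0_is_interval.
have mv : L0 I v by exact: lmeas_antitoneR.
have vW x : I x -> \int[leb]_(t in `]0%R, x]) (v t)%:E <= (W x)%:E.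
  move=> Ix; have [x0 xa] := Ix; have S : `]0%R, x]%classic `<=` I by exact: itv_interval0.
  apply: (@le_trans _ _ (\int[leb]_(t in `]0%R, x]) rearr leb I v t)).
    rewrite (@int_eq _ _ _ (fun t => `|v t|%:E)).
      apply: int_set_le_rearr => //; first exact: lmeas_itv.
      by rewrite (leb_itv_oc (ltW x0)) subr0.
    by move=> t /S It; rewrite ger0_norm// ltW// v0.
  by apply: le_trans (vw x Ix) _; rewrite -(primitiveE hw xa); exact: int_rearr_le.
split => //; split => //; first exact: dw_pos hw.
  by move=> x /v0/ltW.
by move=> x Ix; apply: le_lt_trans (vW x Ix) _; rewrite ltry.
Qed.

Variable v : R -> R.
Hypotheses (hv : decreasing_weight a v)
  (vW : forall x, I x -> \int[leb]_(t in `]0%R, x]) (v t)%:E <= (W x)%:E).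

Lemma density_total_le : density v I <= b.
Proof.
apply: int_interval0_le.
- by apply: int_ge0 => x Ix; rewrite lee_fin (dw_ge0 hw).
- exact: dw_lmfun hv.
- by move=> x Ix; rewrite lee_fin (dw_ge0 hv).
move=> s t s0 st ta; have It : I t by split => //; exact: lt_trans st.
apply: (@le_trans _ _ (\int[leb]_(x in `]0%R, t]) (v x)%:E)).
  apply: int_subset; [exact: lmeas_itv|exact: lmeas_itv|exact: (dw_lmfun_itv hv)|
    by move=> x; exact: (dw_ge0_itv hv)|].
  by apply: subset_itvr; rewrite bnd_simp ltW.
by apply: le_trans (vW It) _; exact: primitive_le_total.
Qed.

(** Unless [A] is [I] or empty, it lies between []0, z[] and []0, z]], with [z] its supremum; the
    end point carries no mass, so [V z <= W z] applies. *)
Lemma density_initial_le A : lebesgue_measurable A -> A `<=` I ->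
  (forall x y, A x -> I y -> (y <= x)%R -> A y) -> density v A <= density w A.
Proof.
move=> mA AI Ainit.
have [->|[c Ic nAc]] : A = I \/ exists2 c, I c & ~ A c.
- apply: contrapT => /not_orP[AnI H]; apply: AnI; apply/seteqP; split => // x Ix.
  by apply: contrapT => nAx; apply: H; exists x.
- exact: density_total_le.
have Ac x : A x -> (x < c)%R.
  by move=> Ax; rewrite ltNge; apply/negP => /(Ainit _ _ Ax Ic).
have [[x0 Ax0]|A0] := pselect (A !=set0); last first.
  have -> : A = set0 by apply/seteqP; split => // x Ax; apply: A0; exists x.
  by rewrite /density !int_set0.
have supA : has_sup A by split; [exists x0|exists c => x /Ac/ltW].
set z := sup A.
have Az x : A x -> (x <= z)%R by move=> Ax; apply: ub_le_sup => //; exact: supA.2.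
have [c0 ca] := Ic.
have zc : (z <= c)%R by apply: ge_sup; [exact: supA.1|move=> x /Ac/ltW].
have za : z%:E < a by apply: le_lt_trans ca; rewrite lee_fin.
have z0 : (0 < z)%R by have [x00 _] := AI _ Ax0; apply: lt_le_trans (Az _ Ax0).
have zA : `]0%R, z[%classic `<=` A.
  move=> x /=; rewrite in_itv/= => /andP[xp xz].
  have [y Ay xy] := sup_gt supA.1 xz.
  apply: Ainit Ay _ (ltW xy); split => //; apply: lt_trans za.
  by rewrite lte_fin.
apply: (@le_trans _ _ (\int[leb]_(x in `]0%R, z]) (v x)%:E)).
  apply: int_subset => //; [exact: lmeas_itv|exact: (dw_lmfun_itv hv)|
    by move=> x; exact: (dw_ge0_itv hv)|].
  by move=> x Ax; rewrite /= in_itv/= Az// andbT; case: (AI _ Ax).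
apply: le_trans (vW (conj z0 za)) _.
rewrite -(primitiveE hw za) int_oc_oo; [|exact: (dw_lmfun_itv hw)|
  by move=> x; exact: (dw_ge0_itv hw)].
apply: int_subset => //; first exact: lmeas_itv.
  by apply: (lmfunS mI AI); exact: dw_lmfun hw.
by move=> x /AI Ix; rewrite lee_fin (dw_ge0 hw).
Qed.

(* The level sets of a decreasing function are initial intervals, and on these v
   has at most the mass of w. *)
Lemma rearr_density_le q t : L0 I q -> (forall x, I x -> (0 <= q x)%R) ->
  (forall x y, I x -> I y -> (x <= y)%R -> (q y <= q x)%R) ->
  rearr (density v) I q t <= rearr (density w) I q t.
Proof.
move=> mq q0 qanti; apply: ereal_inf_le_tmp => _ [s [s0 ts] <-]; exists s => //.
split => //; apply: le_trans ts; apply: density_initial_le.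
- exact: lmeas_tail.
- exact: subIsetl.
move=> x y [Ix /= sx] Iy yx; split => //=; move: sx; rewrite !ger0_norm ?q0// => sx.
by apply: lt_le_trans sx _; exact: qanti.
Qed.

Lemma kothe_gauge_le_Mspace (E : fspace R) f : banach_function_space J E ->
  (forall x, I x -> (0 < v x)%R) ->
  carrier (Mspace I J (kothe_dual J E) v) f ->
  kothe_gauge I (Lambda I J E w) f <= gauge (Mspace I J (kothe_dual J E) v) f.
Proof.
move=> bfs v0 Mf; have [mf [hfin Fvp]] := Mf.
have [mp [pfin [mpv pvE]]] := Fvp.
rewrite /Mspace/guarded/= asboolT// asboolT//.
set hf := (fun x => rearr leb I f x * ((v x)^-1)%:E) in hfin mp pfin mpv pvE *.
pose p := fine \o hf; pose pv := rearr (density v) I p.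
rewrite -/p -/pv in pfin mpv pvE *.
apply: ge_ereal_sup => _ [g [Lg g1] <-].
have [mg [gfin Fwq]] := Lg; have [mq [qfin Eq]] := Fwq.
have {}g1 : gauge E (fine \o rearr (density w) I (fine \o rearr leb I g)) <= 1.
  by move: g1; rewrite /Lambda/guarded/= asboolT// asboolT.
pose q := fine \o rearr leb I g; pose qw := rearr (density w) I q.
rewrite -/q -/qw in mq qfin Eq g1.
have iI : is_interval I by exact: interval0_is_interval.
have mJ : lebesgue_measurable J by exact: lmeas_interval0.
have iJ : is_interval J by exact: interval0_is_interval.
(* Membership gives finiteness only almost everywhere; an infinite value at [x] would spread to []0,
   x]], a set of positive measure. *)
have g_fin x : I x -> rearr leb I g x < +oo.
  move=> Ix; have [x0 xa] := Ix; rewrite ltey; apply/eqP => gx.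
  have := @ae_on_set R I _ `]0%R, x]%classic (lmeas_itv _) (itv_interval0 (lexx _) xa) gfin.
  rewrite leb_itv_oc ?ltW// subr0 => H.
  have : x%:E = 0.
    apply: H => y /=; rewrite in_itv/= => /andP[_ yx].
    have -> : rearr leb I g y = +oo by apply/eqP; rewrite -leye_eq -gx; exact: rearr_antitone.
    by [].
  by case=> x00; move: x0; rewrite x00 ltxx.
have q0 x : (0 <= q x)%R by rewrite fine_ge0// rearr_ge0.
have qanti x y : I x -> I y -> (x <= y)%R -> (q y <= q x)%R by exact: (star_anti g_fin).
have mvI : L0 I v by exact: dw_L0 hv.
apply: le_trans (hardy_littlewood_leb (ltW (dw_pos hw)) mf mg) _.
have mp' : lebesgue_mfun I (fun x => (`|p x| * `|q x| * v x)%R%:E).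
  have EM (k l : R -> R) : lebesgue_mfun I (EFin \o k) -> lebesgue_mfun I (EFin \o l) ->
      lebesgue_mfun I (EFin \o (fun x => (k x * l x)%R)).
    by move=> mk ml; exact: (lmfunM mk ml).
  have mv' : lebesgue_mfun I (EFin \o v) by exact: dw_lmfun hv.
  have mpa : lebesgue_mfun I (EFin \o (fun x => `|p x|%R)) by apply/lmfun_EFin; exact: L0_normr.
  have mqa : lebesgue_mfun I (EFin \o (fun x => `|q x|%R)) by apply/lmfun_EFin; exact: L0_normr.
  exact: (EM _ _ (EM _ _ mpa mqa) mv').
apply: (@le_trans _ _ (\int[leb]_(x in I) (`|p x| * `|q x| * v x)%R%:E)).
  (* Wherever [f*/v] is finite, [f* g* = p q v], the form that Hardy-Littlewood for [v dm]
     accepts. *)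
  apply: int_ae_le => //.
  - by apply: lmfunM; exact: lmfun_rearr.
  - by move=> x _; rewrite mule_ge0 ?rearr_ge0.
  - by move=> x Ix; rewrite lee_fin mulr_ge0 ?mulr_ge0// ltW// v0.
  apply: (ae_onS2 _ hfin hfin) => x Ix hx _.
  have vx := v0 x Ix.
  have -> : rearr leb I g x = (q x)%:E by exact: starE (g_fin x Ix).
  have -> : rearr leb I f x = (p x * v x)%R%:E.
    have hE : hf x = (p x)%:E by rewrite /p/= fineK.
    by rewrite EFinM -hE /hf -muleA -EFinM mulVf ?mule1// gt_eqF.
  have p0 : (0 <= p x)%R.
    by rewrite fine_ge0// /hf mule_ge0 ?rearr_ge0// lee_fin invr_ge0 ltW.
  by rewrite -EFinM lee_fin !ger0_norm ?q0// mulrAC.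
have vI x : I x -> (0 <= v x)%R by exact: (dw_ge0 hv).
apply: le_trans (hardy_littlewood_on mI mvI vI (fun _ _ _ => erefl) mp mq density_total_le) _.
(* [qw] lies in the unit ball of [E] because [g] lies in that of [Lambda], so it tests the dual norm
   of [pv]. *)
apply: (@le_trans _ _ (\int[leb]_(t in J) `|fine (pv t) * fine (qw t)|%:E)); last first.
  by apply: ereal_sup_ubound; exists (fine \o qw).
apply: int_ae_le => //.
- by apply: lmfunM; exact: lmfun_rearr.
- apply/lmfun_EFin/L0_normr; apply: measurable_funM; first exact: mpv.
  exact: (bfs_measurable bfs).
- by move=> t _; rewrite mule_ge0 ?rearr_ge0.
apply: (ae_onS2 _ pfin qfin) => t Jt pt qt.
have pvt : rearr (density v) I p t = (fine (pv t))%:E by exact: (esym (fineK pt)).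
have qwt : rearr (density v) I q t <= (fine (qw t))%:E.
  rewrite (fineK qt); apply: rearr_density_le; [exact: mq|by move=> x _; exact: q0|exact: qanti].
have c0 : (0 <= fine (pv t))%R by rewrite fine_ge0// rearr_ge0.
have d0 : (0 <= fine (qw t))%R by rewrite fine_ge0// rearr_ge0.
rewrite pvt; move: (fine (pv t)) (fine (qw t)) qwt c0 d0 => c d qwt c0 d0.
rewrite ger0_norm ?mulr_ge0// EFinM; exact: lee_wpmul2l.
Qed.

End admissible_weights.

Lemma rearr_zero {R : realType} (mu : set R -> \bar R) (D : set R) (f : R -> R)
    (t : R) : lebesgue_measurable D -> (forall x, D x -> f x = 0%R) ->
  mu set0 <= t%:E -> rearr mu D f t = 0.
Proof.
move=> mD f0 mu0; apply/eqP; rewrite eq_le rearr_ge0 andbT; apply: rearr_le => // s s0.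
rewrite /tail (_ : _ `&` _ = set0)//; apply/seteqP; split => // x [Dx /=].
by rewrite f0// normr0 ltNge (ltW s0).
Qed.

Section kothe_duality.
Context {R : realType}.
Variables (a : \bar R) (w : R -> R) (E : fspace R).
Local Notation I := (interval0 a).
Let b := \int[leb]_(x in I) (w x)%:E.
Local Notation J := (interval0 b).
Hypothesis hw : decreasing_weight a w.
Hypothesis w_gt0 : forall x, I x -> (0 < w x)%R.
Hypotheses (fsE : fully_symmetric J E) (supE : has_support J E).

(** A supremum over the empty set would be [-oo]; the zero function lies in the unit ball and
    excludes this. *)
Lemma kothe_gauge_Lambda_ge0 f : 0 <= kothe_gauge I (Lambda I J E w) f.
Proof.
have bfs := fs_bfs fsE.
have mI : lebesgue_measurable I by exact: lmeas_interval0.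
have r0 t : I t -> rearr leb I (cst 0%R) t = 0.
  by move=> [t0 _]; apply: rearr_zero => //; rewrite leb0 lee_fin ltW.
have q0 t : J t -> rearr (density w) I (fine \o rearr leb I (cst 0%R)) t = 0.
  move=> [t0 _]; apply: rearr_zero => //; first by move=> x Ix /=; rewrite r0.
  by rewrite /density int_set0 lee_fin ltW.
have g0 : gauge E (cst 0%R) = 0.
  have := bfs_normZ bfs 0%R (bfs_0 bfs); rewrite normr0 mul0e => <-.
  by congr (gauge E _); apply/funext => x /=; rewrite mul0r.
have [L0 Lg] : carrier (Lambda I J E w) (cst 0%R) /\
    gauge (Lambda I J E w) (cst 0%R) <= gauge E (cst 0%R).
  apply: Lambda_mem.
  - exact: measurable_cst.
  - exact: fsE.
  - by move=> t It; rewrite r0// ltry.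
  - by move=> t Jt; rewrite q0// ltry.
  - exact: (bfs_0 bfs).
  - move=> x Jx; rewrite (@int_eq _ _ _ (cst 0)).
      rewrite int_cst; last exact: lmeas_itv.
      by rewrite mul0e; apply: int_ge0 => t _; exact: rearr_ge0.
    move=> t /= tx; apply: rearr_zero; [exact: lmeas_interval0|by move=> y Jy /=; rewrite q0|].
    by rewrite leb0 lee_fin; move: tx; rewrite in_itv/= => /andP[/ltW].
apply: le_trans (ereal_sup_ubound _); last first.
  by exists (cst 0%R) => //; split => //; apply: le_trans Lg _; rewrite g0 lee01.
by apply: int_ge0.
Qed.

(** The level weight works with [N] equal to the dual norm itself, so the infimum that defines the
    gauge of [Pspace] is attained. *)
Lemma exists_admissible f : L0 I f -> kothe_gauge I (Lambda I J E w) f < +oo ->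
  exists v, [/\ admissible I w v, carrier (Mspace I J (kothe_dual J E) v) f &
    gauge (Mspace I J (kothe_dual J E) v) f <= kothe_gauge I (Lambda I J E w) f].
Proof.
move=> mf foo; set N := fine (kothe_gauge I (Lambda I J E w) f).
have NE : kothe_gauge I (Lambda I J E w) f = N%:E.
  by rewrite fineK// ge0_fin_numE// kothe_gauge_Lambda_ge0.
have fN : kothe_gauge I (Lambda I J E w) f <= N%:E by rewrite NE.
pose v := level_weight a (star a f) w; exists v.
have hv : decreasing_weight a v by exact: (dual_weight_decreasing hw w_gt0 fsE supE mf fN).
have v0 x : I x -> (0 < v x)%R by exact: (dual_weight_gt0 hw w_gt0 fsE supE mf fN).
have vW x : I x -> \int[leb]_(t in `]0%R, x]) (v t)%:E <= (primitive w x)%:E.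
  exact: (dual_weight_le hw w_gt0 fsE supE mf fN).
have adm : admissible I w v.
  split; first by split => //; exact: dw_anti hv.
  move=> x Ix; have [x0 xa] := Ix.
  apply: le_trans (int_rearr_le hv Ix) _; apply: le_trans (vW x Ix) _.
  by rewrite -(primitiveE hw xa); exact: int_le_rearr.
set hf := (fun x => rearr leb I f x * ((v x)^-1)%:E).
pose p := fine \o hf; pose rho := rearr (density v) I p.
have hfin : ae_on I (fun x => hf x \is a fin_num).
  apply: ae_onW => x Ix; rewrite /hf.
  by rewrite (dual_quotientE hw w_gt0 fsE supE mf fN Ix).
have mp : L0 I p by exact: (dual_quotient_L0 hw w_gt0 fsE supE mf fN).
have rho_fin t : J t -> rho t \is a fin_num.
  move=> Jt; rewrite ge0_fin_numE ?rearr_ge0//.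
  exact: (dual_quotient_rearr_fin hw w_gt0 fsE supE mf fN Jt).
have mrho : L0 J (fine \o rho).
  apply: lmeas_antitoneR; first exact: interval0_is_interval.
  by move=> x y Jx Jy xy /=; rewrite fine_le ?rho_fin//; exact: rearr_antitone.
have rhoN : kothe_gauge J E (fine \o rho) <= N%:E.
  apply: ge_ereal_sup => _ [g [Eg g1] <-].
  exact: (dual_quotient_test hw w_gt0 fsE supE mf fN Eg g1).
have Fv : carrier (weighted_space I J (kothe_dual J E) v) p.
  split => //; split; first exact: ae_onW.
  by split => //=; apply: le_lt_trans rhoN _; rewrite ltry.
have Mf : carrier (Mspace I J (kothe_dual J E) v) f by [].
split => //.
by rewrite NE /Mspace/guarded/= asboolT// asboolT.
Qed.

Lemma kothe_dual_Lambda : isometrically_equal (kothe_dual I (Lambda I J E w))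
  (Pspace I J (kothe_dual J E) w).
Proof.
have lower f v : admissible I w v ->
    kothe_gauge I (Lambda I J E w) f <= gauge (Mspace I J (kothe_dual J E) v) f.
  move=> adm; have [hv vW] := admissible_primitive hw adm.
  have [Mf|nMf] := pselect (carrier (Mspace I J (kothe_dual J E) v) f).
    by apply: (kothe_gauge_le_Mspace hw hv vW (fs_bfs fsE) _ Mf); exact: adm.1.1.
  (* Outside the class the gauge is [+oo]. *)
  by rewrite /Mspace/guarded/= asboolF// leey.
have carE : carrier (kothe_dual I (Lambda I J E w)) =
    carrier (Pspace I J (kothe_dual J E) w).
  apply/seteqP; split => f /=.
    by move=> [mf foo]; have [v [adm Mf _]] := exists_admissible mf foo; exists v.
  move=> [v adm Mf]; split; first by case: Mf.
  apply: le_lt_trans (lower f v adm) _.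
  have [_ [_ Fv]] := Mf; have [_ [_ [_ foo]]] := Fv.
  by rewrite /Mspace/guarded/= asboolT// asboolT.
split => // f [mf foo] /=; apply/eqP; rewrite eq_le; apply/andP; split.
  by apply: le_ereal_inf_tmp => _ [v adm <-]; exact: lower.
have [v [adm Mf vN]] := exists_admissible mf foo.
by apply: le_trans vN; apply: ereal_inf_lbound; exists v.
Qed.

End kothe_duality.

Theorem corollary7p8 (R : realType) (a : \bar R) (w : R -> R) (E : fspace R) :
  let I := interval0 a in
  let b := \int[leb]_(x in I) (w x)%:E in
  let J := interval0 b in
  0 < a ->
  pos_decreasing I w ->
  (forall t, I t -> \int[leb]_(x in `]0%R, t]) (w x)%:E < +oo) ->
  fully_symmetric J E ->
  has_support J E ->
  isometrically_equal (kothe_dual I (Lambda I J E w))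
                      (Pspace I J (kothe_dual J E) w).
Proof.
move=> I b J a0 [w0 wanti] wfin fsE supE.
apply: kothe_dual_Lambda => //.
by split => // x /w0/ltW.
Qed.
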